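(* Let $l,N,K\ge1$, let $\mu=(\mu_1,\dots,\mu_l)$ be a generalized partition with $l$ entries, and let $\lambda$ be a generalized partition of length less than $l+N$, regarded as $\lambda=(\lambda_1,\dots,\lambda_{l+N})$ by appending zeros. Let $x^{\pm}=(x_1^{\pm1},\dots,x_N^{\pm1})$ and $y=(y_1,\dots,y_K)$. Then $$\sum_{\rho=(\rho_1,\dots,\rho_{l+N})}so_{\rho/\mu}(x^{\pm})\,SO^*_{\rho/\lambda}(y)=\prod_{i=1}^N\prod_{j=1}^K\frac{1}{(1-x_iy_j)(1-x_i^{-1}y_j)}\sum_{\tau=(\tau_1,\dots,\tau_l)}so_{\lambda/\tau}(x^{\pm})\,SO^*_{\mu/\tau}(y),$$ where the sums run over all generalized partitions $\rho$ with $l+N$ entries and all generalized partitions $\tau$ with $l$ entries (an identity of formal power series in $y$ with coefficients Laurent polynomials in $x$).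
   Context: A generalized partition is a weakly decreasing finite sequence of nonnegative integers (zeros allowed; the number of entries is recorded); its length is the number of its nonzero entries. The functions $f_n(y)$ are defined by $\prod_{j=1}^K\frac{1}{(1-y_jz)(1-y_jz^{-1})}=\sum_{n\in\mathbb Z}f_n(y)z^n$, expanded as power series in $y$. For generalized partitions $\alpha,\beta$ with the same number $m$ of entries, $$SO^*_{\alpha/\beta}(y)=\det\big(f_{\beta_i-\alpha_j-i+j}(y)-f_{\beta_i+\alpha_j-i-j+2m+1}(y)\big)_{1\le i,j\le m}.$$ For $\mu$ with $l$ entries and $\rho$ with $l+N$ entries, the skew odd orthogonal character is $so_{\rho/\mu}(x^{\pm})=\langle\mu^{so}|\Gamma_+(x^{\pm})|\rho^{so}\rangle$, with the following definitions. Heisenberg algebra: generators $a_n$ ($n\in\mathbb Z\setminus\{0\}$) with $[a_m,a_n]=m\delta_{m,-n}$. The Fock space $\mathcal M$ is generated by the vacuum $|0\rangle$ with $a_n|0\rangle=0$ for $n>0$ (so $\mathcal M\cong\mathbb C[a_{-1},a_{-2},\dots]$), and $\langle 0|$ is the dual vacuum, a linear functional on $\mathcal M$ with $\langle 0|a_{-n}=0$ for $n>0$ and $\langle 0|1|0\rangle=1$. Vertex operators: $$U(z)=(1+z)\exp\Big(\sum_{n\ge1}\tfrac{a_{-n}}{n}z^n\Big)\exp\Big(-\sum_{n\ge1}\tfrac{a_n}{n}(z^n+z^{-n})\Big)=\sum_{n\in\mathbb Z}U_nz^{-n},$$ $$U^*(z)=(1-z)\exp\Big(-\sum_{n\ge1}\tfrac{a_{-n}}{n}z^n\Big)\exp\Big(\sum_{n\ge1}\tfrac{a_n}{n}(z^n+z^{-n})\Big)=\sum_{n\in\mathbb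 Z}U^*_nz^{n}.$$ For $\lambda=(\lambda_1,\dots,\lambda_k)$, $|\lambda^{so}\rangle=U_{-\lambda_1}\cdots U_{-\lambda_k}|0\rangle$ and $\langle\lambda^{so}|=\langle0|U^*_{-\lambda_k}\cdots U^*_{-\lambda_1}$ (the latter depends on the number $k$ of entries). Finally $\Gamma_+(z)=\exp\big(\sum_{n\ge1}\frac{a_n}{n}z^n\big)$ and $\Gamma_+(x^{\pm})=\prod_{i=1}^N\Gamma_+(x_i)\Gamma_+(x_i^{-1})$. *)

(* Defs.v *)
From HB Require Import structures.
From mathcomp Require Import all_boot all_order all_algebra.
From mathcomp Require Import finmap.
From mathcomp Require Import boolp classical_sets cardinality fsbigop.
From mathcomp Require Import reals complex.
From mathcomp Require monalg.
From mathcomp Require Import mpoly.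

Set Implicit Arguments.
Unset Strict Implicit.
Unset Printing Implicit Defensive.

Import GRing.Theory.

Local Open Scope ring_scope.

(** * Generalized partitions *)

Record genpart (m : nat) := GenPart {
  gp_val :> m.-tuple nat;
  _ : sorted geq gp_val
}.

HB.instance Definition _ m := [isSub for @gp_val m].
HB.instance Definition _ m := [Choice of genpart m by <:].

Definition gp_length m (lambda : genpart m) : nat :=
  count (fun p => p != 0)%N lambda.

(** * Formal power series in [K] variables
    A series is its family of coefficients; the product is the Cauchy product
    (same formula as [mcoeffM]).  A series is invertible when it has an inverse
    in the ring, so [f^-1] is the usual inverse of power series. *)

Record fps (K : nat) (F : comNzRingType) := Fps { fps_coef : 'X_{1..K} -> F }.

HB.instance Definition _ K F := gen_eqMixin (fps K F).
HB.instance Definition _ K F := gen_choiceMixin (fps K F).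

Section FpsRing.
Variables (K : nat) (F : comNzRingType).
Implicit Types (f g h : fps K F) (m : 'X_{1..K}) (p q r : {mpoly F[K]}).

Lemma fpsP f g : (forall m, fps_coef f m = fps_coef g m) -> f = g.
Proof. by case: f g => f [g] /= /funext ->. Qed.

Definition fpsC (c : F) : fps K F := Fps (fun m => c *+ (m == 0%MM)).
Definition fpsX (j : 'I_K) : fps K F := Fps (fun m => (m == U_(j)%MM)%:R).

Definition fps_add f g := Fps (fun m => fps_coef f m + fps_coef g m).
Definition fps_opp f := Fps (fun m => - fps_coef f m).
Definition fps_mul f g := Fps (fun m =>
  \sum_(k : 'X_{1..K < (mdeg m).+1, (mdeg m).+1} | m == (k.1 + k.2)%MM)
    fps_coef f k.1 * fps_coef g k.2).

Fact fps_addA : associative fps_add.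
Proof. by move=> f g h; apply: fpsP => m /=; rewrite addrA. Qed.
Fact fps_addC : commutative fps_add.
Proof. by move=> f g; apply: fpsP => m /=; rewrite addrC. Qed.
Fact fps_add0 : left_id (fpsC 0) fps_add.
Proof. by move=> f; apply: fpsP => m /=; rewrite mul0rn add0r. Qed.
Fact fps_addN : left_inverse (fpsC 0) fps_opp fps_add.
Proof. by move=> f; apply: fpsP => m /=; rewrite mul0rn addNr. Qed.

HB.instance Definition _ :=
  GRing.isZmodule.Build (fps K F) fps_addA fps_addC fps_add0 fps_addN.

Definition fps_trunc (d : nat) f : {mpoly F[K]} :=
  \sum_(m : 'X_{1..K < d}) fps_coef f m *: 'X_[m].

Lemma fps_truncE d f m : (mdeg m < d)%N -> (fps_trunc d f)@_m = fps_coef f m.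
Proof.
move=> lt_md; rewrite /fps_trunc raddf_sum /=.
rewrite (bigD1 (BMultinom lt_md)) //= mcoeffZ mcoeffX eqxx mulr1.
rewrite big1 ?addr0 // => k ne_k; rewrite mcoeffZ mcoeffX.
case: eqP => [eq_k|_]; last by rewrite mulr0.
by case/eqP: ne_k; apply: val_inj.
Qed.

Lemma mcoeffM_agree d p q r m :
    (forall k, (mdeg k < d)%N -> p@_k = q@_k) -> (mdeg m < d)%N ->
  (p * r)@_m = (q * r)@_m.
Proof.
move=> eq_pq lt_md; rewrite !mcoeffM; apply: eq_bigr => k /eqP def_m.
have := congr1 (@mdeg K) def_m; rewrite mdegD => def_dm.
rewrite eq_pq //; apply: leq_ltn_trans lt_md.
by apply: leq_trans (leq_addr (mdeg k.2) _) (eq_leq (esym def_dm)).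
Qed.

Lemma fps_mulE d f g m : (mdeg m < d)%N ->
  fps_coef (fps_mul f g) m = (fps_trunc d f * fps_trunc d g)@_m.
Proof.
move=> lt_md; rewrite mcoeffM /=; apply: eq_bigr => k /eqP def_m.
have := congr1 (@mdeg K) def_m; rewrite mdegD => def_dm.
have le1 := leq_trans (leq_addr (mdeg k.2) (mdeg k.1)) (eq_leq (esym def_dm)).
have le2 := leq_trans (leq_addl (mdeg k.1) (mdeg k.2)) (eq_leq (esym def_dm)).
by rewrite !fps_truncE //; apply: leq_ltn_trans lt_md.
Qed.

Fact fps_mulC : commutative fps_mul.
Proof.
by move=> f g; apply: fpsP => m; rewrite !(fps_mulE _ _ (ltnSn _)) mulrC.
Qed.

Fact fps_mulA : associative fps_mul.
Proof.
move=> f g h; apply: fpsP => m; have lt_m := ltnSn (mdeg m).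
have tr f1 f2 k : (mdeg k < (mdeg m).+1)%N ->
  (fps_trunc (mdeg m).+1 (fps_mul f1 f2))@_k =
  (fps_trunc (mdeg m).+1 f1 * fps_trunc (mdeg m).+1 f2)@_k.
  by move=> lt_k; rewrite fps_truncE // -fps_mulE.
rewrite fps_mulC !(fps_mulE _ _ lt_m).
by rewrite !(mcoeffM_agree _ (@tr _ _) lt_m) mulrC mulrA.
Qed.

Fact fps_mul1 : left_id (fpsC 1) fps_mul.
Proof.
move=> f; apply: fpsP => m; have lt_m := ltnSn (mdeg m).
rewrite (fps_mulE _ _ lt_m) -[in RHS](fps_truncE _ lt_m) -[in RHS](mul1r (fps_trunc _ _)).
by apply: mcoeffM_agree lt_m => k lt_k; rewrite fps_truncE // mcoeff1.
Qed.

Fact fps_mulDl : left_distributive fps_mul fps_add.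
Proof.
move=> f g h; apply: fpsP => m /=; rewrite -big_split /=.
by apply: eq_bigr => k _; rewrite mulrDl.
Qed.

Fact fps_oner_neq0 : fpsC 1 != fpsC 0.
Proof.
apply/eqP => /(congr1 (fun f => fps_coef f 0%MM)) /= /eqP.
by rewrite eqxx !mulr1n oner_eq0.
Qed.

HB.instance Definition _ := GRing.Zmodule_isComNzRing.Build (fps K F)
  fps_mulA fps_mulC fps_mul1 fps_mulDl fps_oner_neq0.

Definition fps_unit : pred (fps K F) := fun f => `[< exists g, g * f = 1 >].
Definition fps_inv f : fps K F :=
  if pselect (exists g, g * f = 1) is left ex then sval (cid ex) else f.

Fact fps_mulVf : {in fps_unit, left_inverse 1 fps_inv *%R}.
Proof.
move=> f; rewrite unfold_in /fps_inv => /asboolP ex.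
by case: pselect => // ex'; case: cid.
Qed.
Fact fps_unitPl f g : g * f = 1 -> fps_unit f.
Proof. by move=> gf1; apply/asboolP; exists g. Qed.
Fact fps_inv_out : {in [predC fps_unit], fps_inv =1 id}.
Proof.
move=> f; rewrite inE unfold_in /fps_inv => /asboolPn nex.
by case: pselect.
Qed.

HB.instance Definition _ := GRing.ComNzRing_hasMulInverse.Build (fps K F)
  fps_mulVf fps_unitPl fps_inv_out.

(** Infinite sums of power series: coefficientwise, each coefficient receiving
    finitely many nonzero contributions.  [fps_sum u] is meaningful only when
    [fps_summable u] holds. *)

Definition fps_summable (I : choiceType) (u : I -> fps K F) : Prop :=
  forall m, finite_set [set i | fps_coef (u i) m != 0]%classic.

Definition fps_sum (I : choiceType) (u : I -> fps K F) : fps K F :=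
  Fps (fun m => \sum_(i \in [set: I]%classic) fps_coef (u i) m).

(** * The series [f_n(y)] and the determinants [SO*]
    [f_ser n] is the coefficient of [z^n] in the product of the geometric series
    [1/(1 - y_j z) = \sum_(n >= 0) y_j^n z^n] and
    [1/(1 - y_j z^-1) = \sum_(n >= 0) y_j^n z^-n].  A two-sided series in [z]
    over the power series in [y] is a function on [int]. *)

Definition zser := int -> fps K F.

Definition zser_one : zser := fun n => (n == 0)%:R.

Definition zser_mul (a b : zser) : zser :=
  fun n => fps_sum (fun i : int => a i * b (n - i)).

Definition zgeom (j : 'I_K) : zser :=
  fun n => if n is Posz k then fpsX j ^+ k else 0.

Definition zgeomV (j : 'I_K) : zser := fun n => zgeom j (- n).

Lemma zgeom_inverse j n :
  zgeom j n - fpsX j * zgeom j (n - 1) = zser_one n.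
Proof.
rewrite /zser_one; case: n => [[|n]|n].
- by rewrite sub0r /= mulr0 subr0 expr0.
- have -> : n.+1%:Z - 1 = n%:Z by rewrite -addn1 PoszD addrK.
  by rewrite /= exprS subrr.
- have -> : Negz n - 1 = Negz n.+1 by rewrite !NegzE -opprD -PoszD addn1.
  by rewrite /= mulr0 subrr.
Qed.

Definition f_ser : zser :=
  \big[zser_mul/zser_one]_(j < K) zser_mul (zgeom j) (zgeomV j).

(** [SOstar K F alpha beta] is SO*_{alpha/beta}.  The matrix indices [i], [j] here
    start at 0, whence the successors. *)

Definition SOstar (m : nat) (alpha beta : genpart m) : fps K F :=
  \det (\matrix_(i < m, j < m)
    (f_ser ((tnth beta i)%:Z - (tnth alpha j)%:Z - i.+1%:Z + j.+1%:Z)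
     - f_ser ((tnth beta i)%:Z + (tnth alpha j)%:Z - i.+1%:Z - j.+1%:Z
           + (2 * m)%:Z + 1))).

End FpsRing.

Arguments fpsC {K F}.
Arguments fpsX {K F}.
Arguments f_ser {K F}.
Arguments SOstar K F {m}.

(** * Fock space and Heisenberg algebra
    The Fock space is the polynomial ring in the variables [a_{-n}], [n >= 1],
    with vacuum [1]; the variable of index [k : nat] stands for [a_{-(k+1)}]. *)

Section Fock.
Import monalg.
Variable F : fieldType.

Local Notation fock := {malg F[{cmonom nat}]}.

Definition vac : fock := 1.

(** [<0| v] is the constant coefficient of [v]. *)
Definition dual_vac (v : fock) : F := mcoeff (mone : {cmonom nat}) v.

Definition fock_var (k : nat) : fock := << ucm k >>.

(** Partial derivative with respect to the variable of index [k]. *)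
Definition fock_deriv (k : nat) (v : fock) : fock :=
  \sum_(m <- msupp v) << mcoeff m v *+ m k *g divcm m (ucm k) >>.

(** [Negz k] is [-(k+1)], so [heis (Negz k)] is the creation operator
    [a_{-(k+1)}], and [a_n] acts as [n d/da_{-n}] for [n > 0].  There is no
    generator [a_0]; [heis 0] is never used. *)
Definition heis (n : int) (v : fock) : fock :=
  match n with
  | Posz 0 => 0
  | Posz k.+1 => fock_deriv k v *+ k.+1
  | Negz k => fock_var k * v
  end.

Fact mcoeff_deriv k (v : fock) (m : {cmonom nat}) :
  mcoeff m (fock_deriv k v) = mcoeff (mmul m (ucm k)) v *+ (m k).+1.
Proof.
have cmMU (m' : {cmonom nat}) i : mmul m' (ucm k) i = (m' i + (k == i))%N.
  by rewrite cmM cmU.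
rewrite /fock_deriv (raddf_sum (mcoeff m)) /=.
under eq_bigr do rewrite mcoeffU.
have uniqM m' : m' != mmul m (ucm k) ->
    mcoeff m' v *+ m' k *+ (divcm m' (ucm k) == m) = 0.
  move=> ne; case: eqP => [def_m|//]; case: (posnP (m' k)) => [->|m'k] //.
  case/eqP: ne; apply/eqP/cmP => i; rewrite cmMU -def_m divcmE cmU.
  by case: eqP m'k => [<-|_ _]; rewrite ?subn0 ?addn0 // => /subnK.
case: (boolP (mmul m (ucm k) \in msupp v)) => [in_v|out_v].
  rewrite (bigD1_seq (mmul m (ucm k))) ?fset_uniq //= big1 ?addr0; last first.
    by move=> m' ne; apply: uniqM.
  rewrite cmMU eqxx addn1; case: eqP => [//|[]]; apply/eqP/cmP => i.
  by rewrite divcmE cmMU cmU addnK.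
rewrite (mcoeff_outdom out_v) mul0rn big1_seq // => m' /= in_v.
by apply: uniqM; apply: contra out_v => /eqP <-.
Qed.

Fact mcoeff_varM k (v : fock) (m : {cmonom nat}) :
  mcoeff (mmul (ucm k) m) (fock_var k * v) = mcoeff m v.
Proof.
rewrite /fock_var malgM_def fgmulUg (raddf_sum (mcoeff _)) /=.
under eq_bigr => m' _ do rewrite mcoeffU mul1r.
have uniqM m' : m' != m -> (mmul (ucm k) m' == mmul (ucm k) m) = false.
  apply: contraNF => /cmP eq_m; apply/cmP => i; have := eq_m i.
  by rewrite !cmM => /addnI.
case: (boolP (m \in msupp v)) => [in_v|out_v].
  rewrite (bigD1_seq m) ?fset_uniq //= eqxx big1 ?addr0 //.
  by move=> m' ne; rewrite uniqM.
rewrite (mcoeff_outdom out_v) big1_seq // => m' /= in_v.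
by rewrite uniqM //; apply: contra out_v => /eqP <-.
Qed.

Fact mcoeff_varM0 k (v : fock) (m : {cmonom nat}) :
  m k = 0%N -> mcoeff m (fock_var k * v) = 0.
Proof.
move=> mk0; rewrite /fock_var malgM_def fgmulUg (raddf_sum (mcoeff _)) /=.
rewrite big1 // => m' _; rewrite mcoeffU; case: eqP => // def_m.
by move: mk0; rewrite -def_m cmM cmU eqxx.
Qed.

Fact cm_splitU k (m : {cmonom nat}) :
  m k != 0%N -> {m' | m = mmul (ucm k) m'}.
Proof.
move=> mk; exists (divcm m (ucm k)); apply/eqP/cmP => i.
rewrite cmM divcmE cmU; case: (eqVneq k i) => [<-|_]; last by rewrite subn0.
by rewrite subnKC // lt0n.
Qed.

Fact heis_deriv_var i j (v : fock) :
  fock_deriv i (fock_var j * v) - fock_var j * fock_deriv i v =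
  v *+ (i == j).
Proof.
apply/malgP => m; rewrite mcoeffB mcoeffMn mcoeff_deriv.
case: (eqVneq (m j) 0%N) => [mj|/cm_splitU[m' ->]].
  rewrite (mcoeff_varM0 _ mj) subr0; case: eqVneq => [eq_ij|ne_ij].
    by rewrite eq_ij mj mulmC mcoeff_varM.
  by rewrite mcoeff_varM0 ?mul0rn // cmM cmU mj (negPf ne_ij).
rewrite -mulmA !mcoeff_varM mcoeff_deriv cmM cmU.
case: eqVneq => [<-|ne_ij]; last by rewrite add0n subrr.
by rewrite mulmC add1n mulrS addrK.
Qed.

(** [[a_m, a_n] = m delta_{m,-n}] *)
Lemma heis_comm (m n : int) (v : fock) : m != 0 -> n != 0 ->
  heis m (heis n v) - heis n (heis m v) = if m == - n then v *~ m else 0.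
Proof.
have derivMn i (w : fock) c : fock_deriv i (w *+ c) = fock_deriv i w *+ c.
  by apply/malgP => k; rewrite mcoeff_deriv [RHS]mcoeffMn mcoeff_deriv mcoeffMn mulrnAC.
have derivC i j (w : fock) :
    fock_deriv i (fock_deriv j w) = fock_deriv j (fock_deriv i w).
  have dd i' j' k : mcoeff k (fock_deriv i' (fock_deriv j' w)) =
      mcoeff (mmul (mmul k (ucm i')) (ucm j')) w
        *+ (k j' + (i' == j')).+1 *+ (k i').+1.
    by rewrite mcoeff_deriv mcoeff_deriv cmM cmU.
  apply/malgP => k; rewrite [LHS]dd [RHS]dd.
  case: (eqVneq i j) => [->|_]; first by [].
  by rewrite 2!addn0 mulrnAC -!mulmA (mulmC (ucm i)).
case: m n => [[|i]|i] [[|j]|j] // _ _.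
- by rewrite /= 2!derivMn derivC mulrnAC subrr.
- rewrite NegzE opprK eqz_nat eqSS /= mulrnAr -mulrnBl heis_deriv_var.
  by case: eqP => [_|_]; rewrite ?mulr1n // mulr0n mul0rn.
- rewrite NegzE eqr_opp eqz_nat eqSS eq_sym /= mulrnAr -mulrnBl.
  rewrite -opprB heis_deriv_var; case: eqP => [->|_].
    by rewrite mulr1n mulNrn.
  by rewrite mulr0n oppr0 mul0rn.
- have -> : heis (Negz i) (heis (Negz j) v) = heis (Negz j) (heis (Negz i) v).
    exact: mulrCA.
  by rewrite subrr.
Qed.

Lemma heis_vac (n : nat) : heis n vac = 0.
Proof.
case: n => [//|k]; rewrite /heis; have -> : fock_deriv k vac = 0.
  apply/malgP => m; rewrite mcoeff_deriv mcoeff0 mcoeff1 cmM_eq1 cm1_eq1.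
  by rewrite andbF mul0rn.
exact: mul0rn.
Qed.

Lemma dual_vac_heis (k : nat) (v : fock) : dual_vac (heis (Negz k) v) = 0.
Proof. by apply: mcoeff_varM0; rewrite cm1. Qed.

Lemma dual_vac_vac : dual_vac vac = 1.
Proof. by rewrite /dual_vac mcoeff1 eqxx. Qed.

(** * Formal distributions of operators
    [A : zop] is the formal distribution [\sum_(n in Z) (A n) z^n].  All the
    sums below are finite for the operators they are applied to. *)

Definition zop := int -> fock -> fock.

Definition zop_mul (A B : zop) : zop :=
  fun n v => \sum_(i \in [set: int]%classic) A (n - i) (B i v).

Definition zop_one : zop := fun n v => if n == 0 then v else 0.

Definition zop_exp (A : zop) : zop := fun n v =>
  \sum_(j \in [set: nat]%classic)
    (j`!%:R : F)^-1 *: iter j (zop_mul A) zop_one n v.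

(** [\sum_(n >= 1) (a_{-n}/n) z^n] *)
Definition zcreate : zop := fun n v =>
  if 0 < n then (n%:~R : F)^-1 *: heis (- n) v else 0.

(** [\sum_(n >= 1) (a_n/n) (z^n + z^-n)] *)
Definition zannihil : zop := fun n v =>
  if n == 0 then 0 else (`|n|%:~R : F)^-1 *: heis `|n| v.

Definition zop_opp (A : zop) : zop := fun n v => - A n v.

(** [1 + c z] *)
Definition one_plus_z (c : F) : zop := fun n v =>
  if n == 0 then v else if n == 1 then c *: v else 0.

Definition Uz : zop :=
  zop_mul (one_plus_z 1)
    (zop_mul (zop_exp zcreate) (zop_exp (zop_opp zannihil))).

Definition Ustarz : zop :=
  zop_mul (one_plus_z (-1))
    (zop_mul (zop_exp (zop_opp zcreate)) (zop_exp zannihil)).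

(** [U(z) = \sum_n U_n z^-n] and [U*(z) = \sum_n U*_n z^n]. *)
Definition U (n : int) : fock -> fock := Uz (- n).
Definition Ustar (n : int) : fock -> fock := Ustarz n.

(** [U_{-lambda_1} ... U_{-lambda_k} |0>] *)
Definition ket m (lambda : genpart m) : fock :=
  foldr (fun p : nat => U (- p%:Z)) vac lambda.

(** [v |-> <0| U*_{-lambda_k} ... U*_{-lambda_1} v], where [U*_{-lambda_1}] acts
    first on [v]. *)
Definition bra m (lambda : genpart m) (v : fock) : F :=
  dual_vac (foldl (fun w (p : nat) => Ustar (- p%:Z) w) v lambda).

(** [\sum_(n >= 1) (a_n/n) w^n] and its exponential, for a scalar [w]. *)
Definition log_Gamma (w : F) (v : fock) : fock :=
  \sum_(n \in [set n | (0 < n)%N]%classic) (w ^+ n / n%:R) *: heis n%:Z v.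

Definition Gamma (w : F) (v : fock) : fock :=
  \sum_(j \in [set: nat]%classic) (j`!%:R : F)^-1 *: iter j (log_Gamma w) v.

Definition Gamma_pm N (x : 'I_N -> F) : fock -> fock :=
  \big[comp/id]_(i < N) (Gamma (x i) \o Gamma ((x i)^-1)).

(** [so x rho mu] is so_{rho/mu}(x^{+-1}). *)
Definition so N (x : 'I_N -> F) m k (rho : genpart m) (mu : genpart k) : F :=
  bra mu (Gamma_pm x (ket rho)).

End Fock.

(* Main.v *)
Require Import Defs.
From HB Require Import structures.
From mathcomp Require Import all_boot all_order all_algebra all_fingroup.
From mathcomp Require Import finmap.
From mathcomp Require Import boolp classical_sets cardinality fsbigop.
From mathcomp Require Import reals complex.
From mathcomp Require monalg.
From mathcomp Require Import mpoly.
From mathcomp Require Import zify ring.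

(** The exponential of [c * \sum_n a_n/n (z^n + z^-n)] is the substitution
    a_{-n} -> a_{-n} + c (z^n + z^-n), a ring morphism into polynomials in z + 1/z,
    so it acts entrywise on determinants.  With E(t) = exp(\sum_n a_{-n}/n t^n), the
    vector |rho^so> is the determinant of the coefficients of (1 + t) E(t) (t + 1/t)^j
    at t^(rho_a - a); Gamma_+ multiplies E by H(t) = \prod 1/((1 - x_i t)(1 - t/x_i)),
    and each U^* turns one column into coefficients of H.  Hence so_{rho/mu} is a
    determinant of order l + N in L_a = rho_a + l + N - 1 - a, with l columns
    h_{L - N - M_i} of H, M_i = mu_i + l - 1 - i, and N columns which, by partial
    fractions, are combinations of the sequences
    psi_m(L) = (x_m^(L+1) - x_m^-L) / (x_m - 1).
    By Cauchy-Binet both sums are determinants.  The matrix f_{u-v} - f_{u+v+1} has the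
    eigenvectors psi_m, with eigenvalues \sum_n f_n x_m^n, and it commutes with the h
    columns up to combinations of the psi_m, so column operations relate the two
    determinants.  All this is done modulo terms of degree d in y, where sums are finite. *)

Set Implicit Arguments.
Unset Strict Implicit.
Unset Printing Implicit Defensive.

Import GRing.Theory.

Local Open Scope ring_scope.

(** * The algebra underlying the Fock space *)

Section FockAlgebra.
Import monalg.
Variable F : fieldType.
Local Notation fock := {malg F[{cmonom nat}]}.
Implicit Types (u v : fock) (m : {cmonom nat}).

(** Summing a sequence against f_{u-v} - f_{u+v+1} over v >= 0 is convolution with f, applied to the
    extension of the sequence that is odd under k -> -1-k. As f is even, w^k and w^-k have the same
    eigenvalue, and psi_m is the combination of x_m^k and x_m^-k that is already odd: hence the
    eigenvectors. The entry h_{L-N-M} depends only on L - M, so moving L by r amounts to moving M by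
    -r, except where one of the two crosses -1/2. There, comparing h_n with h_{-n-2N} leaves
    multiples of psi_m and terms that the even f cancels. The prefactor of the theorem is the
    product of the eigenvalues. Partial fractions need x_m nonzero, x_m^2 different from 1 and the
    x_m + 1/x_m distinct, which holds for indeterminates in a fraction field. Identities between
    exponentials are reduced to equality of logarithmic derivatives for t d/dt, so no logarithm of a
    series is formed. *)

Lemma fock_deriv_is_additive k : zmod_morphism (@fock_deriv F k).
Proof.
move=> u v; apply/malgP => m; rewrite Defs.mcoeff_deriv [RHS]mcoeffB.
rewrite [X in _ = X - _]Defs.mcoeff_deriv [X in _ = _ - X]Defs.mcoeff_deriv.
by rewrite mcoeffB mulrnBl.
Qed.

Lemma fock_derivZ k c v : fock_deriv k (c *: v) = c *: fock_deriv k v.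
Proof.
apply/malgP => m; rewrite [LHS]Defs.mcoeff_deriv [RHS]mcoeffZ.
by rewrite [X in _ = _ * X]Defs.mcoeff_deriv [X in X *+ _]mcoeffZ mulrnAr.
Qed.

Lemma fock_deriv1 k : fock_deriv k (1 : fock) = 0.
Proof.
apply/malgP => m; rewrite Defs.mcoeff_deriv mcoeff0 mcoeff1 cmM_eq1 cm1_eq1.
by rewrite andbF mul0rn.
Qed.

Lemma fock_deriv_var i j v :
  fock_deriv i (fock_var F j * v) = fock_var F j * fock_deriv i v + v *+ (i == j).
Proof. by rewrite -heis_deriv_var addrC subrK. Qed.

Lemma fock_derivC i j v : fock_deriv i (fock_deriv j v) = fock_deriv j (fock_deriv i v).
Proof.
have dd i' j' m : mcoeff m (fock_deriv i' (fock_deriv j' v)) =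
    mcoeff (mmul (mmul m (ucm i')) (ucm j')) v *+ (m j' + (i' == j')).+1 *+ (m i').+1.
  by rewrite 2!Defs.mcoeff_deriv cmM cmU.
apply/malgP => m; rewrite [LHS]dd [RHS]dd.
case: (eqVneq i j) => [->|_]; first by [].
by rewrite 2!addn0 mulrnAC -!mulmA (mulmC (ucm i)).
Qed.

(** Every operator met below has a known commutator with multiplication by a variable, so two linear
    operators agree once they agree on 1 and obey the same rule on [fock_var F k * v]. *)
Lemma fock_ind (P : fock -> Prop) :
    (forall u v, P u -> P v -> P (u + v)) -> (forall c v, P v -> P (c *: v)) ->
    P 1 -> (forall k v, P v -> P (fock_var F k * v)) ->
  forall v, P v.
Proof.
move=> PD PZ P1 PX; suff Pm m : P << m >>.
  have scaleU (c : F) m : << c *g m >> = c *: << m >> :> fock.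
    apply/malgP => i; rewrite [RHS]mcoeffZ [LHS]mcoeffU [X in _ = _ * X]mcoeffU.
    by rewrite mulrnAr mulr1.
  move=> v; rewrite (monalgE v); elim/big_rec: _ => [|m u _ Pu].
    by rewrite -(scale0r 1); apply: PZ.
  exact: PD (eq_ind_r P (PZ _ _ (Pm m)) (scaleU _ m)) Pu.
elim: {m}(mdeg m) {-2}m (leqnn (mdeg m)) => [|d IH] m.
  by rewrite leqn0 mdeg_eq0 => /eqP ->.
case: (eqVneq (mdeg m) 0%N) => [/eqP|].
  by rewrite mdeg_eq0 => /eqP -> _.
rewrite mdeg_eq0 => /eqP m_neq1 le_md.
have [k mk] : exists k, m k != 0%N.
  apply/not_existsP => m0; apply: m_neq1; apply/eqP/cmP => i.
  by rewrite cm1; apply/eqP; move: (m0 i) => /negP; rewrite negbK.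
have [m' def_m] := cm_splitU mk; rewrite def_m.
have -> : << mmul (ucm k) m' >> = fock_var F k * << m' >>.
  by rewrite /fock_var malgM_def fgmulUU mulr1.
by apply: PX; apply: IH; move: le_md; rewrite def_m mdegM mdegU.
Qed.

Lemma dual_vac_zmod : zmod_morphism (@dual_vac F).
Proof. by move=> u v; rewrite /dual_vac mcoeffB. Qed.
HB.instance Definition _ :=
  GRing.isZmodMorphism.Build fock F (@dual_vac F) dual_vac_zmod.
Lemma dual_vac_monoid : monoid_morphism (@dual_vac F).
Proof. by split=> [|u v]; rewrite /dual_vac ?rmorph1 ?rmorphM. Qed.
HB.instance Definition _ :=
  GRing.isMonoidMorphism.Build fock F (@dual_vac F) dual_vac_monoid.

Lemma dual_vac_var k : dual_vac (fock_var F k) = 0.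
Proof. by rewrite -[fock_var F k]mulr1; apply: mcoeff_varM0; rewrite cm1. Qed.

Lemma dual_vacZ c : dual_vac (c%:A : fock) = c.
Proof. by rewrite /dual_vac mcoeffZ mcoeff1 eqxx mulr1. Qed.

Section FockHom.
Variables (S : comNzRingType) (iota : {rmorphism F -> S}) (a : nat -> S).

Definition monom_val (m : {cmonom nat}) : S := \prod_(i <- finsupp m) a i ^+ m i.

Lemma monom_val_wide (d : {fset nat}) m : (finsupp m `<=` d)%fset ->
  monom_val m = \prod_(i <- d) a i ^+ m i.
Proof.
move=> le_md; rewrite [LHS](big_fset_incl _ le_md) => //= i _.
by rewrite -cmE_eq0 => /eqP ->.
Qed.

Fact monom_val_morphism : mmorphism monom_val.
Proof.
split=> [m1 m2|]; last by rewrite /monom_val mdom1 big_seq_fset0.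
have le1 : (finsupp m1 `<=` finsupp m1 `|` finsupp m2)%fset by apply: fsubsetUl.
have le2 : (finsupp m2 `<=` finsupp m1 `|` finsupp m2)%fset by apply: fsubsetUr.
rewrite (monom_val_wide le1) (monom_val_wide le2) -big_split.
rewrite (@monom_val_wide (finsupp m1 `|` finsupp m2)%fset) ?mdomD //=.
by apply: eq_bigr => i _; rewrite cmM exprD.
Qed.
HB.instance Definition _ := isMultiplicative.Build _ _ monom_val monom_val_morphism.

Definition fock_hom : fock -> S := mmap iota monom_val.
HB.instance Definition _ := GRing.RMorphism.on fock_hom.

Lemma fock_hom_var k : fock_hom (fock_var F k) = a k.
Proof.
rewrite /fock_hom /fock_var mmapU /= rmorph1 mul1r /monom_val mdomU big_seq_fset1.
by rewrite cmUU expr1.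
Qed.

Lemma fock_homZ c v : fock_hom (c *: v) = iota c * fock_hom v.
Proof. exact: mmapZ. Qed.

End FockHom.

End FockAlgebra.

(** * Power series in one variable *)

Record ser (R : comNzRingType) := Ser { scoef :> nat -> R }.

HB.instance Definition _ R := gen_eqMixin (ser R).
HB.instance Definition _ R := gen_choiceMixin (ser R).

Section SerRing.
Variable R : comNzRingType.
Implicit Types (f g h : ser R) (n d : nat).

Lemma serP f g : (forall n, f n = g n) -> f = g.
Proof. by case: f g => f [g] /= /funext ->. Qed.

Definition serC (c : R) : ser R := Ser (fun n => c *+ (n == 0%N)).
Definition ser_add f g := Ser (fun n => f n + g n).
Definition ser_opp f := Ser (fun n => - f n).
Definition ser_mul f g := Ser (fun n => \sum_(i < n.+1) f i * g (n - i)%N).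

Fact ser_addA : associative ser_add.
Proof. by move=> f g h; apply: serP => n /=; rewrite addrA. Qed.
Fact ser_addC : commutative ser_add.
Proof. by move=> f g; apply: serP => n /=; rewrite addrC. Qed.
Fact ser_add0 : left_id (serC 0) ser_add.
Proof. by move=> f; apply: serP => n /=; rewrite mul0rn add0r. Qed.
Fact ser_addN : left_inverse (serC 0) ser_opp ser_add.
Proof. by move=> f; apply: serP => n /=; rewrite mul0rn addNr. Qed.

HB.instance Definition _ :=
  GRing.isZmodule.Build (ser R) ser_addA ser_addC ser_add0 ser_addN.

Definition ser_trunc d f : {poly R} := \poly_(i < d) f i.

Lemma coef_ser_trunc d f n : (n < d)%N -> (ser_trunc d f)`_n = f n.
Proof. by move=> lt_nd; rewrite coef_poly lt_nd. Qed.

Lemma ser_mulE d f g n : (n < d)%N ->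
  ser_mul f g n = (ser_trunc d f * ser_trunc d g)`_n.
Proof.
move=> lt_nd; rewrite coefM; apply: eq_bigr => i _.
by rewrite !coef_ser_trunc //; move: (ltn_ord i); lia.
Qed.

Lemma coefM_agree d (p q r : {poly R}) n :
  (forall k, (k < d)%N -> p`_k = q`_k) -> (n < d)%N -> (p * r)`_n = (q * r)`_n.
Proof.
move=> eq_pq lt_nd; rewrite !coefM; apply: eq_bigr => i _.
by rewrite eq_pq //; move: (ltn_ord i); lia.
Qed.

Fact ser_mulC : commutative ser_mul.
Proof. by move=> f g; apply: serP => n; rewrite !(ser_mulE _ _ (ltnSn _)) mulrC. Qed.

Fact ser_mulA : associative ser_mul.
Proof.
move=> f g h; apply: serP => n; have lt_n := ltnSn n.
have tr f1 f2 k : (k < n.+1)%N ->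
    (ser_trunc n.+1 (ser_mul f1 f2))`_k = (ser_trunc n.+1 f1 * ser_trunc n.+1 f2)`_k.
  by move=> lt_k; rewrite coef_ser_trunc // -ser_mulE.
rewrite ser_mulC !(ser_mulE _ _ lt_n).
by rewrite !(coefM_agree _ (@tr _ _) lt_n) mulrC mulrA.
Qed.

Fact ser_mul1 : left_id (serC 1) ser_mul.
Proof.
move=> f; apply: serP => n /=; rewrite big_ord_recl /= subn0 mul1r big1 ?addr0 // => i _.
by rewrite /= mul0r.
Qed.

Fact ser_mulDl : left_distributive ser_mul ser_add.
Proof.
by move=> f g h; apply: serP => n /=; rewrite -big_split; apply: eq_bigr => i _; rewrite mulrDl.
Qed.

Fact ser_oner_neq0 : serC 1 != serC 0.
Proof.
by apply/eqP => /(congr1 (fun f : ser R => f 0%N)) /= /eqP; rewrite oner_eq0.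
Qed.

HB.instance Definition _ := GRing.Zmodule_isComNzRing.Build (ser R)
  ser_mulA ser_mulC ser_mul1 ser_mulDl ser_oner_neq0.

Lemma ser0 n : (0 : ser R) n = 0. Proof. exact: mul0rn. Qed.
Lemma ser1 n : (1 : ser R) n = (n == 0%N)%:R. Proof. by []. Qed.
Lemma serD f g n : (f + g) n = f n + g n. Proof. by []. Qed.
Lemma serN f n : (- f) n = - f n. Proof. by []. Qed.
Lemma serM f g n : (f * g) n = \sum_(i < n.+1) f i * g (n - i)%N. Proof. by []. Qed.
Lemma serMn f k n : (f *+ k) n = f n *+ k.
Proof. by elim: k => [|k IH]; rewrite ?ser0 // !mulrS serD IH. Qed.
Lemma ser_sum I r (P : pred I) (F : I -> ser R) n :
  (\sum_(i <- r | P i) F i) n = \sum_(i <- r | P i) F i n.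
Proof. by elim/big_rec2: _ => [|i x y _ <-]; rewrite ?ser0. Qed.

Fact serC_zmod : zmod_morphism serC.
Proof. by move=> a b; apply: serP => n; rewrite serD serN /= mulrnBl. Qed.
HB.instance Definition _ := GRing.isZmodMorphism.Build R (ser R) serC serC_zmod.

Lemma serCM c f n : (serC c * f) n = c * f n.
Proof.
rewrite serM big_ord_recl /= subn0 big1 ?addr0 // => i _.
by rewrite /= mul0r.
Qed.

Fact serC_monoid : monoid_morphism serC.
Proof.
split=> // a b; apply: serP => n; rewrite serCM /=.
by case: eqP; rewrite ?mulr1n ?mulr0n ?mulr0.
Qed.
HB.instance Definition _ := GRing.isMonoidMorphism.Build R (ser R) serC serC_monoid.

Definition serX : ser R := Ser (fun n => (n == 1%N)%:R).

Lemma serXM f n : (serX * f) n.+1 = f n.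
Proof.
rewrite serM 2!big_ord_recl /= mul0r add0r mul1r subn1 big1 ?addr0 // => i _.
by rewrite /= mul0r.
Qed.
Lemma serXM0 f : (serX * f) 0%N = 0.
Proof. by rewrite serM big_ord_recl big_ord0 /= mul0r addr0. Qed.

(* The Euler operator t d/dt, which unlike d/dt preserves degrees. *)
Definition sder f : ser R := Ser (fun n => f n *+ n).

Lemma sderE f n : sder f n = f n *+ n. Proof. by []. Qed.
Lemma sderD f g : sder (f + g) = sder f + sder g.
Proof. by apply: serP => n /=; rewrite mulrnDl. Qed.
Lemma sderM f g : sder (f * g) = sder f * g + f * sder g.
Proof.
apply: serP => n /=; rewrite -sumrMnl -big_split; apply: eq_bigr => i _ /=.
rewrite mulrnAl mulrnAr -mulrnDr subnKC //; exact: (ltn_ord i).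
Qed.

Lemma sder1 : sder 1 = 0.
Proof. by apply: serP => -[|n] /=; rewrite ?mul0rn. Qed.

Lemma sderX f k : sder (f ^+ k.+1) = (f ^+ k * sder f) *+ k.+1.
Proof.
elim: k => [|k IH]; first by rewrite expr0 mul1r.
by rewrite exprS sderM IH mulrnAr mulrA -exprS [sder f * _]mulrC -mulrS.
Qed.

Lemma serX_low f k n : f 0%N = 0 -> (n < k)%N -> (f ^+ k) n = 0.
Proof.
move=> f0; elim: k n => // k IH n lt_nk; rewrite exprS serM big_ord_recl f0 mul0r add0r.
rewrite big1 // => i _; rewrite IH ?mulr0 //= /bump; move: (ltn_ord i); lia.
Qed.

End SerRing.

Arguments serX {R}.
Arguments serC {R}.

(* Newton's recursion: in characteristic zero a series is determined by its
   logarithmic derivative and its constant coefficient. *)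
Lemma sder_unique (R : comNzRingType) (P f g : ser R) :
    (forall (n : nat) (a b : R), a *+ n.+1 = b *+ n.+1 -> a = b) -> P 0%N = 0 ->
  sder f = P * f -> sder g = P * g -> f 0%N = g 0%N -> f = g.
Proof.
move=> char0 P0 df dg fg0; apply: serP => n; elim/ltn_ind: n => -[|n] IH //.
apply: (char0 n); have := congr1 (fun h : ser R => h n.+1) df.
have := congr1 (fun h : ser R => h n.+1) dg; rewrite /= => -> ->.
rewrite !(big_ord_recl n.+1) P0 !mul0r; congr (_ + _); apply: eq_bigr => i _.
by rewrite IH // lift0; lia.
Qed.

Section SerMap.
Variables (R S : comNzRingType) (phi : {rmorphism R -> S}).

Definition ser_map (f : ser R) : ser S := Ser (fun n => phi (f n)).

Fact ser_map_zmod : zmod_morphism ser_map.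
Proof. by move=> f g; apply: serP => n /=; rewrite rmorphB. Qed.
HB.instance Definition _ := GRing.isZmodMorphism.Build _ _ ser_map ser_map_zmod.
Fact ser_map_monoid : monoid_morphism ser_map.
Proof.
split=> [|f g]; apply: serP => n /=; first by rewrite rmorphMn rmorph1.
by rewrite rmorph_sum; apply: eq_bigr => i _; rewrite rmorphM.
Qed.
HB.instance Definition _ := GRing.isMonoidMorphism.Build _ _ ser_map ser_map_monoid.

Lemma ser_mapC c : ser_map (serC c) = serC (phi c).
Proof. by apply: serP => n /=; rewrite rmorphMn. Qed.
Lemma ser_mapX : ser_map serX = serX.
Proof. by apply: serP => n /=; rewrite rmorph_nat. Qed.
Lemma sder_map f : sder (ser_map f) = ser_map (sder f).
Proof. by apply: serP => n /=; rewrite rmorphMn. Qed.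

End SerMap.

Definition cz (R : comNzRingType) (f : ser R) (n : int) : R :=
  if n is Posz k then f k else 0.

Lemma cz_neg (R : comNzRingType) (f : ser R) n : (n < 0)%R -> cz f n = 0.
Proof. by case: n. Qed.

Lemma czD (R : comNzRingType) (f g : ser R) n : cz (f + g) n = cz f n + cz g n.
Proof. by case: n => //= n; rewrite addr0. Qed.

Lemma czN (R : comNzRingType) (f : ser R) n : cz (- f) n = - cz f n.
Proof. by case: n => //= n; rewrite oppr0. Qed.

Lemma czB (R : comNzRingType) (f g : ser R) n : cz (f - g) n = cz f n - cz g n.
Proof. by rewrite czD czN. Qed.

Lemma czC (R : comNzRingType) c (f : ser R) n : cz (serC c * f) n = c * cz f n.
Proof. by case: n => n; rewrite /cz ?serCM ?mulr0. Qed.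

Lemma czX (R : comNzRingType) (f : ser R) n : cz (serX * f) n = cz f (n - 1).
Proof.
case: n => [[|n]|n]; first by rewrite /cz serXM0.
  have -> : n.+1%:Z - 1 = n by lia.
  by rewrite /cz serXM.
by rewrite !cz_neg //; lia.
Qed.

Lemma czXn (R : comNzRingType) (f : ser R) m n : cz (serX ^+ m * f) n = cz f (n - m%:Z).
Proof.
elim: m n => [|m IH] n; first by rewrite expr0 mul1r subr0.
by rewrite exprS -mulrA czX IH; congr (cz _ _); lia.
Qed.

Lemma cz_map (R S : comNzRingType) (phi : {rmorphism R -> S}) (f : ser R) n :
  cz (ser_map phi f) n = phi (cz f n).
Proof. by case: n => n //=; rewrite rmorph0. Qed.

(** * Two-sided series *)

Section IntSums.
Variable V : zmodType.
Implicit Types (F G : int -> V).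

(** The sum is 0 by convention when infinitely many terms are nonzero, so additivity is only
    available under [zbounded]. *)
Definition zsum F : V := \sum_(i \in [set: int]%classic) F i.

Definition zbounded F := exists D : nat, forall i : int, (D < `|i|)%N -> F i = 0.

Definition zwindow (D : nat) : seq int := [seq i%:Z - D%:Z | i <- iota 0 (2 * D).+1].

Lemma zwindow_uniq D : uniq (zwindow D).
Proof. by rewrite map_inj_uniq ?iota_uniq // => i j; lia. Qed.

Lemma mem_zwindow D (i : int) : (i \in zwindow D) = (`|i| <= D)%N.
Proof.
apply/mapP/idP => [[k]|le_iD]; first by rewrite mem_iota => ? ->; lia.
by exists `|(i + D%:Z)%R|%N; rewrite ?mem_iota; lia.
Qed.

Lemma fsum_seq (I : choiceType) (r : seq I) (F : I -> V) : uniq r ->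
    (forall i, i \notin r -> F i = 0) ->
  \sum_(i \in [set: I]%classic) F i = \sum_(i <- r) F i.
Proof.
move=> r_uniq F0; rewrite (fsbigE r) // => [|i _]; last exact: F0.
by apply: eq_bigl => i; apply/mem_set.
Qed.

Lemma zsum_window D F : (forall i : int, (D < `|i|)%N -> F i = 0) ->
  zsum F = \sum_(i <- zwindow D) F i.
Proof.
move=> F0; apply: fsum_seq (zwindow_uniq D) _ => i.
by rewrite mem_zwindow -ltnNge => /F0.
Qed.

Lemma eq_zsum F G : F =1 G -> zsum F = zsum G.
Proof. by move/funext ->. Qed.

Lemma zsum0 : zsum (fun=> 0) = 0.
Proof. exact: fsbig1. Qed.

Lemma zsumD F G : zbounded F -> zbounded G ->
  zsum (fun i => F i + G i) = zsum F + zsum G.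
Proof.
move=> [D1 F0] [D2 G0]; have h1 : (D1 <= D1 + D2)%N by lia.
have h2 : (D2 <= D1 + D2)%N by lia.
rewrite !(@zsum_window (D1 + D2)) ?big_split // => i lt_i.
- by rewrite G0 // (leq_ltn_trans h2).
- by rewrite F0 // (leq_ltn_trans h1).
- by rewrite F0 ?G0 ?addr0 // (leq_ltn_trans _ lt_i).
Qed.

Lemma zsum_shift k F : zsum (fun i => F (i + k)) = zsum F.
Proof.
rewrite /zsum [RHS](reindex_fsbigT (fun i : int => i + k)) //.
by exists (fun i => i - k) => i; rewrite ?addrK ?subrK.
Qed.

Lemma zsum_sub n F : zsum (fun i => F (n - i)) = zsum F.
Proof.
rewrite /zsum [RHS](reindex_fsbigT (fun i : int => n - i)) //.
by exists (fun i => n - i) => i; rewrite subKr.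
Qed.

Lemma zsum_delta m F : zsum (fun i => if i == m then F i else 0) = F m.
Proof.
rewrite /zsum (@fsum_seq _ [:: m]) ?big_seq1 ?eqxx // => i.
by rewrite inE => /negPf ->.
Qed.

Lemma zbounded_add F G : zbounded F -> zbounded G -> zbounded (fun i => F i + G i).
Proof.
move=> [D1 F0] [D2 G0]; exists (D1 + D2)%N => i lt_i.
by rewrite F0 ?G0 ?addr0 //; lia.
Qed.

Lemma zbounded_shift k F : zbounded F -> zbounded (fun i => F (i + k)).
Proof. by move=> [D F0]; exists (D + `|k|)%N => i lt_i; apply: F0; lia. Qed.

Lemma zbounded_delta m F : zbounded (fun i => if i == m then F i else 0).
Proof. by exists `|m|%N => i lt_i; case: eqP lt_i => // ->; rewrite ltnn. Qed.

Lemma zsum_bigsum (I : Type) (r : seq I) (f : I -> int -> V) :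
    (forall k, zbounded (f k)) ->
  zbounded (fun i => \sum_(k <- r) f k i) /\
  zsum (fun i => \sum_(k <- r) f k i) = \sum_(k <- r) zsum (f k).
Proof.
move=> bf; elim: r => [|k r [IHb IH]].
  split; first by exists 0%N => i _; rewrite big_nil.
  by rewrite big_nil -[RHS]zsum0; apply: eq_zsum => i; rewrite big_nil.
have eqf : (fun i => \sum_(k <- k :: r) f k i) = fun i => f k i + \sum_(k <- r) f k i.
  by apply/funext => i; rewrite big_cons.
rewrite eqf big_cons -IH; split; first exact: zbounded_add.
exact: zsumD.
Qed.

End IntSums.

Lemma zsum_raddf (V W : zmodType) (f : {additive V -> W}) (F : int -> V) :
  zbounded F -> f (zsum F) = zsum (fun i => f (F i)).
Proof.
move=> [D F0]; rewrite (zsum_window F0) raddf_sum (@zsum_window _ D) // => i lt_i.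
by rewrite F0 // raddf0.
Qed.

Lemma mulr_zsumr (R : nzRingType) (c : R) (F : int -> R) :
  zbounded F -> c * zsum F = zsum (fun i => c * F i).
Proof.
move=> [D F0]; rewrite (zsum_window F0) mulr_sumr (@zsum_window _ D) // => i lt_i.
by rewrite F0 // mulr0.
Qed.

Section LaurentPairing.
Variable A : comNzRingType.
Implicit Types (G H : int -> A) (p q : {poly A}) (n : int).

(* Multiplication of a two-sided series by z + 1/z. *)
Definition zS G : int -> A := fun n => G (n - 1) + G (n + 1).

Lemma zSE G n : zS G n = G (n - 1) + G (n + 1). Proof. by []. Qed.

(* The coefficient of z^n in G(z) q(z + 1/z). *)
Definition lpair G q n : A := \sum_(i < size q) q`_i * iter i zS G n.

Lemma lpair_wide d G q n : (size q <= d)%N ->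
  lpair G q n = \sum_(i < d) q`_i * iter i zS G n.
Proof.
move=> le_qd; rewrite /lpair (big_ord_widen _ (fun i => q`_i * iter i zS G n) le_qd).
rewrite big_mkcond; apply: eq_bigr => i _; case: ltnP => // le_qi.
by rewrite nth_default // mul0r.
Qed.

Fact lpair_zmod G n : zmod_morphism (lpair G ^~ n).
Proof.
move=> p q; pose d := maxn (size p) (size q).
have [le_p le_q] : (size p <= d)%N /\ (size q <= d)%N by rewrite leq_maxl leq_maxr.
have le_pq : (size (p - q)%R <= d)%N by rewrite (leq_trans (size_polyD _ _)) // size_polyN.
rewrite (lpair_wide _ _ le_p) (lpair_wide _ _ le_q) (lpair_wide _ _ le_pq) -sumrB.
by apply: eq_bigr => i _; rewrite coefB mulrBl.
Qed.

Lemma lpairB G p q n : lpair G (p - q) n = lpair G p n - lpair G q n.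
Proof. exact: lpair_zmod. Qed.
Lemma lpair0 G n : lpair G 0 n = 0.
Proof. by rewrite -(subrr 0) lpairB subrr. Qed.
Lemma lpairD G p q n : lpair G (p + q) n = lpair G p n + lpair G q n.
Proof. by rewrite -{1}[q]opprK lpairB -[- q]sub0r lpairB lpair0 sub0r opprK. Qed.
Lemma lpair_sum G I r (P : pred I) (f : I -> {poly A}) n :
  lpair G (\sum_(i <- r | P i) f i) n = \sum_(i <- r | P i) lpair G (f i) n.
Proof. exact: (big_morph _ (fun p q => lpairD G p q n) (lpair0 G n)). Qed.

Lemma lpairCM G a q n : lpair G (a%:P * q) n = a * lpair G q n.
Proof.
have le_aq : (size (a%:P * q)%R <= size q)%N.
  by rewrite mul_polyC size_scale_leq.
rewrite (lpair_wide _ _ le_aq) mulr_sumr; apply: eq_bigr => i _.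
by rewrite coefCM mulrA.
Qed.

Lemma lpairMC G q a n : lpair G (q * a%:P) n = lpair G q n * a.
Proof. by rewrite mulrC lpairCM mulrC. Qed.

Lemma lpairC G a n : lpair G a%:P n = a * G n.
Proof.
by rewrite (@lpair_wide 1) ?size_polyC ?leq_b1 // big_ord1 coefC eqxx.
Qed.

Lemma lpair1 G n : lpair G 1 n = G n.
Proof. by rewrite lpairC mul1r. Qed.

Lemma lpairXM G q n : lpair G ('X * q) n = lpair (zS G) q n.
Proof.
have le_Xq : (size ('X * q)%R <= (size q).+1)%N.
  by rewrite mulrC; apply: leq_trans (size_polyMleq _ _) _; rewrite size_polyX addn2.
rewrite (lpair_wide _ _ le_Xq) big_ord_recl coefXM mul0r add0r.
by apply: eq_bigr => i _; rewrite coefXM /= /bump /= -iterSr.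
Qed.

Lemma zS_iter i G n : iter i zS (zS G) n = zS (iter i zS G) n.
Proof. by rewrite -iterSr. Qed.

Lemma lpair_zS G q n : lpair (zS G) q n = lpair G q (n - 1) + lpair G q (n + 1).
Proof.
by rewrite /lpair -big_split; apply: eq_bigr => i _; rewrite zS_iter /zS mulrDr.
Qed.

Lemma lpairXn G k n : lpair G 'X^k n = iter k zS G n.
Proof.
elim: k G n => [|k IH] G n; first by rewrite expr0 lpair1.
by rewrite exprS lpairXM IH iterSr.
Qed.

Lemma eq_zS_iter i G H : G =1 H -> iter i zS G =1 iter i zS H.
Proof. by move/funext ->. Qed.

Lemma iter_zSD i G H n : iter i zS (fun m => G m + H m) n = iter i zS G n + iter i zS H n.
Proof. by elim: i n => // i IH n; rewrite !iterS /zS !IH addrACA. Qed.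

Lemma iter_zSZ i c G n : iter i zS (fun m => c * G m) n = c * iter i zS G n.
Proof. by elim: i n => // i IH n; rewrite !iterS /zS !IH mulrDr. Qed.

Lemma iter_zS_shift i k G n : iter i zS (fun m => G (m + k)) n = iter i zS G (n + k).
Proof.
by elim: i n => // i IH n; rewrite !iterS /zS !IH addrAC [n + 1 + k]addrAC.
Qed.

Lemma lpair_DG G H q n : lpair (fun m => G m + H m) q n = lpair G q n + lpair H q n.
Proof.
by rewrite /lpair -big_split; apply: eq_bigr => i _; rewrite iter_zSD mulrDr.
Qed.

Lemma lpair_ZG c G q n : lpair (fun m => c * G m) q n = c * lpair G q n.
Proof.
by rewrite /lpair mulr_sumr; apply: eq_bigr => i _; rewrite iter_zSZ mulrCA.
Qed.

Lemma lpair_shift k G q n : lpair (fun m => G (m + k)) q n = lpair G q (n + k).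
Proof. by apply: eq_bigr => i _; rewrite iter_zS_shift. Qed.

(* The polynomial in v = z + 1/z equal to z^k + z^-k. *)
Fixpoint dickson (k : nat) : {poly A} :=
  match k with
  | 0 => 2%:R
  | S k' => if k' is S k'' then 'X * dickson k' - dickson k'' else 'X
  end.

Lemma dicksonSS k : dickson k.+2 = 'X * dickson k.+1 - dickson k.
Proof. by []. Qed.

Lemma lpair_dickson k G q n :
  lpair G (dickson k * q) n = lpair G q (n - k%:Z) + lpair G q (n + k%:Z).
Proof.
move: n; have [//] : (forall n, lpair G (dickson k * q) n =
    lpair G q (n - k%:Z) + lpair G q (n + k%:Z)) /\
  (forall n, lpair G (dickson k.+1 * q) n =
    lpair G q (n - k.+1%:Z) + lpair G q (n + k.+1%:Z)).
elim: k => [|k [IH1 IH2]]; split=> // n.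
- by rewrite mulr_natl mulr2n lpairD; congr (lpair _ _ _ + lpair _ _ _); lia.
- by rewrite lpairXM lpair_zS.
rewrite dicksonSS mulrBl lpairB -mulrA lpairXM lpair_zS !IH2 IH1.
rewrite (_ : n - 1 - k.+1%:Z = n - k.+2%:Z); last by lia.
rewrite (_ : n - 1 + k.+1%:Z = n + k%:Z); last by lia.
rewrite (_ : n + 1 - k.+1%:Z = n - k%:Z); last by lia.
rewrite (_ : n + 1 + k.+1%:Z = n + k.+2%:Z); last by lia.
by ring.
Qed.

Definition zdelta (n : int) : A := (n == 0)%:R.

Lemma iter_zS_delta_far i n : (i < `|n|)%N -> iter i zS zdelta n = 0.
Proof.
elim: i n => [|i IH] n lt_in; first by rewrite /zdelta /= /zdelta; case: eqP lt_in => // ->.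
by rewrite iterS /zS !IH ?addr0 //; lia.
Qed.

Lemma zsum_conv_delta G i n : zsum (fun k => G (n - k) * iter i zS zdelta k) = iter i zS G n.
Proof.
have bd j m : zbounded (fun k => G (m - k) * iter j zS zdelta k).
  by exists j => k lt_jk; rewrite iter_zS_delta_far ?mulr0.
elim: i n => [|i IH] n.
  rewrite /= -[n in RHS]subr0 -(zsum_delta 0 (fun k => G (n - k))); apply: eq_zsum => k.
  by rewrite /= /zdelta; case: eqP => _; rewrite ?mulr1 ?mulr0.
rewrite -[iter i.+1 zS G]/(zS (iter i zS G)) zSE -!IH -[zsum (fun k => G (n - 1 - k) * _)](zsum_shift (-1)).
rewrite -[zsum (fun k => G (n + 1 - k) * _)](zsum_shift 1) -zsumD.
- apply: eq_zsum => k; rewrite iterS zSE mulrDr.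
  by congr (G _ * _ + G _ * _); lia.
- exact: (zbounded_shift (-1) (bd i (n - 1))).
- exact: (zbounded_shift 1 (bd i (n + 1))).
Qed.

(** [zdelta] is the series 1, so [lpair zdelta q] lists the coefficients of the Laurent polynomial
    q(z + 1/z), and convolution with G is multiplication by it. *)
Lemma zsum_conv_lpair G q n : zsum (fun k => G (n - k) * lpair zdelta q k) = lpair G q n.
Proof.
have bd i : zbounded (fun k => G (n - k) * (q`_i * iter i zS zdelta k)).
  by exists i => k lt_ik; rewrite iter_zS_delta_far ?mulr0.
have [_ eq_sum] := zsum_bigsum (index_enum _) (fun i : 'I_(size q) => bd i).
under eq_zsum do rewrite mulr_sumr.
rewrite eq_sum; apply: eq_bigr => i _; rewrite -zsum_conv_delta mulr_zsumr; last first.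
  by exists i => k lt_ik; rewrite iter_zS_delta_far ?mulr0.
by apply: eq_zsum => k; rewrite mulrCA.
Qed.

End LaurentPairing.

(** * Exponentials of Heisenberg operators *)

(* An interface to the Fock space: on the concrete algebra [{malg F[_]}],
   unification unfolds the terms and practically diverges. *)
Record fock_space (F : fieldType) := FockSpace {
  fs_alg :> comAlgType F;
  fs_var : nat -> fs_alg;
  fs_deriv : nat -> fs_alg -> fs_alg;
  fs_derivB : forall k u v, fs_deriv k (u - v) = fs_deriv k u - fs_deriv k v;
  fs_derivZ : forall k c v, fs_deriv k (c *: v) = c *: fs_deriv k v;
  fs_deriv1 : forall k, fs_deriv k 1 = 0;
  fs_deriv_var : forall i j v,
    fs_deriv i (fs_var j * v) = fs_var j * fs_deriv i v + v *+ (i == j);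
  fs_derivC : forall i j v, fs_deriv i (fs_deriv j v) = fs_deriv j (fs_deriv i v);
  fs_ind : forall P : fs_alg -> Prop,
    (forall u v, P u -> P v -> P (u + v)) -> (forall c v, P v -> P (c *: v)) ->
    P 1 -> (forall k v, P v -> P (fs_var k * v)) -> forall v, P v;
  fs_hom : forall (S : comNzRingType) (iota : {rmorphism F -> S}) (a : nat -> S),
    exists phi : {rmorphism fs_alg -> S},
      (forall k, phi (fs_var k) = a k) /\ (forall c v, phi (c *: v) = iota c * phi v);
  fs_vac : {rmorphism fs_alg -> F};
  fs_vac_var : forall k, fs_vac (fs_var k) = 0;
  fs_vacZ : forall c, fs_vac (c%:A) = c
}.

HB.instance Definition _ (F : fieldType) (A : fock_space F) k :=
  GRing.isZmodMorphism.Build A A (fs_deriv k) (@fs_derivB F A k).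

Section FockExponentials.
Variables (F : fieldType) (A : fock_space F).
Hypothesis char0 : forall n : nat, n.+1%:R != 0 :> F.
Local Notation var := (@fs_var F A).
Implicit Types (u v w : A) (n m : int) (c : F).

Definition azop := int -> A -> A.
Definition azop_mul (P Q : azop) : azop := fun n v => zsum (fun i => P (n - i) (Q i v)).
Definition azop_one : azop := fun n v => if n == 0 then v else 0.
Definition azop_exp (P : azop) : azop := fun n v =>
  \sum_(j \in [set: nat]%classic) (j`!%:R : F)^-1 *: iter j (azop_mul P) azop_one n v.

(* In characteristic zero [zannihil] is [zann 1]: [a_n / n] is a partial derivative. *)
Definition zann c : azop := fun n v => if n == 0 then 0 else c *: fs_deriv `|n|%N.-1 v.

Fact zann_zmod c n : zmod_morphism (zann c n).
Proof.
by move=> u v; rewrite /zann; case: eqP; rewrite ?subr0 // raddfB scalerBr.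
Qed.
HB.instance Definition _ c n :=
  GRing.isZmodMorphism.Build A A (zann c n) (zann_zmod c n).

Lemma zannZ c n a v : zann c n (a *: v) = a *: zann c n v.
Proof.
by rewrite /zann; case: eqP; rewrite ?scaler0 // fs_derivZ !scalerA mulrC.
Qed.

Lemma zann_var c n k v :
  zann c n (var k * v) = var k * zann c n v + (if `|n|%N == k.+1 then c *: v else 0).
Proof.
rewrite /zann; case: (eqVneq n 0) => [->|n0]; first by rewrite mulr0 addr0.
rewrite fs_deriv_var scalerDr scalerAr; congr (_ + _).
have -> : (`|n|%N.-1 == k) = (`|n|%N == k.+1) by lia.
by case: eqP; rewrite ?mulr1n // mulr0n scaler0.
Qed.

(** A polynomial involves finitely many variables: the source of finiteness for the annihilation
    operators, whose formal sums run over infinitely many derivatives. *)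
Lemma fock_vars v : exists B, forall k, (B <= k)%N -> fs_deriv k v = 0.
Proof.
elim/(@fs_ind F): v => [u v [B1 h1] [B2 h2]|c v [B hB]||i v [B hB]].
- exists (maxn B1 B2) => k; rewrite geq_max => /andP[le1 le2].
  by rewrite raddfD /= h1 // h2 // addr0.
- by exists B => k le_Bk; rewrite fs_derivZ hB // scaler0.
- by exists 0%N => k _; rewrite fs_deriv1.
- exists (maxn B i.+1) => k; rewrite geq_max => /andP[le1 le2].
  by rewrite fs_deriv_var hB // mulr0 add0r gtn_eqF.
Qed.

Definition zann_pow c j : azop := iter j (azop_mul (zann c)) azop_one.

Lemma zann_powS c j n v :
  zann_pow c j.+1 n v = zsum (fun i => zann c (n - i) (zann_pow c j i v)).
Proof. by []. Qed.

(** Derivatives commute, so powers of the annihilation part bring in no new variables; each factor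
    then contributes only degrees of absolute value at most B, whence the bound j B. *)
Lemma zann_pow_support c j B v : (forall k, (B <= k)%N -> fs_deriv k v = 0) ->
  (forall n k, (B <= k)%N -> fs_deriv k (zann_pow c j n v) = 0) /\
  (forall n, (j * B < `|n|)%N -> zann_pow c j n v = 0).
Proof.
move=> hB; elim: j => [|j [IH1 IH2]].
  rewrite /zann_pow /azop_one /=; split=> n.
    by move=> k le_Bk; case: eqP => _; rewrite ?hB ?raddf0.
  by case: eqP => // ->.
split=> [n k le_Bk|n lt_n].
  rewrite zann_powS zsum_raddf; last first.
    by exists (j * B)%N => i lt_i; rewrite IH2 // raddf0.
  rewrite -[RHS]zsum0; apply: eq_zsum => i.
  rewrite {1}/zann; case: eqP => _; first by rewrite raddf0.
  by rewrite /= fs_derivZ fs_derivC IH1 // raddf0 scaler0.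
rewrite zann_powS -[RHS]zsum0; apply: eq_zsum => i.
case: (ltnP (j * B) `|i|) => [lt_i|le_i]; first by rewrite IH2 // raddf0.
rewrite /zann; case: eqP => // ni; rewrite IH1 ?scaler0 //.
move: lt_n le_i ni; rewrite mulSn; lia.
Qed.

Lemma zann_pow_bounded c j v : zbounded (fun i => zann_pow c j i v).
Proof.
have [B hB] := fock_vars v; exists (j * B)%N => i.
exact: (zann_pow_support c j hB).2.
Qed.

Lemma zann_zann_pow_bounded c j v n :
  zbounded (fun i => zann c (n - i) (zann_pow c j i v)).
Proof.
by have [D hD] := zann_pow_bounded c j v; exists D => i lt_i; rewrite hD // raddf0.
Qed.

Lemma zann_powD c j n u v :
  zann_pow c j n (u + v) = zann_pow c j n u + zann_pow c j n v.
Proof.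
elim: j n => [|j IH] n.
  by rewrite /zann_pow /= /azop_one; case: eqP; rewrite ?addr0.
rewrite 3!zann_powS -zsumD; try exact: zann_zann_pow_bounded.
by apply: eq_zsum => i; rewrite IH raddfD.
Qed.

Lemma scaler_zsumr a (f : int -> A) : zbounded f -> a *: zsum f = zsum (fun i => a *: f i).
Proof. exact: (zsum_raddf ( *:%R a)). Qed.

Lemma zann_powZ c j n a v : zann_pow c j n (a *: v) = a *: zann_pow c j n v.
Proof.
elim: j n => [|j IH] n.
  by rewrite /zann_pow /= /azop_one; case: eqP; rewrite ?scaler0.
rewrite 2!zann_powS scaler_zsumr; last exact: zann_zann_pow_bounded.
by apply: eq_zsum => i; rewrite IH zannZ.
Qed.

Lemma zann_pow1 c j n : zann_pow c j.+1 n 1 = 0.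
Proof.
elim: j n => [|j IH] n; rewrite zann_powS -[RHS]zsum0; apply: eq_zsum => i.
  rewrite /zann_pow /= /azop_one /zann; case: eqP => // _; case: eqP => // _.
    by rewrite fs_deriv1 scaler0.
  by rewrite raddf0 scaler0.
by rewrite IH raddf0.
Qed.

(** The commutator of [zann c] with a variable is the central scalar c (z^(k+1) + z^-(k+1)), so the
    j-th power picks it up j times. For j = 0 the exponent [j.-1] is harmless because its
    coefficient is 0. *)
Lemma zann_pow_var c j n k v :
  zann_pow c j n (var k * v) = var k * zann_pow c j n v +
    (c *+ j) *: (zann_pow c j.-1 (n - k.+1%:Z) v + zann_pow c j.-1 (n + k.+1%:Z) v).
Proof.
elim: j n => [|j IH] n.
  rewrite mulr0n scale0r addr0 /zann_pow /= /azop_one.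
  by case: eqP; rewrite ?mulr0.
pose T i := zann_pow c j i v; pose T' i := zann_pow c j.-1 i v.
pose k1 := k.+1%:Z.
(* Only two values of i give a nonzero commutator, and they differ because k + 1 > 0. *)
have step i : zann c (n - i) (zann_pow c j i (var k * v)) =
   var k * zann c (n - i) (T i) +
   ((if i == n - k1 then c *: T i else 0) + (if i == n + k1 then c *: T i else 0) +
    (c *+ j) *: (zann c (n - i) (T' (i - k1)) + zann c (n - i) (T' (i + k1)))).
  rewrite IH raddfD /= zannZ raddfD /= zann_var -/T -addrA; congr (_ + (_ + _)).
  case: (eqVneq i (n - k1)) => [->|ne1].
    have -> : (n - k1 == n + k1) = false by rewrite /k1; lia.
    by rewrite addr0 ifT //; rewrite /k1; lia.
  case: (eqVneq i (n + k1)) => [->|ne2]; first by rewrite add0r ifT //; rewrite /k1; lia.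
  by rewrite addr0 ifF //; apply/negbTE; move: ne1 ne2; rewrite /k1; lia.
have bT := zann_zann_pow_bounded c j v n.
have bT' d : zbounded (fun i => zann c (n - i) (T' (i + d))).
  have [D hD] := zbounded_shift d (zann_pow_bounded c j.-1 v).
  by exists D => i lt_i; rewrite /T' hD // raddf0.
have bxT : zbounded (fun i => var k * zann c (n - i) (T i)).
  by have [D hD] := bT; exists D => i lt_i; rewrite hD // mulr0.
have bcT : zbounded (fun i => (c *+ j) *:
    (zann c (n - i) (T' (i - k1)) + zann c (n - i) (T' (i + k1)))).
  have [D hD] := zbounded_add (bT' (- k1)) (bT' k1).
  by exists D => i lt_i; rewrite hD // scaler0.
have bd d : zbounded (fun i => if i == d then c *: T i else 0).
  exact: zbounded_delta.
rewrite zann_powS (eq_zsum step) zsumD //; last by do !apply: zbounded_add.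
rewrite zsumD //; last exact: zbounded_add.
rewrite zsumD // !zsum_delta -mulr_zsumr // -scaler_zsumr; last exact: zbounded_add.
rewrite (zsumD (bT' (- k1)) (bT' k1)).
congr (_ + _); rewrite -scalerDr mulrS scalerDl /T /=; congr (_ + _).
case: (posnP j) => [j0|j_gt0]; first by rewrite j0 !mulr0n !scale0r.
congr (_ *: (_ + _)).
  rewrite -(zsum_shift k1) -[in RHS](prednK j_gt0) zann_powS; apply: eq_zsum => i.
  by rewrite addrK; congr (zann _ _ _); lia.
rewrite -(zsum_shift (- k1)) -[in RHS](prednK j_gt0) zann_powS; apply: eq_zsum => i.
by rewrite addrNK; congr (zann _ _ _); lia.
Qed.

(** By [zann_pow_var], multiplying by a variable delays the vanishing by at most one power. *)
Lemma zann_pow_nilp c v : exists J, forall j n, (J <= j)%N -> zann_pow c j n v = 0.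
Proof.
elim/(@fs_ind F): v => [u v [J1 h1] [J2 h2]|a v [J hJ]||i v [J hJ]].
- exists (maxn J1 J2) => j n; rewrite geq_max => /andP[le1 le2].
  by rewrite zann_powD h1 // h2 // addr0.
- by exists J => j n le_Jj; rewrite zann_powZ hJ // scaler0.
- by exists 1%N => -[|j] n // _; rewrite zann_pow1.
- exists J.+1 => -[|j] n // le_Jj; rewrite zann_pow_var !hJ //; try exact: leqW.
  by rewrite mulr0 add0r addr0 scaler0.
Qed.

Lemma zann_exp_window c J v n : (forall j n, (J <= j)%N -> zann_pow c j n v = 0) ->
  azop_exp (zann c) n v = \sum_(j < J) (j`!%:R : F)^-1 *: zann_pow c j n v.
Proof.
move=> hJ; rewrite /azop_exp (@fsum_seq _ _ (iota 0 J)) ?iota_uniq //.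
  by rewrite -[J in iota 0 J]subn0 big_mkord.
by move=> j; rewrite mem_iota add0n -leqNgt => le_Jj; rewrite [iter _ _ _ _ _]hJ // scaler0.
Qed.

Lemma zann_exp_zmod c n u v :
  azop_exp (zann c) n (u + v) = azop_exp (zann c) n u + azop_exp (zann c) n v.
Proof.
have [J1 h1] := zann_pow_nilp c u; have [J2 h2] := zann_pow_nilp c v.
rewrite !(@zann_exp_window _ (maxn J1 J2)).
- rewrite -big_split; apply: eq_bigr => j _.
  by rewrite zann_powD scalerDr.
- by move=> j m; rewrite geq_max => /andP[_ le2]; rewrite h2.
- by move=> j m; rewrite geq_max => /andP[le1 _]; rewrite h1.
- by move=> j m; rewrite geq_max => /andP[le1 le2]; rewrite zann_powD h1 // h2 // addr0.
Qed.

Lemma zann_expZ c n a v : azop_exp (zann c) n (a *: v) = a *: azop_exp (zann c) n v.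
Proof.
have [J hJ] := zann_pow_nilp c v.
rewrite !(@zann_exp_window _ J) //; last by move=> j m le_Jj; rewrite zann_powZ hJ // scaler0.
rewrite scaler_sumr; apply: eq_bigr => j _.
by rewrite zann_powZ !scalerA mulrC.
Qed.

Lemma zann_exp1 c n : azop_exp (zann c) n 1 = azop_one n 1.
Proof.
rewrite (@zann_exp_window _ 1); first by rewrite big_ord1 /= invr1 scale1r.
by move=> [|j] m // _; rewrite zann_pow1.
Qed.

(** The factor j of the power rule turns 1/j! into 1/(j-1)!, so the exponential acts on a variable
    as the substitution that adds c (z^(k+1) + z^-(k+1)). *)
Lemma zann_exp_var c n k v :
  azop_exp (zann c) n (var k * v) = var k * azop_exp (zann c) n v +
    c *: (azop_exp (zann c) (n - k.+1%:Z) v + azop_exp (zann c) (n + k.+1%:Z) v).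
Proof.
have [J hJ] := zann_pow_nilp c v.
have hJ1 j m : (J < j)%N -> zann_pow c j m v = 0 by move=> /ltnW; apply: hJ.
have hJv j m : (J < j)%N -> zann_pow c j m (var k * v) = 0.
  case: j => // j lt_Jj; rewrite zann_pow_var !hJ //; try exact: ltnW.
  by rewrite mulr0 add0r addr0 scaler0.
rewrite (zann_exp_window _ hJv) (zann_exp_window n hJ1) !(zann_exp_window _ hJ).
under eq_bigr do rewrite zann_pow_var scalerDr.
rewrite big_split mulr_sumr /=; congr (_ + _).
  by apply: eq_bigr => j _; rewrite scalerAr.
rewrite -big_split scaler_sumr big_ord_recl mulr0n scale0r scaler0 add0r.
apply: eq_bigr => j _; rewrite /= add0n -scalerDr !scalerA; congr (_ *: _).
rewrite /bump /= add1n factS natrM invfM -[c *+ _]mulr_natr mulrC -mulrA.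
by rewrite [_ * (_^-1 * _)]mulrA mulfV ?mul1r // char0.
Qed.

End FockExponentials.

Lemma sum_iota (V : nmodType) n (f : nat -> V) :
  \sum_(i <- iota 0 n) f i = \sum_(i < n) f i.
Proof. by rewrite -[n in iota 0 n]subn0 big_mkord. Qed.

(** * Exponentials of power series and logarithmic derivatives *)

Section SerExp.
Variables (F : fieldType) (A : comAlgType F).
Hypothesis char0 : forall n : nat, n.+1%:R != 0 :> F.

Lemma mulrSn_inj (V : lmodType F) (n : nat) (a b : V) : a *+ n.+1 = b *+ n.+1 -> a = b.
Proof.
by rewrite -!(scaler_nat n.+1) => /(scalerI (char0 n)).
Qed.

Lemma poly_mulrSn_inj (n : nat) (p q : {poly A}) : p *+ n.+1 = q *+ n.+1 -> p = q.
Proof.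
move=> /polyP eq_pq; apply/polyP => i; apply: (@mulrSn_inj _ n).
by rewrite -!coefMn.
Qed.

(** When C has no constant term, C^j has order at least j, so the terms j > n do not reach degree n
    and the exponential series can be cut there. *)
Definition sexp (C : ser A) : ser A :=
  Ser (fun n => \sum_(j < n.+1) (j`!%:R : F)^-1 *: (C ^+ j) n).

Variable C : ser A.
Hypothesis C0 : C 0%N = 0.

Lemma sexp0 : sexp C 0%N = 1.
Proof. by rewrite /= big_ord1 invr1 scale1r. Qed.

Lemma sexp_wide d n : (n < d)%N ->
  sexp C n = \sum_(j < d) (j`!%:R : F)^-1 *: (C ^+ j) n.
Proof.
move=> lt_nd; rewrite /= (big_ord_widen d (fun j => (j`!%:R : F)^-1 *: (C ^+ j) n)) //.
rewrite big_mkcond; apply: eq_bigr => j _; case: ltnP => // le_nj.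
by rewrite serX_low // scaler0.
Qed.

Lemma sder_sexp : sder (sexp C) = sder C * sexp C.
Proof.
apply: serP => -[|n]; first by rewrite serM big_ord1 /= C0 mul0rn mul0r.
rewrite [LHS]/= big_ord_recl expr0 ser1 scaler0 add0r -sumrMnl.
transitivity (\sum_(j < n.+1) (j`!%:R : F)^-1 *: (sder C * C ^+ j) n.+1).
  apply: eq_bigr => j _; rewrite lift0 scalerMnr.
  have -> : (C ^+ j.+1) n.+1 *+ n.+1 = ((C ^+ j * sder C) *+ j.+1) n.+1 by rewrite -sderX.
  rewrite serMn -scaler_nat scalerA [C ^+ j * _]mulrC; congr (_ *: _).
  by rewrite factS natrM invfM mulrAC mulVf ?mul1r // char0.
have dC0 : sder C 0%N = 0 by rewrite /= C0.
under eq_bigr do rewrite serM big_ord_recl dC0 mul0r add0r scaler_sumr.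
rewrite exchange_big serM [RHS]big_ord_recl dC0 mul0r add0r.
apply: eq_bigr => i _; rewrite (@sexp_wide n.+1); last by rewrite /= /bump; move: (ltn_ord i); lia.
by rewrite mulr_sumr; apply: eq_bigr => j _; rewrite scalerAr.
Qed.

End SerExp.

Lemma sexpN (F : fieldType) (A : comAlgType F) (C : ser A) :
    (forall n : nat, n.+1%:R != 0 :> F) -> C 0%N = 0 -> sexp C * sexp (- C) = 1.
Proof.
move=> char0 C0; have NC0 : (- C) 0%N = 0 by rewrite serN C0 oppr0.
apply: (@sder_unique _ 0) => //; first exact: (mulrSn_inj char0).
- rewrite sderM (sder_sexp char0 C0) (sder_sexp char0 NC0) mul0r.
  have -> : sder (- C) = - sder C by apply: serP => n /=; rewrite mulNrn.
  by rewrite mulNr mulrN -mulrA [sexp C * (_ * _)]mulrCA subrr.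
- by rewrite sder1 mul0r.
- by rewrite serM big_ord1 sexp0 sexp0 mulr1.
Qed.

Section LogDerivative.
Variable B : comNzRingType.
Hypothesis charB : forall (n : nat) (a b : B), a *+ n.+1 = b *+ n.+1 -> a = b.
Variables (P P' Q f g : ser B).
Hypotheses (P0 : P 0%N = 0) (P'0 : P' 0%N = 0) (Q0 : Q 0%N = 1) (QP' : Q * P' = - sder Q).
Hypotheses (dg : sder g = P * g) (fg0 : f 0%N = g 0%N).

Let QM0 h : (Q * h) 0%N = h 0%N.
Proof. by rewrite serM big_ord1 Q0 mul1r. Qed.

(** [P'] is minus the logarithmic derivative of Q, so Q f has the same logarithmic derivative P as
    g. Keeping Q as a factor expresses f = g / Q without an inverse. *)
Lemma log_der_div : sder f = (P + P') * f -> Q * f = g.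
Proof.
move=> df; apply: (sder_unique charB P0) => //; last by rewrite QM0.
have dQ : sder Q = - (Q * P') by rewrite QP' opprK.
by rewrite sderM df dQ; ring.
Qed.

Lemma log_der_mul : sder f = (P - P') * f -> f = Q * g.
Proof.
move=> df; apply: (sder_unique charB (P := P - P')) => //; last by rewrite QM0.
  by rewrite serD serN P0 P'0 subr0.
have dQ : sder Q = - (Q * P') by rewrite QP' opprK.
by rewrite sderM dg dQ; ring.
Qed.

End LogDerivative.

(** * The series E(t) and the substitution given by the annihilation operators *)

Section FockSeries.
Variables (F : fieldType) (A : fock_space F).
Hypothesis char0 : forall n : nat, n.+1%:R != 0 :> F.
Local Notation var := (@fs_var F A).
Implicit Types (v : A) (n : int) (c : F).

Definition create_ser : ser A :=
  Ser (fun n : nat => if n is k.+1 then (k.+1%:R : F)^-1 *: var k else 0).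
Definition var_ser : ser A := Ser (fun n : nat => if n is k.+1 then var k else 0).

Lemma sder_create : sder create_ser = var_ser.
Proof.
apply: serP => -[|n] //=.
by rewrite -scaler_nat scalerA mulfV ?scale1r.
Qed.

Definition Eser : ser A := sexp create_ser.
Definition EVser : ser A := sexp (- create_ser).

Lemma EserV : Eser * EVser = 1. Proof. exact: sexpN. Qed.
Lemma sder_Eser : sder Eser = var_ser * Eser.
Proof. by rewrite sder_sexp // sder_create. Qed.
Lemma Eser0 : Eser 0%N = 1. Proof. exact: sexp0. Qed.

Lemma fs_vac_Eser : ser_map (fs_vac A) Eser = 1.
Proof.
apply: (@sder_unique _ 0) => //; first exact: (@mulrSn_inj _ char0 F^o).
- rewrite sder_map sder_Eser rmorphM mul0r /= (_ : ser_map _ var_ser = 0) ?mul0r //.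
  by apply: serP => -[|n]; rewrite ser0 /= ?fs_vac_var ?rmorph0.
- by rewrite sder1 mul0r.
- by rewrite -[LHS]/(fs_vac A (Eser 0%N)) Eser0 rmorph1.
Qed.

Lemma azop_exp_ser (C : ser A) (P : azop A) n v : C 0%N = 0 ->
  (forall n v, P n v = cz C n * v) -> azop_exp P n v = cz (sexp C) n * v.
Proof.
move=> C0 PC.
have powE j m w : iter j (azop_mul P) (@azop_one _ A) m w = cz (C ^+ j) m * w.
  elim: j m w => [|j IH] m w.
    rewrite /= /azop_one expr0; case: m => [[|m]|m] //=; rewrite ?mul1r ?mul0r //.
  rewrite iterS exprS /azop_mul; under eq_zsum do rewrite PC IH mulrA.
  rewrite -[in RHS](mul1r w).
  case: m => [m|m]; last first.
    rewrite [in RHS]cz_neg // !mul0r -[RHS]zsum0; apply: eq_zsum => -[i|i].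
      by rewrite cz_neg ?mul0r //; lia.
    by rewrite [cz (C ^+ j) _]cz_neg // mulr0 mul0r.
  rewrite /zsum (@fsum_seq _ _ [seq Posz i | i <- iota 0 m.+1]).
  - rewrite big_map /cz serM mul1r mulr_suml sum_iota.
    rewrite [RHS](reindex_inj rev_ord_inj); apply: eq_bigr => i _ /=.
    have -> : m%:Z - i%:Z = (m - i)%N%:Z by move: (ltn_ord i); lia.
    by rewrite subSS subKn // -ltnS.
  - by rewrite map_inj_uniq ?iota_uniq // => i i' [].
  - move=> [i|i] i_notin; last by rewrite [cz (C ^+ j) _]cz_neg // mulr0 mul0r.
    rewrite cz_neg ?mul0r //; move: i_notin.
    by rewrite mem_map ?mem_iota; [lia|move=> ? ? []].
rewrite /azop_exp; under eq_fsbigr do rewrite powE scalerAl.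
case: n => [n|n]; last first.
  rewrite [in RHS]cz_neg // mul0r fsbig1 // => j _.
  by rewrite cz_neg // scaler0 mul0r.
rewrite (@fsum_seq _ _ (iota 0 n.+1)) ?iota_uniq //.
  by rewrite sum_iota -mulr_suml.
move=> j; rewrite mem_iota /= => lt_nj; rewrite serX_low ?scaler0 ?mul0r //; lia.
Qed.

(* The substitution a_{-k} -> a_{-k} + c (z^k + z^-k), with z + 1/z = 'X. *)
Definition is_zshift c (phi : {rmorphism A -> {poly A}}) : Prop :=
  (forall k, phi (var k) = (var k)%:P + (c%:A)%:P * dickson A k.+1) /\
  (forall a v, phi (a *: v) = (a%:A)%:P * phi v).

Lemma zshift_exists c : exists phi, is_zshift c phi.
Proof.
have [phi [h1 h2]] := @fs_hom F A {poly A} (polyC \o in_alg A)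
  (fun k => (var k)%:P + (c%:A)%:P * dickson A k.+1).
by exists phi.
Qed.

Lemma zann_exp_lpair c phi n v : is_zshift c phi ->
  azop_exp (zann c) n v = lpair (@zdelta A) (phi v) n.
Proof.
move=> [h1 h2]; elim/(@fs_ind F): v n => [u v IHu IHv|a v IH||k v IH] n.
- by rewrite zann_exp_zmod IHu IHv rmorphD lpairD.
- by rewrite zann_expZ IH h2 lpairCM mulr_algl.
- by rewrite zann_exp1 rmorph1 lpair1 /azop_one /zdelta; case: eqP.
- rewrite zann_exp_var // !IH rmorphM h1 mulrDl lpairD lpairCM -mulrA lpairCM.
  by rewrite lpair_dickson mulr_algl.
Qed.

(** With ['X] = z + 1/z this is (1 - z t)(1 - t/z). *)
Definition quad_ser : ser {poly A} := 1 - serC 'X * serX + serX * serX.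
Definition dickson_ser : ser {poly A} :=
  Ser (fun n : nat => if n is k.+1 then dickson A k.+1 else 0).

(** Each factor 1 - z^e t, e = 1 or -1, has logarithmic derivative -\sum_(k >= 1) z^(e k) t^k. The
    coefficients are compared through the Dickson recurrence, low degrees apart. *)
Lemma quad_dickson : quad_ser * dickson_ser = - sder quad_ser.
Proof.
have dX : sder serX = serX :> ser {poly A} by apply: serP => -[|[|n]] /=; rewrite ?mul0rn.
have dC (c : {poly A}) : sder (serC c) = 0 by apply: serP => -[|n]; rewrite //= mul0rn.
have -> : sder quad_ser = - (serC 'X * serX) + serX * serX + serX * serX.
  have dN (f : ser {poly A}) : sder (- f) = - sder f by apply: serP => n /=; rewrite mulNrn.
  by rewrite /quad_ser !sderD dN !sderM dX !dC; ring.
apply: serP => -[|[|[|n]]]; rewrite /quad_ser mulrDl mulrBl mul1r -!mulrA;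
  rewrite !(serD, serN, serCM, ser1, serXM, serXM0).
- by rewrite /=; ring.
- by rewrite /=; ring.
- by rewrite /=; ring.
- have dE k : dickson_ser k.+1 = dickson A k.+1 by [].
  have X0 k : serX k.+2 = 0 :> {poly A} by [].
  by rewrite !dE dicksonSS !X0; ring.
Qed.

End FockSeries.

(** * Column operations, and linear forms applied to determinants *)

Section Determinants.
Variable R : comNzRingType.

(** Right multiplication subtracts x times the old column j - 1 from every column j > s
    simultaneously; being unitriangular, it keeps determinants. *)
Definition shear_mx k (s : nat) (x : R) : 'M[R]_k :=
  \matrix_(i, j) ((i == j)%:R - x * ((i.+1 == j) && (s < j))%N%:R).

Lemma det_shear k s x : \det (shear_mx k s x) = 1.
Proof.
rewrite -det_tr det_trig.
  rewrite big1 // => i _; rewrite !mxE eqxx.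
  by rewrite (_ : (i.+1 == i) = false) ?mulr0 ?subr0 //; lia.
apply/is_trig_mxP => i j lt_ij; rewrite !mxE.
have -> : (j == i) = false by apply/eqP => eq_ij; rewrite eq_ij ltnn in lt_ij.
by rewrite (_ : (j.+1 == i) = false) ?mulr0 ?subr0 //; lia.
Qed.

Lemma mulmx_shear_low m k s x (M : 'M[R]_(m, k)) i (j : 'I_k) :
  (j <= s)%N -> (M *m shear_mx k s x) i j = M i j.
Proof.
move=> le_js; rewrite mxE (bigD1 j) //= mxE eqxx [(s < j)%N]ltnNge le_js andbF.
rewrite mulr0 subr0 mulr1 big1 ?addr0 // => j' ne; rewrite mxE (negPf ne).
by rewrite [(s < j)%N]ltnNge le_js andbF mulr0 subr0 mulr0.
Qed.

Lemma mulmx_shear_high m k s x (M : 'M[R]_(m, k)) i (j j' : 'I_k) :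
  (s < j)%N -> j'.+1 = j -> (M *m shear_mx k s x) i j = M i j - x * M i j'.
Proof.
move=> lt_sj def_j; have ne : j' != j by apply/eqP => eq_j; rewrite -eq_j in def_j; lia.
rewrite mxE (bigD1 j) //= (bigD1 j') //= !mxE eqxx (negPf ne) def_j eqxx lt_sj.
rewrite (_ : (j.+1 == j) = false) /=; last by lia.
rewrite mulr0 subr0 !mulr1 sub0r mulrN [_ * x]mulrC big1 ?addr0 // => a /andP[ne1 ne2].
rewrite mxE (negPf ne1) (_ : (a.+1 == j) = false) /= ?mulr0 ?subr0 ?mulr0 //.
apply/negbTE; apply: contra ne2 => /eqP eq_a; apply/eqP/val_inj => /=; lia.
Qed.

Lemma det_mulmx_shear k s x (M : 'M[R]_k) : \det (M *m shear_mx k s x) = \det M.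
Proof. by rewrite det_mulmx det_shear mulr1. Qed.

(** Subtracting x times the preceding column reduces the row of powers to (1, 0, ..., 0), and
    expansion along that row leaves the minor on the right. *)
Lemma det_border_powers k (x : R) (c : 'I_k -> nat -> R) :
  \det (\matrix_(a < k.+1, j < k.+1)
          (if unlift ord0 a is Some a' then c a' j else x ^+ j)) =
  \det (\matrix_(a < k, j < k) (c a j.+1 - x * c a j)).
Proof.
set M := \matrix_(a, j) _; rewrite -(det_mulmx_shear 0 x M) (expand_det_row _ ord0).
rewrite big_ord_recl big1 ?addr0 => [|j _].
  rewrite mulmx_shear_low // mxE unlift_none expr0 mul1r /cofactor expr0 mul1r.
  congr (\det _); apply/matrixP => a j; rewrite 2!mxE.
  rewrite (@mulmx_shear_high _ _ _ _ _ _ _ (widen_ord (leqnSn k) j)) ?lift0 //.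
  by rewrite !mxE liftK lift0.
rewrite (@mulmx_shear_high _ _ _ _ _ _ _ (widen_ord (leqnSn k) j)) ?lift0 //.
by rewrite !mxE unlift_none lift0 exprS subrr mul0r.
Qed.

End Determinants.

Section DetLpair.
Variable A : comNzRingType.
Implicit Types (G : int -> A) (n : int).


(** [lpair] is linear over A, so it passes through a determinant in which a single row involves
    ['X]. *)
Lemma lpair_det_row G n k (p : 'I_k.+1 -> {poly A}) (c : 'I_k -> 'I_k.+1 -> A) :
  lpair G (\det (\matrix_(a < k.+1, j < k.+1)
    (if unlift ord0 a is Some a' then (c a' j)%:P else p j))) n =
  \det (\matrix_(a < k.+1, j < k.+1)
    (if unlift ord0 a is Some a' then c a' j else lpair G (p j) n)).
Proof.
rewrite !(expand_det_row _ ord0) lpair_sum; apply: eq_bigr => j _.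
rewrite !mxE unlift_none /cofactor -signr_odd -[in RHS]signr_odd.
set M := row' _ _; set N := row' _ _.
have -> : M = map_mx polyC N by apply/matrixP => a b; rewrite !mxE liftK.
by rewrite det_map_mx -(rmorph_sign polyC) -polyCM lpairMC.
Qed.

Lemma lpair_det_col G n k (s : 'I_k) (M : 'M[{poly A}]_k)
    (N : 'M[A]_k) :
    (forall a, lpair G (M a s) n = N a s) ->
    (forall a j, j != s -> M a j = (N a j)%:P) ->
  lpair G (\det M) n = \det N.
Proof.
move=> Ms Mj; rewrite !(expand_det_col _ s) lpair_sum; apply: eq_bigr => a _.
rewrite /cofactor -signr_odd -[in RHS]signr_odd.
have -> : row' a (col' s M) = map_mx polyC (row' a (col' s N)).
  by apply/matrixP => b j; rewrite !mxE Mj // eq_sym neq_lift.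
by rewrite det_map_mx -(rmorph_sign polyC) -polyCM lpairMC Ms.
Qed.

End DetLpair.

Section IterMorph.
Variables (A B : comNzRingType) (phi : {rmorphism A -> B}).

Lemma iter_zS_morph j (G : int -> A) n :
  phi (iter j (@zS A) G n) = iter j (@zS B) (fun m => phi (G m)) n.
Proof. by elim: j n => // j IH n; rewrite !iterS !zSE rmorphD !IH. Qed.

End IterMorph.

(** * Vertex operators acting on determinants *)

Section VertexOperators.
Variables (F : fieldType) (A : fock_space F).
Hypothesis char0 : forall n : nat, n.+1%:R != 0 :> F.
Local Notation var := (@fs_var F A).
Local Notation E := (Eser A).
Local Notation EV := (EVser A).
Implicit Types (v : A) (n : int) (c : F).

Definition azop_linear c : azop A := fun n v =>
  if n == 0 then v else if n == 1 then c *: v else 0.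

Lemma azop_linearE c (w : int -> A) n :
  zsum (fun i => azop_linear c (n - i) (w i)) = w n + c *: w (n - 1).
Proof.
rewrite -(zsum_delta n w) -(zsum_delta (n - 1) (fun i => c *: w i)) -zsumD; last first.
- exact: zbounded_delta.
- exact: zbounded_delta.
apply: eq_zsum => i; rewrite /azop_linear subr_eq0 eq_sym.
case: eqP => [->|ni]; first by rewrite (_ : (n == n - 1) = false) ?addr0 //; lia.
by rewrite add0r (_ : (n - i == 1) = (i == n - 1)) //; lia.
Qed.

(** By normal ordering the annihilation half acts first, as the substitution [phi], and the creation
    half then multiplies by a series, which also absorbs 1 + c z. *)
Lemma vertex_lpair (c d : F) (C : ser A) (P : azop A) (phi : {rmorphism A -> {poly A}}) n v :
    C 0%N = 0 -> (forall n v, P n v = cz C n * v) -> is_zshift d phi ->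
  azop_mul (azop_linear c) (azop_mul (azop_exp P) (azop_exp (zann d))) n v =
  lpair (cz ((1 + serC c%:A * serX) * sexp C)) (phi v) n.
Proof.
move=> C0 PC phi_shift.
have inner m w : azop_mul (azop_exp P) (azop_exp (zann d)) m w = lpair (cz (sexp C)) (phi w) m.
  rewrite -zsum_conv_lpair; apply: eq_zsum => i.
  by rewrite (azop_exp_ser _ _ C0 PC) (zann_exp_lpair char0 _ _ phi_shift).
rewrite {1}/azop_mul azop_linearE !inner -[c *: lpair _ _ _]mulr_algl.
rewrite -(lpair_shift (-1)) -lpair_ZG -lpair_DG; congr lpair.
by apply/funext => m; rewrite mulrDl mul1r -mulrA czD czC czX.
Qed.

Lemma quad_ser0 : quad_ser A 0%N = 1.
Proof. by rewrite /quad_ser !(serD, serN, serXM0, serCM) /= mulr0 subr0 addr0. Qed.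

Lemma ser_mul_inj (R : comNzRingType) (Q f g : ser R) : Q 0%N = 1 -> Q * f = Q * g -> f = g.
Proof.
move=> Q0 eq_fg; apply: serP => n; elim/ltn_ind: n => n IH.
have := congr1 (fun h : ser R => h n) eq_fg; rewrite !serM !big_ord_recl Q0 !mul1r subn0.
have -> : \sum_(i < n) Q (lift ord0 i) * f (n - lift ord0 i)%N =
          \sum_(i < n) Q (lift ord0 i) * g (n - lift ord0 i)%N.
  by apply: eq_bigr => i _; rewrite IH // lift0; move: (ltn_ord i); lia.
by move/addIr.
Qed.

(** On coefficients, multiplication by 1 - X t + t^2 is the difference operator [zS] minus ['X],
    shifted by one: this is how c_{j+1} - X c_j arises from the column entry c_j. *)
Lemma cz_quad (f : ser {poly A}) n :
  cz (quad_ser A * f) n = zS (cz f) (n - 1) - 'X * cz f (n - 1).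
Proof.
rewrite /quad_ser mulrDl mulrBl mul1r -!mulrA czD czB czC !czX zSE subrK; ring.
Qed.

Section Shift.
Variable phi : {rmorphism A -> {poly A}}.

Lemma ser_map_zshift c : is_zshift c phi ->
  sder (ser_map phi E) =
  (ser_map polyC (var_ser A) + serC (c%:A)%:P * dickson_ser A) * ser_map phi E.
Proof.
move=> [h1 h2]; rewrite sder_map (sder_Eser A char0) rmorphM /=; congr (_ * _).
apply: serP => -[|n]; rewrite serD serCM /=; first by rewrite rmorph0 mulr0 addr0.
exact: h1.
Qed.

Let P0 : ser_map polyC (var_ser A) 0%N = 0. Proof. exact: rmorph0. Qed.
Let dE : sder (ser_map polyC E) = ser_map polyC (var_ser A) * ser_map polyC E.
Proof. by rewrite sder_map (sder_Eser A char0) rmorphM. Qed.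
Let E0 : ser_map phi E 0%N = ser_map polyC E 0%N.
Proof. by rewrite -[LHS]/(phi (E 0%N)) -[RHS]/((E 0%N)%:P) Eser0 !rmorph1. Qed.

(** The exponent of E changes by -\sum_(k >= 1) (z^k + z^-k) t^k / k, the logarithm of (1 - z t)(1 -
    t/z). *)
Lemma zshiftN_Eser : is_zshift (-1) phi -> ser_map phi E = quad_ser A * ser_map polyC E.
Proof.
move=> hphi; apply: (log_der_mul (poly_mulrSn_inj char0) P0 _ quad_ser0 (quad_dickson A) dE E0).
  by [].
by rewrite (ser_map_zshift hphi) scaleN1r polyCN rmorphN rmorph1 mulN1r.
Qed.

Lemma zshift1_Eser : is_zshift 1 phi -> quad_ser A * ser_map phi E = ser_map polyC E.
Proof.
move=> hphi; apply: (log_der_div (poly_mulrSn_inj char0) P0 quad_ser0 (quad_dickson A) dE E0).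
by rewrite (ser_map_zshift hphi) scale1r rmorph1 mul1r.
Qed.

Lemma zshift_scalar c a : is_zshift c phi -> phi a%:A = (a%:A)%:P.
Proof. by move=> [_ h]; rewrite h rmorph1 mulr1. Qed.

End Shift.

Lemma iter_zS_polyC k j (G : int -> A) n :
  iter j (@zS {poly A}) (fun m => (G (m + k))%:P) n = (iter j (@zS A) G (n + k))%:P.
Proof. by rewrite -(iter_zS_morph polyC j (fun m => G (m + k))) iter_zS_shift. Qed.

Lemma zshiftN_iter (phi : {rmorphism A -> {poly A}}) (f : ser A) j n :
    ser_map phi f = quad_ser A * ser_map polyC f ->
  phi (iter j (@zS A) (cz f) n) =
  (iter j.+1 (@zS A) (cz f) (n - 1))%:P - 'X * (iter j (@zS A) (cz f) (n - 1))%:P.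
Proof.
move=> phif; rewrite iter_zS_morph.
have -> : (fun m => phi (cz f m)) =
    fun m => (zS (cz f) (m + -1))%:P + (- 'X) * (cz f (m + -1))%:P.
  apply/funext => m; rewrite -cz_map phif cz_quad mulNr !zSE !(cz_map polyC).
  by rewrite /= polyCD.
by rewrite iter_zSD iter_zSZ !iter_zS_polyC mulNr zS_iter.
Qed.

(** Here the substitution divides f by 1 - X t + t^2, so combining adjacent columns restores a
    series free of ['X], with the argument moved up by one. *)
Lemma zshift1_iter (phi : {rmorphism A -> {poly A}}) (f : ser A) j n :
    quad_ser A * ser_map phi f = ser_map polyC f ->
  phi (iter j.+1 (@zS A) (cz f) n) - 'X * phi (iter j (@zS A) (cz f) n) =
  (iter j (@zS A) (cz f) (n + 1))%:P.
Proof.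
move=> phif; rewrite !iter_zS_morph iterSr -mulNr -iter_zSZ -iter_zSD.
have -> : (fun m => zS (fun m' => phi (cz f m')) m + (- 'X) * phi (cz f m)) =
    fun m => (cz f (m + 1))%:P.
  apply/funext => m; have := cz_quad (ser_map phi f) (m + 1).
  rewrite phif (cz_map polyC) addrK => ->; rewrite !zSE !(cz_map phi) mulNr.
  by [].
by rewrite iter_zS_polyC iter_zS_morph.
Qed.

Definition aket (U : int -> A -> A) (s : seq nat) : A :=
  foldr (fun p : nat => U p) 1 s.

(* U_{-p} maps a column entry c_j to c_{j+1} - X c_j, and [det_border_powers]
   turns the resulting determinant into one with an additional row. *)
Lemma ket_det (U : int -> A -> A) (phi : {rmorphism A -> {poly A}}) (s : seq nat)
    (f := (1 + serX) * E) :
    is_zshift (-1) phi -> (forall n v, U n v = lpair (cz f) (phi v) n) ->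
  aket U s =
  \det (\matrix_(a < size s, j < size s) iter j (@zS A) (cz f) ((nth 0%N s a)%:Z - a%:Z)).
Proof.
move=> hphi Uphi; elim: s => [|p s IH]; first by rewrite det_mx00.
rewrite [LHS]/= -/(aket U s) IH Uphi -det_map_mx; set k := size s.
pose c (a : 'I_k) (j : nat) : A := iter j (@zS A) (cz f) ((nth 0%N s a)%:Z - a.+1%:Z).
have phif : ser_map phi f = quad_ser A * ser_map polyC f.
  by rewrite /f !rmorphM !rmorphD !rmorph1 /= !ser_mapX (zshiftN_Eser hphi) mulrCA.
set M := map_mx _ _.
have -> : M = \matrix_(a < k, j < k) ((c a j.+1)%:P - 'X * (c a j)%:P).
  apply/matrixP => a j; rewrite !mxE (zshiftN_iter _ _ phif) /c.
  by rewrite (_ : _ - a%:Z - 1 = (nth 0%N s a)%:Z - a.+1%:Z) //; lia.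
rewrite -(det_border_powers 'X (fun a j => (c a j)%:P)).
rewrite (lpair_det_row (cz f) p (fun j => 'X^j) (fun a j => c a j)).
congr (\det _); apply/matrixP => a j; rewrite !mxE.
case: unliftP => [a'|] -> /=; last by rewrite lpairXn subr0.
by rewrite /c.
Qed.

(** With ['X] = z + 1/z this is z^-p + ... + z^p, the coefficient of t^p in (1 + t) / (1 - X t +
    t^2). *)
Fixpoint cheb (p : nat) : {poly A} :=
  match p with
  | 0 => 1
  | S p' => if p' is S p'' then 'X * cheb p' - cheb p'' else 'X + 1
  end.

Lemma chebSS p : cheb p.+2 = 'X * cheb p.+1 - cheb p. Proof. by []. Qed.

Lemma quad_cheb : quad_ser A * Ser cheb = 1 + serX.
Proof.
apply: serP => -[|[|[|p]]]; rewrite /quad_ser mulrDl mulrBl mul1r -!mulrA;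
  rewrite !(serD, serN, serCM, ser1, serXM, serXM0).
- by rewrite /=; ring.
- by rewrite /=; ring.
- by rewrite /=; ring.
- have cE q : Ser cheb q = cheb q by [].
  have X0 q : serX q.+2 = 0 :> {poly A} by [].
  by rewrite !cE chebSS !X0 (_ : (p.+3 == 0%N)%:R = 0) //; ring.
Qed.

(** Multiplying z^-p + ... + z^p by 1 - z telescopes to the two end terms. *)
Lemma lpair_cheb (G : int -> A) p n :
  lpair (fun m => G m - G (m - 1)) (cheb p) n = G (n + p%:Z) - G (n - p.+1%:Z).
Proof.
move: n; have [//] : (forall n,
    lpair (fun m => G m - G (m - 1)) (cheb p) n = G (n + p%:Z) - G (n - p.+1%:Z)) /\
  (forall n, lpair (fun m => G m - G (m - 1)) (cheb p.+1) n =
     G (n + p.+1%:Z) - G (n - p.+2%:Z)).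
elim: p => [|p [IH1 IH2]]; split=> // n.
- by rewrite lpair1 addr0.
- rewrite lpairD -{1}['X]mulr1 lpairXM !lpair1 zSE.
  have e1 : n - 1 - 1 = n - 2%:Z by lia.
  have e2 : n + 1%:Z = n + 1 by lia.
  by rewrite addrK e1 e2; ring.
rewrite chebSS lpairB lpairXM lpair_zS !IH2 IH1.
rewrite (_ : n - 1 + p.+1%:Z = n + p%:Z); last by lia.
rewrite (_ : n + 1 - p.+2%:Z = n - p.+1%:Z); last by lia.
rewrite (_ : n - 1 - p.+2%:Z = n - p.+3%:Z); last by lia.
rewrite (_ : n + 1 + p.+1%:Z = n + p.+2%:Z); last by lia.
by ring.
Qed.

(* The contraction of U^*_{-m} with a column of the determinant: the series E
   cancels against its inverse and leaves a scalar column. *)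
Lemma lpair_contract (phi : {rmorphism A -> {poly A}}) (H : ser A) (m : nat) n
    (f := (1 + serX) * (E * H)) :
    quad_ser A * ser_map phi f = ser_map polyC f ->
  lpair (cz ((1 - serX) * EV)) (phi (cz f n)) (- m%:Z) = cz H (n - m%:Z).
Proof.
move=> phif; case: n => [n|n]; last by rewrite rmorph0 lpair0 cz_neg //; lia.
have eq_f : ser_map phi f = ser_map polyC (E * H) * Ser cheb.
  apply: (ser_mul_inj quad_ser0); rewrite phif mulrCA quad_cheb /f.
  by rewrite rmorphM rmorphD rmorph1 /= ser_mapX mulrC.
have -> : phi (cz f n) = \sum_(i < n.+1) ((E * H) i)%:P * cheb (n - i)%N.
  by rewrite -(cz_map phi) eq_f /cz serM.
rewrite lpair_sum.
have -> : cz ((1 - serX) * EV) = fun k => cz EV k - cz EV (k - 1).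
  by apply/funext => k; rewrite mulrBl mul1r czB czX.
have term i : lpair (fun k => cz EV k - cz EV (k - 1)) (((E * H) i)%:P * cheb (n - i)%N) (- m%:Z) =
    (E * H) i * (serX ^+ m * EV) (n - i)%N.
  (* In degree -m <= 0 one of the two end terms has a negative index and vanishes. *)
  rewrite lpairCM lpair_cheb [cz EV (- m%:Z - _)]cz_neg ?subr0; last by lia.
  by rewrite addrC -czXn.
under eq_bigr do rewrite term.
rewrite -serM.
have -> : E * H * (serX ^+ m * EV) = serX ^+ m * H.
  by rewrite mulrCA [E * H]mulrC -mulrA [H * (E * EV)]mulrC EserV // mul1r.
by rewrite -czXn.
Qed.

(* The determinant obtained after the first s operators U^* have been applied. *)
Definition bra_mx k (R : 'I_k -> int) (f H : ser A) (mu : seq nat) (s : nat) : 'M[A]_k :=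
  \matrix_(a < k, j < k)
    (if (j < s)%N then cz H (R a + j%:Z - (nth 0%N mu j)%:Z)
     else iter (j - s) (@zS A) (cz f) (R a + s%:Z)).

(** The columns before s are scalar and fixed by [phi]. Each column past s becomes free of ['X]
    after subtracting ['X] times its left neighbour. Only column s still involves ['X], so the
    operator acts on it alone and contracts it. *)
Lemma bra_step k (R : 'I_k -> int) (h : ser F) (mu : seq nat) (s : nat)
    (Us : int -> A -> A) (phi : {rmorphism A -> {poly A}})
    (H := ser_map (in_alg A) h) (f := (1 + serX) * (E * H)) :
    is_zshift 1 phi ->
    (forall n v, Us n v = lpair (cz ((1 - serX) * EV)) (phi v) n) -> (s < k)%N ->
  Us (- (nth 0%N mu s)%:Z) (\det (bra_mx R f H mu s)) = \det (bra_mx R f H mu s.+1).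
Proof.
move=> hphi Usphi lt_sk.
have phiH : ser_map phi H = ser_map polyC H.
  by apply: serP => n; rewrite /= (zshift_scalar _ hphi).
have phif : quad_ser A * ser_map phi f = ser_map polyC f.
  rewrite /f !rmorphM !rmorphD !rmorph1 /= !ser_mapX phiH mulrCA.
  by rewrite [quad_ser A * _]mulrA (zshift1_Eser hphi).
rewrite Usphi -det_map_mx -(det_mulmx_shear s 'X).
apply: (lpair_det_col (s := Ordinal lt_sk)) => [a|a j ne_js].
  rewrite mulmx_shear_low // !mxE /= ltnn ltnSn subnn /=.
  exact: lpair_contract.
have {}ne_js : (j : nat) != s by apply: contra ne_js => /eqP js; apply/eqP/val_inj.
case: (ltnP j s) => [lt_js|le_sj].
  rewrite mulmx_shear_low ?(ltnW lt_js) // !mxE lt_js ltnW //.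
  by rewrite -(cz_map phi) phiH (cz_map polyC).
have lt_sj : (s < j)%N by rewrite ltn_neqAle eq_sym ne_js.
have lt_j1 : (j.-1 < k)%N by move: (ltn_ord j); lia.
rewrite (@mulmx_shear_high _ _ _ _ _ _ _ _ (Ordinal lt_j1)) //; last by rewrite /=; lia.
rewrite !mxE /= !ifF; try by apply/negbTE; lia.
have [i def_i] : exists i, (j - s)%N = i.+1 by exists (j - s).-1; lia.
rewrite def_i (_ : j.-1 - s = i)%N; last by lia.
rewrite (_ : j - s.+1 = i)%N; last by lia.
by rewrite (zshift1_iter _ _ phif); congr (iter _ _ _ _)%:P; lia.
Qed.

Definition abra (Us : int -> A -> A) (mu : seq nat) (v : A) : A :=
  foldl (fun w (p : nat) => Us (- p%:Z) w) v mu.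

Lemma bra_det k (R : 'I_k -> int) (h : ser F) (mu : seq nat)
    (Us : int -> A -> A) (phi : {rmorphism A -> {poly A}})
    (H := ser_map (in_alg A) h) (f := (1 + serX) * (E * H)) :
    is_zshift 1 phi ->
    (forall n v, Us n v = lpair (cz ((1 - serX) * EV)) (phi v) n) -> (size mu <= k)%N ->
  abra Us mu (\det (bra_mx R f H mu 0)) = \det (bra_mx R f H mu (size mu)).
Proof.
move=> hphi Usphi le_k; suff step s : (s <= size mu)%N ->
    abra Us (take s mu) (\det (bra_mx R f H mu 0)) = \det (bra_mx R f H mu s).
  by rewrite -[in LHS](take_size mu) step.
elim: s => [|s IH] lt_s; first by rewrite take0.
rewrite (take_nth 0%N) // /abra foldl_rcons -/(abra _ _ _) IH ?(ltnW lt_s) //.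
by apply: bra_step hphi Usphi _; apply: leq_trans le_k.
Qed.

End VertexOperators.

(** * The operators Gamma_+ as ring morphisms *)

Section GammaOperators.
Variables (F : fieldType) (A : fock_space F).
Hypothesis char0 : forall n : nat, n.+1%:R != 0 :> F.
Local Notation var := (@fs_var F A).
Local Notation E := (Eser A).
Implicit Types (v : A) (w : F).

Definition alog_gamma w v : A :=
  \sum_(n \in [set n | (0 < n)%N]%classic) w ^+ n *: fs_deriv n.-1 v.

Lemma alog_gamma_window w v B : (forall k, (B <= k)%N -> fs_deriv k v = 0) ->
  alog_gamma w v = \sum_(n < B) w ^+ n.+1 *: fs_deriv n v.
Proof.
move=> hB; rewrite /alog_gamma (fsbigE (iota 1 B)) ?iota_uniq //.
- rewrite (iotaDl 1 0 B) big_map -(sum_iota B (fun n => w ^+ n.+1 *: fs_deriv n v)); apply: eq_bigl => i.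
  by apply/mem_set.
- by move=> i /=; rewrite mem_iota => /andP[].
- move=> [|n] //= _; rewrite mem_iota => le_Bn; rewrite hB ?scaler0 //; lia.
Qed.

Lemma alog_gammaD w u v : alog_gamma w (u + v) = alog_gamma w u + alog_gamma w v.
Proof.
have [B1 h1] := fock_vars u; have [B2 h2] := fock_vars v.
rewrite !(@alog_gamma_window _ _ (maxn B1 B2)).
- by rewrite -big_split; apply: eq_bigr => i _; rewrite raddfD scalerDr.
- by move=> k; rewrite geq_max => /andP[_ le2]; rewrite h2.
- by move=> k; rewrite geq_max => /andP[le1 _]; rewrite h1.
- by move=> k; rewrite geq_max => /andP[le1 le2]; rewrite raddfD /= h1 // h2 // addr0.
Qed.

Lemma alog_gammaZ w a v : alog_gamma w (a *: v) = a *: alog_gamma w v.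
Proof.
have [B hB] := fock_vars v.
rewrite !(@alog_gamma_window _ _ B) //; last by move=> k /hB; rewrite fs_derivZ => ->; rewrite scaler0.
by rewrite scaler_sumr; apply: eq_bigr => i _; rewrite fs_derivZ !scalerA mulrC.
Qed.

Lemma alog_gamma1 w : alog_gamma w 1 = 0.
Proof. by rewrite (@alog_gamma_window _ _ 0) ?big_ord0 // => k _; rewrite fs_deriv1. Qed.

Lemma alog_gamma_var w k v :
  alog_gamma w (var k * v) = var k * alog_gamma w v + w ^+ k.+1 *: v.
Proof.
have [B hB] := fock_vars v; pose D := (maxn B k.+1).
have hD i : (D <= i)%N -> fs_deriv i v = 0 by rewrite geq_max => /andP[/hB].
rewrite !(@alog_gamma_window _ _ D) //; last first.
  move=> i le_Di; rewrite fs_deriv_var hD // mulr0 add0r gtn_eqF //.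
  by rewrite (leq_trans _ le_Di) // leq_maxr.
under eq_bigr do rewrite fs_deriv_var scalerDr scalerAr.
rewrite big_split mulr_sumr; congr (_ + _).
have lt_kD : (k < D)%N by rewrite leq_maxr.
rewrite (bigD1 (Ordinal lt_kD)) //= eqxx mulr1n big1 ?addr0 // => i ne_i.
have -> : (i == k :> nat) = false by apply: contraNF ne_i => /eqP eq_ik; apply/eqP/val_inj.
by rewrite mulr0n scaler0.
Qed.

Lemma iter_log_gammaD w j u v :
  iter j (alog_gamma w) (u + v) = iter j (alog_gamma w) u + iter j (alog_gamma w) v.
Proof. by elim: j => // j IH; rewrite !iterS IH alog_gammaD. Qed.

Lemma iter_log_gammaZ w j a v :
  iter j (alog_gamma w) (a *: v) = a *: iter j (alog_gamma w) v.
Proof. by elim: j => // j IH; rewrite !iterS IH alog_gammaZ. Qed.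

Lemma iter_log_gamma1 w j : iter j.+1 (alog_gamma w) 1 = 0.
Proof.
elim: j => [|j IH]; first by rewrite /= alog_gamma1.
by rewrite iterS IH -(scale0r 0) alog_gammaZ !scale0r.
Qed.

Lemma iter_log_gamma_var w j k v :
  iter j (alog_gamma w) (var k * v) = var k * iter j (alog_gamma w) v +
    (w ^+ k.+1 *+ j) *: iter j.-1 (alog_gamma w) v.
Proof.
elim: j => [|j IH]; first by rewrite mulr0n scale0r addr0.
rewrite iterS IH alog_gammaD alog_gammaZ alog_gamma_var -addrA; congr (_ + _).
rewrite mulrS scalerDl; congr (_ + _).
by case: j {IH} => [|j]; rewrite ?mulr0n ?scale0r.
Qed.

Lemma iter_log_gamma_nilp w v :
  exists J, forall j, (J <= j)%N -> iter j (alog_gamma w) v = 0.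
Proof.
elim/(@fs_ind F): v => [u v [J1 h1] [J2 h2]|a v [J hJ]||i v [J hJ]].
- exists (maxn J1 J2) => j; rewrite geq_max => /andP[le1 le2].
  by rewrite iter_log_gammaD h1 // h2 // addr0.
- by exists J => j le_Jj; rewrite iter_log_gammaZ hJ // scaler0.
- by exists 1%N => -[|j] // _; rewrite iter_log_gamma1.
- exists J.+1 => -[|j] // le_Jj; rewrite iter_log_gamma_var !hJ //; last exact: leqW.
  by rewrite mulr0 add0r scaler0.
Qed.

Definition agamma w v : A :=
  \sum_(j \in [set: nat]%classic) (j`!%:R : F)^-1 *: iter j (alog_gamma w) v.

Lemma agamma_window w v J : (forall j, (J <= j)%N -> iter j (alog_gamma w) v = 0) ->
  agamma w v = \sum_(j < J) (j`!%:R : F)^-1 *: iter j (alog_gamma w) v.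
Proof.
move=> hJ; rewrite /agamma (@fsum_seq _ _ (iota 0 J)) ?iota_uniq ?sum_iota //.
by move=> j; rewrite mem_iota add0n -leqNgt => le_Jj; rewrite hJ // scaler0.
Qed.

(** [alog_gamma w] is a derivation sending variable k to w^(k+1); its exponential is the translation
    by these constants. *)
Lemma agamma_hom (w : F) : exists psi : {rmorphism A -> A},
  [/\ forall v, agamma w v = psi v, forall k, psi (var k) = var k + w ^+ k.+1 *: 1 &
      forall a v, psi (a *: v) = a *: psi v].
Proof.
have [psi [h1 h2]] := @fs_hom F A A (in_alg A) (fun k => var k + w ^+ k.+1 *: 1).
exists psi; split=> // [|a v]; last by rewrite h2 mulr_algl.
elim/(@fs_ind F) => [u v IHu IHv|a v IH||k v IH].
- have [J1 j1] := iter_log_gamma_nilp w u; have [J2 j2] := iter_log_gamma_nilp w v.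
  rewrite rmorphD -IHu -IHv !(@agamma_window _ _ (maxn J1 J2)).
  + by rewrite -big_split; apply: eq_bigr => i _; rewrite iter_log_gammaD scalerDr.
  + by move=> k; rewrite geq_max => /andP[_ le2]; rewrite j2.
  + by move=> k; rewrite geq_max => /andP[le1 _]; rewrite j1.
  + by move=> k; rewrite geq_max => /andP[le1 le2]; rewrite iter_log_gammaD j1 // j2 // addr0.
- have [J hJ] := iter_log_gamma_nilp w v.
  rewrite h2 -IH mulr_algl !(@agamma_window _ _ J) //; last first.
    by move=> j le_Jj; rewrite iter_log_gammaZ hJ // scaler0.
  by rewrite scaler_sumr; apply: eq_bigr => j _; rewrite iter_log_gammaZ !scalerA mulrC.
- rewrite rmorph1 (@agamma_window _ _ 1) ?big_ord1 /= ?invr1 ?scale1r //.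
  by move=> [|j] // _; rewrite iter_log_gamma1.
- have [J hJ] := iter_log_gamma_nilp w v.
  rewrite rmorphM h1 mulrDl -IH mulr_algl.
  have hv j : (J.+1 <= j)%N -> iter j (alog_gamma w) v = 0 by move/ltnW/hJ.
  have hkv j : (J.+1 <= j)%N -> iter j (alog_gamma w) (var k * v) = 0.
    case: j => // j le_Jj; rewrite iter_log_gamma_var !hJ //; last exact: leqW.
    by rewrite mulr0 add0r scaler0.
  rewrite (agamma_window hv) (agamma_window hkv).
  under eq_bigr do rewrite iter_log_gamma_var scalerDr.
  rewrite big_split mulr_sumr; congr (_ + _).
    by apply: eq_bigr => j _; rewrite scalerAr.
  rewrite big_ord_recl mulr0n scale0r scaler0 /= add0r [in RHS]big_ord_recr /= hJ // scaler0 addr0.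
  rewrite scaler_sumr; apply: eq_bigr => j _; rewrite /bump /= scalerA scalerA.
  congr (_ *: _); rewrite add1n factS natrM invfM -[w ^+ _ *+ _]mulr_natr mulrC -mulrA.
  by rewrite [_ * (_^-1 * _)]mulrA mulfV ?mul1r // char0.
Qed.

Definition geo (R : comNzRingType) (w : R) : ser R := Ser (fun n => w ^+ n).

Lemma geoV (R : comNzRingType) (w : R) : (1 - serC w * serX) * geo w = 1.
Proof.
apply: serP => -[|n]; rewrite mulrBl mul1r -mulrA serD serN serCM ser1 ?serXM ?serXM0 /=.
  by rewrite mulr0 subr0.
by rewrite -exprS subrr.
Qed.

(** The exponent of E grows by \sum_(k >= 1) (w t)^k / k = - log (1 - w t). *)
Lemma agamma_Eser w (psi : {rmorphism A -> A}) :
    (forall k, psi (var k) = var k + w ^+ k.+1 *: 1) ->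
  ser_map psi E = ser_map (in_alg A) (geo w) * E.
Proof.
move=> psi_var; pose Q : ser A := 1 - serC (w%:A) * serX.
have Q0 : Q 0%N = 1 by rewrite serD serN serCM /= mulr0 subr0.
apply: (ser_mul_inj Q0); rewrite mulrA.
have -> : Q * ser_map (in_alg A) (geo w) = 1.
  rewrite -(rmorph1 (ser_map (in_alg A))) -(geoV w) rmorphM rmorphB rmorphM rmorph1 /=.
  by rewrite ser_mapC ser_mapX.
rewrite mul1r; pose P' : ser A := Ser (fun n : nat => if n is k.+1 then w ^+ k.+1 *: 1 else 0).
apply: (log_der_div (P := var_ser A) (P' := P') (@mulrSn_inj _ char0 A)) => //.
- have -> : - sder Q = serC w%:A * serX.
    apply: serP => -[|[|n]]; rewrite serN sderE /Q !(serD, serN, serCM, ser1) /=.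
    + by rewrite mulr0n oppr0 mulr0.
    + by rewrite !mulr1 sub0r mulr1n opprK.
    + by rewrite !mulr0 subr0 mul0rn oppr0.
  apply: serP => -[|[|n]]; rewrite /Q mulrBl mul1r -mulrA.
  + by rewrite !(serD, serN, serCM, serXM0) /= mulr0 subr0.
  + by rewrite !(serD, serN, serCM, serXM) /= mulr0 subr0 expr1 mulr1.
  + by rewrite !(serD, serN, serCM, serXM) /= mulr0 mulr_algl scalerA -exprS subrr.
- exact: sder_Eser.
- by rewrite -[LHS]/(psi (E 0%N)) Eser0 rmorph1.
- rewrite sder_map (sder_Eser A char0) rmorphM /=; congr (_ * _).
  by apply: serP => -[|n]; rewrite serD /= ?rmorph0 ?addr0 ?psi_var.
Qed.

(** The coefficients are the complete symmetric functions of the x_i and their inverses. *)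
Definition hser N (x : 'I_N -> F) : ser F :=
  \prod_(i < N) (geo (x i) * geo ((x i)^-1)).

Lemma agamma_pm_hom N (x : 'I_N -> F) : exists psi : {rmorphism A -> A},
  [/\ forall v, (\big[comp/id]_(i < N) (agamma (x i) \o agamma ((x i)^-1))) v = psi v,
      ser_map psi E = ser_map (in_alg A) (hser x) * E &
      forall a v, psi (a *: v) = a *: psi v].
Proof.
rewrite /hser; elim/big_rec2: _ => [|i H g _ [psi [g_psi psiE psiZ]]].
  by exists (idfun : {rmorphism A -> A}); split=> //; rewrite rmorph1 mul1r; apply: serP.
have [p1 [g1 v1 z1]] := agamma_hom (x i); have [p2 [g2 v2 z2]] := agamma_hom (x i)^-1.
exists (p1 \o (p2 \o psi)); split=> [v||a v] /=.
- by rewrite g_psi g2 g1.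
- have map_comp (f f' : {rmorphism A -> A}) h : ser_map (f \o f') h = ser_map f (ser_map f' h).
    by apply: serP.
  have fixA (f : {rmorphism A -> A}) h : (forall a v, f (a *: v) = a *: f v) ->
      ser_map f (ser_map (in_alg A) h) = ser_map (in_alg A) h.
    by move=> fZ; apply: serP => n /=; rewrite fZ rmorph1.
  rewrite map_comp map_comp psiE !rmorphM /= !fixA // (agamma_Eser v2) rmorphM /= fixA //.
  by rewrite (agamma_Eser v1); ring.
- by rewrite psiZ z2 z1.
Qed.

End GammaOperators.

(** * The skew character as a determinant *)

Section SkewCharacter.
Variables (F : fieldType) (A : fock_space F).
Hypothesis char0 : forall n : nat, n.+1%:R != 0 :> F.
Local Notation E := (Eser A).
Local Notation EV := (EVser A).

(* The matrix of so_{rho/mu}, with rows R a = rho_a - a (0-based). *)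
Definition so_mx k (R : 'I_k -> int) (h : ser F) (mu : seq nat) : 'M[F]_k :=
  \matrix_(a < k, j < k)
    (if (j < size mu)%N then cz h (R a + j%:Z - (nth 0%N mu j)%:Z)
     else iter (j - size mu) (@zS F) (cz ((1 + serX) * h)) (R a + (size mu)%:Z)).

(** The vacuum functional is a ring morphism sending E to 1, so it acts entrywise on the last
    determinant and leaves only H. *)
Lemma so_det_abstract N (x : 'I_N -> F) (U Us : int -> A -> A)
    (phi phi' : {rmorphism A -> {poly A}}) (s mu : seq nat) :
    is_zshift (-1) phi -> is_zshift 1 phi' ->
    (forall n v, U n v = lpair (cz ((1 + serX) * E)) (phi v) n) ->
    (forall n v, Us n v = lpair (cz ((1 - serX) * EV)) (phi' v) n) ->
    (size mu <= size s)%N ->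
  fs_vac A (abra Us mu
    ((\big[comp/id]_(i < N) (@agamma F A (x i) \o @agamma F A (x i)^-1)) (aket U s))) =
  \det (so_mx (fun a : 'I_(size s) => (nth 0%N s a)%:Z - a%:Z) (hser x) mu).
Proof.
move=> hphi hphi' Uphi Usphi le_size; have [psi [-> psiE psiZ]] := agamma_pm_hom A char0 x.
rewrite (ket_det char0 s hphi Uphi) -det_map_mx; set k := size s.
pose R (a : 'I_k) := (nth 0%N s a)%:Z - a%:Z.
pose H := ser_map (in_alg A) (hser x); pose f := (1 + serX) * (E * H).
have psif : ser_map psi ((1 + serX) * E) = f.
  by rewrite /f [E * H]mulrC rmorphM rmorphD rmorph1 /= ser_mapX psiE.
have -> : map_mx psi (\matrix_(a < k, j < k) iter j (@zS A) (cz ((1 + serX) * E)) (R a)) =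
    bra_mx R f H mu 0.
  apply/matrixP => a j; rewrite !mxE iter_zS_morph subn0 addr0.
  by apply: eq_zS_iter => n; rewrite -cz_map psif.
rewrite (bra_det char0 _ _ hphi' Usphi) // -det_map_mx; congr (\det _).
have vacH : ser_map (fs_vac A) H = hser x by apply: serP => n; rewrite /= fs_vacZ.
apply/matrixP => a j; rewrite !mxE; case: ifP => _.
  by rewrite -cz_map vacH.
rewrite iter_zS_morph; apply: eq_zS_iter => n; rewrite -cz_map.
by rewrite !rmorphM rmorphD rmorph1 /= ser_mapX (fs_vac_Eser A char0) mul1r vacH.
Qed.

End SkewCharacter.

(** * Transfer to the given Fock space *)

Section ConcreteFock.
Import monalg.
Variable F : fieldType.
Local Notation fock := {malg F[{cmonom nat}]}.

Fact fock_hom_exists (S : comNzRingType) (iota : {rmorphism F -> S}) (a : nat -> S) :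
  exists phi : {rmorphism fock -> S},
    (forall k, phi (fock_var F k) = a k) /\ (forall c v, phi (c *: v) = iota c * phi v).
Proof.
exists (fock_hom iota a : {rmorphism fock -> S}).
by split=> [k|c v]; [exact: fock_hom_var|exact: fock_homZ].
Qed.

Definition malg_fock : fock_space F :=
  @FockSpace F fock (fock_var F) (@fock_deriv F)
    (@fock_deriv_is_additive F) (@fock_derivZ F) (@fock_deriv1 F) (@fock_deriv_var F)
    (@fock_derivC F) (@fock_ind F) fock_hom_exists (@dual_vac F) (@dual_vac_var F)
    (@dual_vacZ F).

Hypothesis char0 : forall n : nat, n.+1%:R != 0 :> F.

Lemma heisS k (v : fock) : heis k.+1 v = (k.+1%:R : F) *: fock_deriv k v.
Proof. exact/esym/scaler_nat. Qed.

Lemma zannihilE : @zannihil F = @zann F malg_fock 1.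
Proof.
apply/funext => n; apply/funext => v; rewrite /zannihil /zann; case: eqP => [//|/eqP n0].
rewrite -abszE; have [k ->] : exists k, `|n|%N = k.+1 by exists `|n|%N.-1; lia.
rewrite heisS scalerA mulVf; first by [].
exact: char0.
Qed.

Lemma zannihil_oppE : zop_opp (@zannihil F) = @zann F malg_fock (-1).
Proof.
rewrite zannihilE; apply/funext => n; apply/funext => v; rewrite /zop_opp /zann.
by case: eqP => _; [exact: oppr0|rewrite scaleN1r scale1r].
Qed.

Lemma zcreateE n v : @zcreate F n v = cz (create_ser malg_fock) n * v.
Proof.
rewrite /zcreate; case: n => [[|n]|n] /=.
- by rewrite mul0r.
- by rewrite scalerAl.
- by rewrite mul0r.
Qed.

Lemma zcreate_oppE n v : zop_opp (@zcreate F) n v = cz (- create_ser malg_fock) n * v.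
Proof. by rewrite /zop_opp zcreateE czN mulNr. Qed.

Lemma Uz_lpair (phi : {rmorphism malg_fock -> {poly malg_fock}}) n (v : malg_fock) :
    is_zshift (A := malg_fock) (-1) phi ->
  Uz n v = lpair (cz ((1 + serX) * Eser malg_fock)) (phi v) n.
Proof.
move=> hphi; rewrite /Uz zannihil_oppE.
have -> : 1 + serX = 1 + serC (1%:A : malg_fock) * serX :> ser malg_fock.
  by rewrite scale1r rmorph1 mul1r.
exact: (@vertex_lpair F malg_fock char0 1 (-1) (create_ser malg_fock) _ _ n v erefl
  zcreateE hphi).
Qed.

Lemma Ustarz_lpair (phi : {rmorphism malg_fock -> {poly malg_fock}}) n (v : malg_fock) :
    is_zshift (A := malg_fock) 1 phi ->
  Ustarz n v = lpair (cz ((1 - serX) * EVser malg_fock)) (phi v) n.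
Proof.
move=> hphi; rewrite /Ustarz zannihilE.
have -> : 1 - serX = 1 + serC ((-1)%:A : malg_fock) * serX :> ser malg_fock.
  by rewrite scaleN1r rmorphN rmorph1 mulN1r.
exact: (@vertex_lpair F malg_fock char0 (-1) 1 (- create_ser malg_fock) _ _ n v
  (oppr0 _) zcreate_oppE hphi).
Qed.

Lemma GammaE w : Gamma w = @agamma F malg_fock w.
Proof.
have logE : log_Gamma w = @alog_gamma F malg_fock w.
  apply/funext => v; rewrite /log_Gamma /alog_gamma; apply: eq_fsbigr => n /set_mem /= n_gt0.
  case: n n_gt0 => [n_gt0|n _]; first by exfalso.
  rewrite -scaler_nat scalerA mulfVK; first exact: erefl.
  exact: char0.
by apply/funext => v; rewrite /Gamma logE.
Qed.

Lemma so_det N (x : 'I_N -> F) m k (rho : genpart m) (mu : genpart k) : (k <= m)%N ->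
  so x rho mu = \det (so_mx (fun a : 'I_(size rho) => (nth 0%N rho a)%:Z - a%:Z) (hser x) mu).
Proof.
move=> le_km; have [phi hphi] := zshift_exists malg_fock (-1).
have [phi' hphi'] := zshift_exists malg_fock 1.
have le_size : (size mu <= size rho)%N by rewrite !size_tuple.
rewrite -(@so_det_abstract F malg_fock char0 N x (fun n => U (- n)) (@Ustar F) phi phi' rho mu
  hphi hphi' _ _ le_size).
- by rewrite /so /bra /Gamma_pm (funext GammaE).
- by move=> n v; rewrite /U opprK; exact: (Uz_lpair n v hphi).
- by move=> n v; exact: (Ustarz_lpair n v hphi').
Qed.

End ConcreteFock.

(** * The Cauchy-Binet formula *)

Section AlternatingSums.
Variable d : nat.

(** Strictly decreasing maps stand for the l-element subsets in Cauchy-Binet, and also for the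
    shifted partitions rho_i + l - 1 - i with entries below d. *)
Definition decr l (T : {ffun 'I_l -> 'I_d}) : bool :=
  [forall i : 'I_l, forall j : 'I_l, (i < j)%N ==> (T j < T i)%N].

Lemma decrP l (T : {ffun 'I_l -> 'I_d}) :
  reflect (forall i j : 'I_l, (i < j)%N -> (T j < T i)%N) (decr T).
Proof.
apply: (iffP forallP) => [h i j|h i]; first by move/forallP: (h i) => /(_ j)/implyP.
by apply/forallP => j; apply/implyP; apply: h.
Qed.

Definition ffun_perm l (T : {ffun 'I_l -> 'I_d}) (s : 'S_l) : {ffun 'I_l -> 'I_d} :=
  [ffun i => T (s i)].

(** Both u and its inverse are increasing, and an increasing self-map of an initial segment never
    goes below the identity. *)
Lemma mono_perm1 l (u : 'S_l) : (forall i j : 'I_l, (i < j)%N -> (u i < u j)%N) -> u = 1%g.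
Proof.
have ge (w : 'S_l) : (forall i j : 'I_l, (i < j)%N -> (w i < w j)%N) ->
    forall i : 'I_l, (i <= w i)%N.
  move=> mono_w [i lt_il]; elim: i lt_il => // i IH lt_il.
  have lt_i : (i < l)%N by apply: ltnW.
  by apply: leq_ltn_trans (IH lt_i) (mono_w (Ordinal lt_i) (Ordinal lt_il) (ltnSn i)).
move=> mono_u; apply/permP => i; rewrite perm1; apply/val_inj/eqP.
rewrite eqn_leq ge // andbT -{2}(permK u i); apply: ge => {i} i j lt_ij.
rewrite ltnNge leq_eqVlt; apply/negP => /orP[/eqP/val_inj/perm_inj eq_ij|/mono_u].
  by rewrite eq_ij ltnn in lt_ij.
by rewrite !permKV ltnNge (ltnW lt_ij).
Qed.

Lemma decr_inj l (T : {ffun 'I_l -> 'I_d}) : decr T -> injective T.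
Proof.
move/decrP => dT i j eq_T; apply/val_inj/eqP; case: (ltngtP i j) => // /dT.
  by rewrite eq_T ltnn.
by rewrite eq_T ltnn.
Qed.

Lemma decr_perm_uniq l (T T' : {ffun 'I_l -> 'I_d}) s s' : decr T -> decr T' ->
  ffun_perm T s = ffun_perm T' s' -> T = T' /\ s = s'.
Proof.
move=> dT dT' eq_T; have eqT' j : T' j = T ((s'^-1 * s)%g j).
  by have /ffunP/(_ (s'^-1 j)%g) := eq_T; rewrite !ffunE permKV permM.
have u1 : (s'^-1 * s)%g = 1%g.
  apply: mono_perm1 => i j lt_ij; move/decrP: dT' => /(_ _ _ lt_ij); rewrite !eqT'.
  case: (ltngtP ((s'^-1 * s)%g i) ((s'^-1 * s)%g j)) => [//|lt_ji|/val_inj ->]; last by rewrite ltnn.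
  by move/decrP: dT => /(_ _ _ lt_ji) lt1 lt2; rewrite ltnNge (ltnW lt1) in lt2.
have eq_s : s = s' by rewrite -[s]mul1g -(mulgV s') -mulgA u1 mulg1.
by split=> //; apply/ffunP => j; rewrite eqT' u1 perm1.
Qed.

Lemma decr_perm_exists l (T : {ffun 'I_l -> 'I_d}) : injective T ->
  exists T' s, decr T' /\ ffun_perm T' s = T.
Proof.
move=> inj_T; pose r := fun i j : 'I_d => (j <= i)%N.
pose t := [tuple T i | i < l]; pose t' := [tuple of sort r t].
have /tuple_permP[s def_t'] : perm_eq t' t by rewrite perm_sort.
exists (ffun_perm T s), (s^-1)%g; split; last first.
  by apply/ffunP => i; rewrite !ffunE permKV.
have t'E i : tnth t' i = T (s i).
  rewrite (tnth_nth (T (s i))) def_t'.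
  by rewrite -[nth _ _ i]/(nth _ (val [tuple tnth t (s i) | i < l]) i) -tnth_nth !tnth_mktuple.
have r_tr : transitive r by move=> y x z; rewrite /r => h1 h2; apply: leq_trans h2 h1.
have r_tot : total r by move=> x y; apply: leq_total.
apply/decrP => i j lt_ij; rewrite !ffunE ltn_neqAle; apply/andP; split.
  apply/eqP => /val_inj /inj_T /perm_inj eq_ij; by rewrite eq_ij ltnn in lt_ij.
have := sorted_ltn_nth r_tr (T (s i)) (sort_sorted r_tot t).
move=> /(_ i j); rewrite !inE size_sort size_tuple => /(_ (ltn_ord i) (ltn_ord j) lt_ij).
rewrite -[nth _ _ i]/(nth (T (s i)) (val t') i) -[nth _ _ j]/(nth (T (s i)) (val t') j).
by rewrite -!tnth_nth !t'E.
Qed.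

Variables (R : comNzRingType) (l : nat) (G : {ffun 'I_l -> 'I_d} -> R) (B : 'I_l -> 'I_d -> R).
Hypothesis G_perm : forall T s, G (ffun_perm T s) = (-1) ^+ s * G T.
Hypothesis G_ninj : forall T : {ffun 'I_l -> 'I_d}, ~~ injectiveb T -> G T = 0.

(** An injective map factors uniquely into a permutation followed by a decreasing map. The
    alternating G contributes the sign of the permutation, and the signed sum over permutations is
    the determinant. *)
Lemma alternating_sum :
  \sum_T G T * \prod_i B i (T i) =
  \sum_(T | decr T) G T * \det (\matrix_(i, j) B i (T j)).
Proof.
pose h (p : {ffun 'I_l -> 'I_d} * 'S_l) := ffun_perm p.1 p.2.
transitivity (\sum_(p : {ffun 'I_l -> 'I_d} * 'S_l | decr p.1)
    G (h p) * \prod_i B i (h p i)).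
  rewrite [LHS](bigID (fun T : {ffun _} => injectiveb T)) /= [X in _ + X]big1 ?addr0; last first.
    by move=> T /G_ninj ->; rewrite mul0r.
  rewrite [RHS](partition_big h (fun T : {ffun _} => injectiveb T)) /=; last first.
    move=> [T s] /= /decr_inj inj_T; apply/injectiveP => i j.
    by rewrite !ffunE => /inj_T /perm_inj.
  apply: eq_bigr => T /injectiveP /decr_perm_exists [T' [s [dT' def_T]]].
  rewrite (big_pred1 (T', s)) /h ?def_T //= => -[T1 s1] /=.
  apply/andP/eqP => [[dT1 /eqP eq_T]|[-> ->]]; last by rewrite dT' def_T eqxx.
  by have [-> ->] := decr_perm_uniq dT1 dT' (etrans eq_T (esym def_T)).
transitivity (\sum_(T : {ffun 'I_l -> 'I_d} | decr T) \sum_(s : 'S_l)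
    G (h (T, s)) * \prod_i B i (h (T, s) i)).
  by rewrite pair_big; apply: eq_big => [[T s]|[T s] _] //=; rewrite andbT.
apply: eq_bigr => T dT; rewrite /determinant mulr_sumr; apply: eq_bigr => s _.
rewrite /h /= G_perm [_ * G T]mulrC -mulrA; congr (_ * (_ * _)); apply: eq_bigr => i _.
by rewrite ffunE mxE.
Qed.

End AlternatingSums.

Section CauchyBinet.
Variable R : comNzRingType.

Lemma cauchy_binet_rows d m (A : 'I_d -> 'I_m -> R) (B : 'I_m -> 'I_d -> R) :
  \sum_(T : {ffun 'I_m -> 'I_d} | decr T)
     \det (\matrix_(a, c) A (T a) c) * \det (\matrix_(i, j) B i (T j)) =
  \det (\matrix_(i, c) \sum_L B i L * A L c).
Proof.
rewrite -(@alternating_sum d R m (fun T => \det (\matrix_(a, c) A (T a) c)) B).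
- rewrite [RHS]/determinant.
  under [RHS]eq_bigr => s _ do [under eq_bigr do rewrite mxE; rewrite bigA_distr_bigA mulr_sumr].
  rewrite [RHS]exchange_big; apply: eq_bigr => T _; rewrite [in LHS]/determinant mulr_suml.
  apply: eq_bigr => s _; rewrite big_split -mulrA; congr (_ * _).
  by rewrite mulrC; congr (_ * _); apply: eq_bigr => i _; rewrite mxE.
- move=> T s; have -> : \matrix_(a, c) A (ffun_perm T s a) c = row_perm s (\matrix_(a, c) A (T a) c).
    by apply/matrixP => a c; rewrite !mxE ffunE.
  by rewrite row_permE det_mulmx det_perm.
- move=> T /injectivePn [i [j ne_ij eq_T]]; apply: (determinant_alternate ne_ij) => c.
  by rewrite !mxE eq_T.
Qed.

(** With the block [Phi] fixed, the determinant is still an alternating function of the l chosen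
    columns, which is all that [alternating_sum] asks of G. *)
Lemma cauchy_binet_cols d l N (P : 'I_(l + N) -> 'I_d -> R) (B : 'I_l -> 'I_d -> R)
    (Phi : 'M[R]_(l + N, N)) :
  \sum_(T : {ffun 'I_l -> 'I_d} | decr T)
     \det (row_mx (\matrix_(a, j) P a (T j)) Phi) * \det (\matrix_(i, j) B i (T j)) =
  \det (row_mx (\matrix_(a, i) \sum_t B i t * P a t) Phi).
Proof.
rewrite -(@alternating_sum d R l (fun T => \det (row_mx (\matrix_(a, j) P a (T j)) Phi)) B).
- rewrite -[RHS]det_tr [RHS]/determinant.
  under [RHS]eq_bigr => s _.
    under eq_bigr do rewrite mxE.
    rewrite big_split_ord /=.
    under eq_bigr do rewrite row_mxEl mxE.
    rewrite bigA_distr_bigA mulr_suml mulr_sumr; over.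
  rewrite [RHS]exchange_big; apply: eq_bigr => T _; rewrite -[in LHS]det_tr [in LHS]/determinant mulr_suml.
  apply: eq_bigr => s _; rewrite big_split -mulrA; congr (_ * _).
  rewrite [LHS]mulrC -mulrA; congr (_ * _); under [LHS]eq_bigr do rewrite mxE.
  rewrite big_split_ord /=; congr (_ * _); apply: eq_bigr => i _.
    by rewrite row_mxEl mxE.
  by rewrite !row_mxEr.
- move=> T s; set X := \matrix_(a, j) P a (T j).
  have -> : \matrix_(a, j) P a (ffun_perm T s j) = X *m perm_mx s^-1%g.
    by rewrite -col_permE; apply/matrixP => a c; rewrite !mxE ffunE.
  have -> : row_mx (X *m perm_mx s^-1%g) Phi = row_mx X Phi *m block_mx (perm_mx s^-1%g) 0 0 1%:M.
    by rewrite mul_row_block !mulmx0 mulmx1 addr0 add0r.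
  by rewrite det_mulmx det_ublock det1 mulr1 det_perm odd_permV mulrC.
- move=> T /injectivePn [i [j ne_ij eq_T]]; rewrite -det_tr.
  have ne : lshift N i != lshift N j by apply: contra ne_ij => /eqP /lshift_inj ->.
  by apply: (determinant_alternate ne) => c; rewrite [LHS]mxE [RHS]mxE !row_mxEl !mxE eq_T.
Qed.

End CauchyBinet.

(** * Partial fractions *)

Section Lagrange.
Variables (F : fieldType) (N : nat) (xi : 'I_N -> F).
Hypothesis xi_inj : injective xi.

Definition other_nodes (m : 'I_N) : seq F := [seq xi k | k <- enum 'I_N & k != m].

Lemma size_other_nodes m : size (other_nodes m) = N.-1.
Proof.
rewrite size_map size_filter -sum1_count big_enum_cond sum1_card.
by rewrite (eq_card (B := predC1 m)) ?cardC1 ?card_ord // => k; rewrite !inE andbT.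
Qed.

Lemma prod_other_nodes (S : comNzRingType) m (g : F -> S) :
  \prod_(k < N | k != m) g (xi k) = \prod_(c <- other_nodes m) g c.
Proof. by rewrite big_map big_filter big_enum_cond. Qed.

Definition lagrange_weight (m : 'I_N) : F := (\prod_(k < N | k != m) (xi m - xi k))^-1.

(** The difference has degree below N and vanishes at the N distinct nodes. *)
Lemma lagrange_monomial (j : nat) : (j < N)%N ->
  'X^j = \sum_m (lagrange_weight m * xi m ^+ j) *: \prod_(k < N | k != m) ('X - (xi k)%:P).
Proof.
move=> lt_jN; apply/eqP; rewrite -subr_eq0; set p := _ - _; apply/eqP.
pose rs := [seq xi k | k <- enum 'I_N].
apply: (@roots_geq_poly_eq0 _ p rs).
- apply/allP => _ /mapP[k _ ->]; rewrite /root /p hornerD hornerN horner_sum hornerXn.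
  rewrite (bigD1 k) //= hornerZ horner_prod [X in _ - (_ + X)]big1 ?addr0 => [|m ne_mk].
    have -> : \prod_(i < N | i != k) ('X - (xi i)%:P).[xi k] = (lagrange_weight k)^-1.
      by rewrite /lagrange_weight invrK; apply: eq_bigr => i _; rewrite hornerXsubC.
    rewrite mulrAC divff ?mul1r ?subrr // invr_neq0 //.
    by apply/prodf_neq0 => i ne_ik; rewrite subr_eq0; apply: contra ne_ik => /eqP/xi_inj ->.
  rewrite hornerZ horner_prod; apply/eqP; rewrite mulf_eq0; apply/orP; right.
  by apply/prodf_eq0; exists k; rewrite 1?eq_sym // hornerXsubC subrr.
- by rewrite map_inj_uniq ?enum_uniq.
- rewrite size_map size_enum_ord /p (leq_trans (size_polyD _ _)) // geq_max size_polyXn lt_jN.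
  rewrite size_polyN; apply/(leq_trans (size_sum _ _ _))/bigmax_leqP => m _.
  rewrite (leq_trans (size_scale_leq _ _)) //.
  rewrite (prod_other_nodes m (fun c => 'X - c%:P)) size_prod_XsubC size_other_nodes.
  by move: (ltn_ord m); lia.
Qed.

Section Homogenization.
Variables (S : comNzRingType) (iota : {rmorphism F -> S}) (a b : S).

(** The degree n form of p at (a, b). With a = 1 + t^2 and b = t it substitutes t + 1/t into p and
    clears denominators, so no negative power of t appears. *)
Definition homogenize (n : nat) (p : {poly F}) : S :=
  \sum_(i < n.+1) iota p`_i * (a ^+ i * b ^+ (n - i)).

Lemma homogenizeD n p q : homogenize n (p + q) = homogenize n p + homogenize n q.
Proof.
by rewrite -big_split; apply: eq_bigr => i _; rewrite coefD rmorphD mulrDl.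
Qed.

Lemma homogenizeZ n c p : homogenize n (c *: p) = iota c * homogenize n p.
Proof.
by rewrite /homogenize mulr_sumr; apply: eq_bigr => i _; rewrite coefZ rmorphM -!mulrA.
Qed.

Lemma homogenizeB n p q : homogenize n (p - q) = homogenize n p - homogenize n q.
Proof. by rewrite homogenizeD -scaleN1r homogenizeZ rmorphN1 mulN1r. Qed.

Lemma homogenizeXn n j : (j <= n)%N -> homogenize n 'X^j = a ^+ j * b ^+ (n - j).
Proof.
rewrite -ltnS => lt_jn; rewrite /homogenize (bigD1 (Ordinal lt_jn)) //= coefXn eqxx rmorph1 mul1r.
rewrite big1 ?addr0 // => i ne_ij; rewrite coefXn (_ : (i == j :> nat) = false) ?rmorph0 ?mul0r //.
by apply: contraNF ne_ij => /eqP eq_ij; apply/eqP/val_inj.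
Qed.

Lemma homogenize_XM n p : homogenize n.+1 ('X * p) = a * homogenize n p.
Proof.
rewrite /homogenize big_ord_recl coefXM rmorph0 mul0r add0r mulr_sumr.
apply: eq_bigr => i _; rewrite coefXM lift0 /= subSS exprS.
by ring.
Qed.

Lemma homogenize_widen n (p : {poly F}) : (size p <= n.+1)%N -> homogenize n.+1 p = b * homogenize n p.
Proof.
move=> le_p; rewrite /homogenize big_ord_recr nth_default // rmorph0 mul0r /= addr0 mulr_sumr.
by apply: eq_bigr => i _ /=; rewrite subSn ?exprS; [ring|move: (ltn_ord i); lia].
Qed.

Lemma homogenize_prod (r : seq F) :
  homogenize (size r) (\prod_(c <- r) ('X - c%:P)) = \prod_(c <- r) (a - iota c * b).
Proof.
elim: r => [|c r IH]; first by rewrite !big_nil -(expr0 'X) homogenizeXn // !expr0 mulr1.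
rewrite !big_cons /= mulrBl homogenizeB homogenize_XM mul_polyC homogenizeZ IH homogenize_widen.
  by rewrite IH; ring.
by rewrite size_prod_XsubC.
Qed.

Lemma homogenize_sum n I r (P : pred I) (f : I -> {poly F}) :
  homogenize n (\sum_(i <- r | P i) f i) = \sum_(i <- r | P i) homogenize n (f i).
Proof.
apply: (big_morph _ (homogenizeD n)).
by rewrite /homogenize big1 // => i _; rewrite coef0 rmorph0 mul0r.
Qed.

Lemma homogeneous_lagrange (j : nat) : (j < N)%N ->
  a ^+ j * b ^+ (N.-1 - j) =
  \sum_m iota (lagrange_weight m * xi m ^+ j) * \prod_(k < N | k != m) (a - iota (xi k) * b).
Proof.
move=> lt_jN; have le_jN : (j <= N.-1)%N by move: lt_jN; lia.
rewrite -homogenizeXn // lagrange_monomial // homogenize_sum; apply: eq_bigr => m _.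
rewrite homogenizeZ (prod_other_nodes m (fun c => 'X - c%:P)) -(size_other_nodes m).
by rewrite homogenize_prod (prod_other_nodes m (fun c => a - iota c * b)).
Qed.

End Homogenization.
End Lagrange.

Lemma iter_zS_cz (R : comNzRingType) j (f : ser R) n :
  iter j (@zS R) (cz f) n = cz ((1 + serX * serX) ^+ j * f) (n + j%:Z).
Proof.
elim: j n => [|j IH] n; first by rewrite expr0 mul1r addr0.
rewrite iterS zSE !IH exprS -mulrA mulrDl mul1r czD -mulrA !czX addrC.
by congr (cz _ _ + cz _ _); lia.
Qed.

Section PartialFractions.
Variables (F : fieldType) (N : nat) (x : 'I_N -> F).
Hypothesis x_neq0 : forall m, x m != 0.
Hypothesis x_neq1 : forall m, x m != 1.
Hypothesis x_neqV : forall m, x m - (x m)^-1 != 0.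
Let xi m := x m + (x m)^-1.
Hypothesis xi_inj : injective xi.

(** For w other than 0 and 1 this is w^-n + ... + w^n when n >= 0, and it is odd under n -> -1 -
    n. *)
Definition psi (w : F) (n : int) : F := (w ^ (n + 1) - w ^ (- n)) / (w - 1).

Lemma geo_pair_quad (w : F) : w != 0 ->
  (1 + serX * serX - serC (w + w^-1) * serX) * (geo w * geo w^-1) = 1.
Proof.
move=> w0; transitivity (((1 - serC w * serX) * geo w) * ((1 - serC w^-1 * serX) * geo w^-1)).
  have : serC w * serC w^-1 = 1 :> ser F by rewrite -rmorphM mulfV ?rmorph1.
  rewrite rmorphD /= => wV; rewrite [RHS]mulrACA; congr (_ * _).
  by ring: wV.
by rewrite !geoV mulr1.
Qed.

Lemma geo_pairE (w : F) n : w != 0 -> w - w^-1 != 0 ->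
  (geo w * geo w^-1) n = (w ^+ n.+1 - w^-1 ^+ n.+1) / (w - w^-1).
Proof.
move=> w0 wV; pose T := Ser (fun n => (w ^+ n.+1 - w^-1 ^+ n.+1) / (w - w^-1)).
rewrite -[RHS]/(T n); congr (scoef _ n).
apply: (@ser_mul_inj _ (1 + serX * serX - serC (w + w^-1) * serX)).
  by rewrite !(serD, serN, serXM0, serCM) /= mulr0 subr0 addr0.
have wwV : w * w^-1 = 1 by rewrite mulfV.
rewrite geo_pair_quad //; apply: serP => k; rewrite mulrBl mulrDl mul1r -!mulrA.
case: k => [|[|k]]; rewrite !(serD, serN, serCM, ser1, serXM, serXM0) /=.
- by rewrite !expr1 divff // mulr0 subr0 addr0.
- by rewrite addr0 mulrA -mulrBl [X in X / _](_ : _ = 0) ?mul0r // !expr1; ring: wwV.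
- rewrite mulrA -mulrDl -mulrBl [X in X / _](_ : _ = 0) ?mul0r // !exprS.
  by ring: wwV.
Qed.

(** Homogeneous Lagrange interpolation at 1 + t^2 and t, divided by \prod_k (1 + t^2 - xi_k t), the
    denominator of H. *)
Lemma partial_fractions (j : nat) : (j < N)%N ->
  serX ^+ (N.-1 - j) * ((1 + serX * serX) ^+ j * hser x) =
  \sum_m serC (lagrange_weight xi m * xi m ^+ j) * (geo (x m) * geo (x m)^-1).
Proof.
move=> lt_jN; rewrite mulrA [serX ^+ _ * _]mulrC.
rewrite (homogeneous_lagrange xi_inj serC (1 + serX * serX) serX lt_jN) mulr_suml.
apply: eq_bigr => m _; rewrite -mulrA; congr (_ * _).
rewrite /hser [X in _ * X = _](bigD1 m) //= mulrCA -big_split /= big1 ?mulr1 // => k _.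
exact: geo_pair_quad.
Qed.

Lemma odd_columnE (j L : nat) : (j < N)%N ->
  iter j (@zS F) (cz ((1 + serX) * hser x)) (L%:Z - (N.-1)%:Z) =
  \sum_m lagrange_weight xi m * xi m ^+ j * psi (x m) L.
Proof.
move=> lt_jN; rewrite iter_zS_cz.
(* The offset N - 1 and the j factors z + 1/z combine into the power t^(N-1-j) of the partial
   fraction expansion. *)
have -> : L%:Z - N.-1%:Z + j%:Z = L%:Z - (N.-1 - j)%N%:Z by move: lt_jN; lia.
rewrite -czXn.
have swap (f1 f2 f3 f4 : ser F) : f1 * (f2 * (f3 * f4)) = f3 * (f1 * (f2 * f4)) by ring.
rewrite swap (partial_fractions lt_jN) mulr_sumr /cz ser_sum; apply: eq_bigr => m _.
rewrite mulrCA serCM; congr (_ * _); rewrite mulrDl mul1r serD /psi.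
have w0 := x_neq0 m; have wV := x_neqV m; set w := x m in w0 wV *.
have wwV : w * w^-1 = 1 by rewrite mulfV.
have w1 : w - 1 != 0 by rewrite subr_eq0 x_neq1.
case: L => [|L].
  by rewrite serXM0 geo_pairE // addr0 !expr1 divff // add0r oppr0 expr1z expr0z divff.
rewrite serXM !geo_pairE // -mulrDl.
have -> : w ^ (L.+1%:Z + 1) = w ^+ L.+2.
  by rewrite (_ : L.+1%:Z + 1 = L.+2%:Z) //; lia.
have -> : w ^ (- L.+1%:Z) = w^-1 ^+ L.+1 by rewrite exprVn.
(* The numerator 1 + t produces the factor 1 + 1/w, trading the denominator w - 1/w for w - 1. *)
have eq_w : w - w^-1 = (w - 1) * (1 + w^-1) by ring: wwV.
have w1V : 1 + w^-1 != 0 by move: wV; rewrite eq_w mulf_eq0 => /norP[].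
rewrite eq_w; apply: (canLR (mulfK (mulf_neq0 w1 w1V))).
rewrite mulrA divfK // !exprS; ring: wwV.
Qed.

Lemma geo_pairZ m n : (-1 <= n)%R ->
  cz (geo (x m) * geo (x m)^-1) n = (x m ^ (n + 1) - x m ^ (- n - 1)) / (x m - (x m)^-1).
Proof.
have w0 := x_neq0 m; have wV := x_neqV m; set w := x m in w0 wV *.
case: n => [n|[|n]] // _; last first.
  (* At n = -1 both sides vanish; this extra value extends the closed form of H down to degree
     -N. *)
  by rewrite cz_neg // (_ : Negz 0 + 1 = 0) // (_ : - Negz 0 - 1 = 0) // subrr mul0r.
rewrite /cz geo_pairE // (_ : n%:Z + 1 = n.+1%:Z); last by lia.
by rewrite (_ : - n%:Z - 1 = - n.+1%:Z) ?exprVn //; lia.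
Qed.

(* Below degree -N the complete symmetric function vanishes, and the reflection
   n -> -n - 2N changes the sign of the right-hand side. *)
Lemma hser_reflect (n : int) : (0 < N)%N ->
  cz (hser x) n - cz (hser x) (- n - (2 * N)%N%:Z) =
  \sum_m lagrange_weight xi m *
     ((x m ^ (n + N%:Z) - x m ^ (- n - N%:Z)) / (x m - (x m)^-1)).
Proof.
move=> N0; have pos k : (- N%:Z <= k)%R -> cz (hser x) k =
    \sum_m lagrange_weight xi m *
      ((x m ^ (k + N%:Z) - x m ^ (- k - N%:Z)) / (x m - (x m)^-1)).
  move=> le_k; have := partial_fractions N0; rewrite subn0 expr0 mul1r => pf.
  rewrite (_ : k = k + N.-1%:Z - N.-1%:Z); last by lia.
  rewrite -czXn pf.
  have -> : cz (\sum_m serC (lagrange_weight xi m * xi m ^+ 0) *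
       (geo (x m) * geo (x m)^-1)) (k + N.-1%:Z) =
      \sum_m lagrange_weight xi m * cz (geo (x m) * geo (x m)^-1) (k + N.-1%:Z).
    case: (k + N.-1%:Z) => i; rewrite /cz ?ser_sum; last by rewrite big1 // => m _; rewrite mulr0.
    by apply: eq_bigr => m _; rewrite serCM expr0 mulr1.
  apply: eq_bigr => m _; rewrite geo_pairZ; last by lia.
  by congr (_ * ((_ ^ _ - _ ^ _) / _)); lia.
case: (Num.Theory.lerP (- N%:Z) n) => [le_n|lt_n].
  rewrite (pos n le_n); case: (eqVneq n (- N%:Z)) => [->|ne_n].
    rewrite (_ : - - N%:Z - (2 * N)%N%:Z = - N%:Z); last by lia.
    by rewrite cz_neg ?subr0 //; lia.
  by rewrite [cz _ (- n - _)]cz_neg ?subr0 //; lia.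
rewrite [cz _ n]cz_neg ?sub0r; last by lia.
rewrite pos -?sumrN; last by lia.
apply: eq_bigr => m _; rewrite -mulrN -mulNr opprB; congr (_ * ((_ ^ _ - _ ^ _) / _)); lia.
Qed.

End PartialFractions.

(** * The determinant identity *)

Section Windows.
Variable S : comNzRingType.

(* The odd extension of a sequence around -1/2. *)
Definition odd_ext (a : int -> S) (k : int) : S :=
  match k with Posz L => a L | Negz L => - a L end.

Lemma zsum_halves D (G : int -> S) :
    (forall L : nat, (D <= L)%N -> G L = 0) -> (forall L, (D <= L)%N -> G (Negz L) = 0) ->
  zsum G = \sum_(L < D) (G L + G (Negz L)).
Proof.
move=> Gp Gn; rewrite /zsum (@fsum_seq _ _ (map Posz (iota 0 D) ++ map Negz (iota 0 D))).
- by rewrite big_cat !big_map /= !sum_iota big_split.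
- rewrite cat_uniq !map_inj_uniq ?iota_uniq ?andbT /=; try by move=> ? ? [].
  by apply/hasPn => _ /mapP[i _ ->]; apply/mapP => -[].
- move=> [L|L]; rewrite mem_cat negb_or => /andP[].
    by rewrite mem_map ?mem_iota => [le_DL _|? ? []//]; apply: Gp; lia.
  by move=> _; rewrite mem_map ?mem_iota => [le_DL|? ? []//]; apply: Gn; lia.
Qed.

Variables (f : int -> S) (d : nat).
Hypotheses (f_even : forall n, f (- n) = f n) (f_far : forall n : int, (d <= `|n|)%N -> f n = 0).

Definition fold_coef (u v : nat) : S := f (u%:Z - v%:Z) - f (u%:Z + v%:Z + 1).

Lemma zbounded_mulf (g : int -> S) : zbounded (fun r => f r * g r).
Proof. by exists d => r lt_r; rewrite f_far ?mul0r // ltnW. Qed.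

(** The term f(u + L + 1) is the contribution of the reflected point -1 - L. The bound on D keeps
    the support of f around u, reflected part included, inside the window. *)
Lemma sum_fold_coef D (u : nat) (a : int -> S) : (u + d <= D)%N ->
  \sum_(L < D) fold_coef u L * a L = zsum (fun r => f r * odd_ext a (u%:Z + r)).
Proof.
move=> le_D; rewrite -[RHS](zsum_shift (- u%:Z)) (@zsum_halves D).
- apply: eq_bigr => L _; rewrite /fold_coef mulrBl.
  rewrite (_ : u%:Z + (L%:Z - u%:Z) = L%:Z); last by lia.
  rewrite (_ : u%:Z + (Negz L - u%:Z) = Negz L); last by lia.
  rewrite /odd_ext mulrN -[f (L%:Z - _)]f_even -[f (Negz L - _)]f_even.
  by congr (f _ * _ - f _ * _); lia.
- by move=> L le_DL; rewrite f_far ?mul0r //; lia.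
- by move=> L le_DL; rewrite f_far ?mul0r //; lia.
Qed.

Lemma zsum_even (g : int -> S) : zsum (fun r => f r * g (- r)) = zsum (fun r => f r * g r).
Proof.
rewrite -(zsum_sub 0 (fun r => f r * g r)); apply: eq_zsum => r.
by rewrite sub0r f_even.
Qed.

End Windows.

(** * Commutation of the folded convolution with the columns of H *)

Section CoreIdentity.
Variables (F : fieldType) (l N : nat) (x : 'I_N -> F).
Hypothesis N_gt0 : (0 < N)%N.
Hypothesis x_neq0 : forall m, x m != 0.
Hypothesis x_neq1 : forall m, x m != 1.
Hypothesis x_neqV : forall m, x m - (x m)^-1 != 0.
Let xi m := x m + (x m)^-1.
Hypothesis xi_inj : injective xi.
Variables (S : comNzRingType) (iota : {rmorphism F -> S}) (f : int -> S) (d : nat).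
Hypotheses (f_even : forall n, f (- n) = f n) (f_far : forall n : int, (d <= `|n|)%N -> f n = 0).

Local Notation h := (cz (hser x)).
Local Notation A := (lagrange_weight xi).

Definition odd_column (j : nat) (n : int) : F :=
  iter j (@zS F) (cz ((1 + serX) * hser x)) (n - (N.-1)%:Z).

Definition gen_val (w : F) : S := zsum (fun r => f r * iota (w ^ r)).

(** [psi] is its own odd extension, and it combines w^(u+r) with w^-(u+r), on which the even f has
    the same eigenvalue. *)
Lemma psi_eigen D (u : nat) m : (u + d <= D)%N ->
  \sum_(L < D) fold_coef f u L * iota (psi (x m) L) = gen_val (x m) * iota (psi (x m) u).
Proof.
move=> le_D; rewrite (sum_fold_coef f_even f_far (fun k => iota (psi (x m) k)) le_D).
have w0 := x_neq0 m; set w := x m in w0 *.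
have ext k : odd_ext (fun k => iota (psi w k)) k = iota (psi w k).
  case: k => // L; rewrite /odd_ext -rmorphN; congr (iota _).
  rewrite /psi -mulNr opprB; congr ((w ^ _ - w ^ _) / _); lia.
have term r : f r * odd_ext (fun k => iota (psi w k)) (u%:Z + r) =
    iota (w ^ (u%:Z + 1) / (w - 1)) * (f r * iota (w ^ r)) +
    iota (- w ^ (- u%:Z) / (w - 1)) * (f r * iota (w ^ (- r))).
  rewrite ext mulrCA [iota (- _ / _) * _]mulrCA -mulrDr -!rmorphM -rmorphD.
  congr (_ * iota _); rewrite /psi.
  have -> : w ^ (u%:Z + r + 1) = w ^ (u%:Z + 1) * w ^ r by rewrite -expfzDr //; congr (_ ^ _); lia.
  have -> : w ^ (- (u%:Z + r)) = w ^ (- u%:Z) * w ^ (- r) by rewrite -expfzDr //; congr (_ ^ _); lia.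
  by ring.
rewrite (eq_zsum term) zsumD; first last.
- by have [D1 h1] := zbounded_mulf f_far (fun r => iota (w ^ (- r))); exists D1 => i /h1 ->; rewrite mulr0.
- by have [D1 h1] := zbounded_mulf f_far (fun r => iota (w ^ r)); exists D1 => i /h1 ->; rewrite mulr0.
rewrite -!mulr_zsumr; try exact: (zbounded_mulf f_far).
rewrite (zsum_even f_even (fun r => iota (w ^ r))) -/(gen_val w) -mulrDl mulrC -rmorphD.
by congr (_ * iota _); rewrite /psi mulNr -mulrBl.
Qed.

(** The coefficient of psi_m in the defect of commutation at offset r. It is zero unless M - r < 0,
    where the odd extension reflects; the formula is that of [hser_reflect_pair] with k = r - M. *)
Definition correction_coef (M : nat) (m : 'I_N) (r : int) : F :=
  if M%:Z < r then
    A m * ((x m ^ (r - M%:Z - 1) + x m ^ (M%:Z - r)) * (x m - 1) / (x m - (x m)^-1))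
  else 0.

(** Expanding (w^(k-1) + w^-k)(w^(u+1) - w^-u) gives the four powers on the left, so two reflections
    of H assemble into a multiple of psi(u). *)
Lemma hser_reflect_pair (u k : int) :
  \sum_m A m * ((x m ^ (u + k) - x m ^ (- u - k)) / (x m - (x m)^-1)) +
  \sum_m A m * ((x m ^ (u + 1 - k) - x m ^ (k - u - 1)) / (x m - (x m)^-1)) =
  \sum_m A m * ((x m ^ (k - 1) + x m ^ (- k)) * (x m - 1) / (x m - (x m)^-1)) * psi (x m) u.
Proof.
rewrite -big_split; apply: eq_bigr => m _ /=.
have w0 := x_neq0 m; have w1 : x m - 1 != 0 by rewrite subr_eq0.
set w := x m in w0 w1 *; have wwV : w * w^-1 = 1 by rewrite mulfV.
have cancel (a b c p D : F) : p != 0 -> a * (b * p / D) * (c / p) = a * (b * c / D).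
  by move=> p0; rewrite -[RHS]mulr1 -(divff p0); ring.
rewrite /psi cancel // -mulrDr -mulrDl; congr (_ * (_ / _)).
rewrite !expfzDr // !expr1z exprN1.
by ring: wwV.
Qed.

(** Moving u by r or M by -r gives the same index of H. The odd extensions disagree only where one
    of the two points becomes negative; the discrepancy is a combination of the psi_m plus an odd
    function of r, which the even f annihilates. *)
Lemma fold_commute D (u M : nat) : (u + d <= D)%N -> (M + d <= D)%N ->
  \sum_(L < D) fold_coef f u L * iota (h (L%:Z - N%:Z - M%:Z)) =
  \sum_(p < D) fold_coef f M p * iota (h (u%:Z - N%:Z - p%:Z)) +
  \sum_m zsum (fun r => f r * iota (correction_coef M m r)) * iota (psi (x m) u).
Proof.
move=> le_uD le_MD.
rewrite (sum_fold_coef f_even f_far (fun k => iota (h (k - N%:Z - M%:Z))) le_uD).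
rewrite (sum_fold_coef f_even f_far (fun k => iota (h (u%:Z - N%:Z - k))) le_MD).
rewrite -(zsum_even f_even (fun r => odd_ext _ (M%:Z + r))).
pose p r := \sum_m correction_coef M m r * psi (x m) u.
(* Two reflections produce two extra values of H. One has the negative index -u - N - (r - M) and
   vanishes; [q] is the other. *)
pose q r : F := if M%:Z < r then h (- u%:Z - N%:Z - 1 + r - M%:Z) else 0.
have key r : odd_ext (fun k => iota (h (k - N%:Z - M%:Z))) (u%:Z + r) =
    odd_ext (fun k => iota (h (u%:Z - N%:Z - k))) (M%:Z - r) + (iota (p r) + (iota (q r) - iota (q (- r)))).
  have oddE (a : int -> F) k : odd_ext (fun k => iota (a k)) k =
      iota (if 0 <= k then a k else - a (- k - 1)).
    case: k => L //=; rewrite rmorphN; congr (- iota (a _)); lia.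
  rewrite !oddE -!(rmorphB, rmorphD); congr (iota _).
  (* For r > M the point M - r is reflected; for r <= M only u + r can be. *)
  case: (Num.Theory.ltrP M%:Z r) => [lt_Mr|le_rM].
    rewrite ifT; last by lia.
    rewrite ifF; last by apply/negbTE; lia.
    have -> : q (- r) = 0 by rewrite /q ifF //; apply/negbTE; lia.
    rewrite /q lt_Mr subr0.
    have -> : p r = (h (u%:Z - N%:Z + (r - M%:Z)) - h (- u%:Z - N%:Z - (r - M%:Z))) +
                    (h (u%:Z - N%:Z + 1 - (r - M%:Z)) - h (- u%:Z - N%:Z - 1 + (r - M%:Z))).
      rewrite /p /correction_coef lt_Mr.
      have := hser_reflect x_neq0 x_neqV xi_inj (u%:Z - N%:Z + (r - M%:Z)) N_gt0.
      rewrite (_ : - (u%:Z - N%:Z + (r - M%:Z)) - (2 * N)%N%:Z = - u%:Z - N%:Z - (r - M%:Z)); last by lia.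
      move=> ->.
      have := hser_reflect x_neq0 x_neqV xi_inj (u%:Z - N%:Z + 1 - (r - M%:Z)) N_gt0.
      rewrite (_ : - (u%:Z - N%:Z + 1 - (r - M%:Z)) - (2 * N)%N%:Z = - u%:Z - N%:Z - 1 + (r - M%:Z)); last by lia.
      move=> ->.
      have pair := hser_reflect_pair u%:Z (r - M%:Z).
      rewrite -[RHS]/(_ + _); etransitivity; [etransitivity; [|exact: esym pair]|].
        by apply: eq_bigr => m _; rewrite opprB.
      by congr (_ + _); apply: eq_bigr => m _; congr (_ * ((_ ^ _ - _ ^ _) / _)); lia.
    rewrite [h (- u%:Z - N%:Z - (r - M%:Z))]cz_neg; last by lia.
    rewrite (_ : u%:Z + r - N%:Z - M%:Z = u%:Z - N%:Z + (r - M%:Z)); last by lia.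
    rewrite (_ : u%:Z - N%:Z - (- (M%:Z - r) - 1) = u%:Z - N%:Z + 1 - (r - M%:Z)); last by lia.
    rewrite (_ : - u%:Z - N%:Z - 1 + r - M%:Z = - u%:Z - N%:Z - 1 + (r - M%:Z)); last by lia.
    by ring.
  have -> : p r = 0.
    by rewrite /p big1 // => m _; rewrite /correction_coef ifF ?mul0r //; apply/negbTE; lia.
  have -> : q r = 0 by rewrite /q ifF //; apply/negbTE; lia.
  rewrite [X in _ = X + _]ifT; last by lia.
  rewrite add0r sub0r.
  rewrite (_ : u%:Z + r - N%:Z - M%:Z = u%:Z - N%:Z - (M%:Z - r)); last by lia.
  case: ifP => [ge0|lt0].
    rewrite (_ : q (- r) = 0) ?oppr0 ?addr0 // /q; case: ifP => // _; rewrite cz_neg //; lia.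
  rewrite [h (u%:Z - _ - (M%:Z - r))]cz_neg; last by lia.
  rewrite add0r /q; congr (- _); case: ifP => [_|le]; first by congr (cz _ _); lia.
  by rewrite cz_neg //; lia.
have bd := zbounded_mulf f_far.
have split r : f r * odd_ext (fun k => iota (h (k - N%:Z - M%:Z))) (u%:Z + r) =
    f r * odd_ext (fun k => iota (h (u%:Z - N%:Z - k))) (M%:Z - r) +
    (f r * iota (p r) + (f r * iota (q r) - f r * iota (q (- r)))).
  by rewrite key !mulrDr mulrN.
rewrite (eq_zsum split) zsumD; [|exact: bd|]; last first.
  do !apply: zbounded_add; try exact: bd.
  by have [D1 h1] := bd (fun r => iota (q (- r))); exists D1 => i /h1 ->; rewrite oppr0.
congr (_ + _).
rewrite zsumD; [|exact: bd|]; last first.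
  apply: zbounded_add; first exact: bd.
  by have [D1 h1] := bd (fun r => iota (q (- r))); exists D1 => i /h1 ->; rewrite oppr0.
have -> : zsum (fun r => f r * iota (q r) - f r * iota (q (- r))) = 0.
  have -> : (fun r => f r * iota (q r) - f r * iota (q (- r))) =
      fun r => f r * iota (q r) + f r * iota (- q (- r)).
    by apply/funext => r; rewrite rmorphN mulrN.
  rewrite zsumD; [|exact: bd|exact: bd].
  rewrite (zsum_even f_even (fun r => iota (- q r))) -zsumD; [|exact: bd|exact: bd].
  by rewrite -[RHS]zsum0; apply: eq_zsum => r; rewrite rmorphN mulrN subrr.
rewrite addr0 /p.
have -> : (fun r => f r * iota (\sum_m correction_coef M m r * psi (x m) u)) =
    fun r => \sum_m f r * iota (correction_coef M m r * psi (x m) u).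
  by apply/funext => r; rewrite rmorph_sum mulr_sumr.
have [_ ->] := zsum_bigsum (index_enum 'I_N)
  (fun m => bd (fun r => iota (correction_coef M m r * psi (x m) u))).
apply: eq_bigr => m _; rewrite mulrC mulr_zsumr; last exact: bd.
by apply: eq_zsum => r; rewrite rmorphM mulrA mulrC.
Qed.

(** Both matrices are (W | Psi) times a block lower triangular matrix: the defect of commutation
    lies in the span of Psi, and the odd columns are Psi E C on the left and Psi C on the right. The
    determinants differ by det E, the product of the eigenvalues. *)
Lemma core_identity D (M : 'I_l -> nat) (La : 'I_(l + N) -> nat) :
    (forall a, (La a + d <= D)%N) -> (forall i, (M i + d <= D)%N) ->
  \det (row_mx
    (\matrix_(a, i) \sum_(L < D) fold_coef f (La a) L * iota (h (L%:Z - N%:Z - (M i)%:Z)))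
    (\matrix_(a, j) \sum_(L < D) fold_coef f (La a) L * iota (odd_column (j : 'I_N) L%:Z))) =
  (\prod_m gen_val (x m)) *
  \det (row_mx
    (\matrix_(a, i) \sum_(p < D) fold_coef f (M i) p * iota (h ((La a)%:Z - N%:Z - p%:Z)))
    (\matrix_(a, j) iota (odd_column (j : 'I_N) (La a)%:Z))).
Proof.
move=> leLa leM; pose Psi : 'M[S]_(l + N, N) := \matrix_(a, m) iota (psi (x m) (La a)).
pose C : 'M[S]_N := \matrix_(m, j) iota (A m * xi m ^+ j).
pose E : 'M[S]_N := diag_mx (\row_m gen_val (x m)).
pose K : 'M[S]_(N, l) := \matrix_(m, i) zsum (fun r => f r * iota (correction_coef (M i) m r)).
set V := \matrix_(a, i) _; set VPhi := \matrix_(a, j) _.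
set W := \matrix_(a, i) _; set Phi := \matrix_(a, j) _.
have odd_colE j (L : nat) : (j < N)%N ->
    odd_column j L = \sum_m A m * xi m ^+ j * psi (x m) L.
  by move=> lt_j; rewrite /odd_column (odd_columnE x_neq0 x_neq1 x_neqV xi_inj).
have eqPhi : Phi = Psi *m C.
  apply/matrixP => a j; rewrite !mxE odd_colE // rmorph_sum; apply: eq_bigr => m _.
  by rewrite !mxE -rmorphM mulrC.
have eqV : V = W + Psi *m K.
  apply/matrixP => a i; rewrite !mxE (fold_commute (leLa a) (leM i)); congr (_ + _).
  by apply: eq_bigr => m _; rewrite !mxE mulrC.
have eqVPhi : VPhi = Psi *m (E *m C).
  apply/matrixP => a j; rewrite !mxE.
  transitivity (\sum_(L < D) \sum_m iota (A m * xi m ^+ j) *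
      (fold_coef f (La a) L * iota (psi (x m) L))).
    apply: eq_bigr => L _; rewrite odd_colE // rmorph_sum mulr_sumr; apply: eq_bigr => m _.
    by rewrite rmorphM mulrCA.
  rewrite exchange_big; apply: eq_bigr => m _; rewrite -mulr_sumr psi_eigen //.
  by rewrite mul_diag_mx !mxE; ring.
have detV : row_mx V VPhi = row_mx W Psi *m block_mx 1%:M 0 K (E *m C).
  by rewrite mul_row_block mulmx1 mulmx0 add0r eqV eqVPhi.
have detW : row_mx W Phi = row_mx W Psi *m block_mx 1%:M 0 0 C.
  by rewrite mul_row_block mulmx1 !mulmx0 add0r addr0 eqPhi.
rewrite detV detW !det_mulmx !det_lblock det1 !mul1r det_mulmx det_diag.
rewrite mulrCA; congr (_ * (_ * _)); apply: eq_bigr => m _; by rewrite mxE.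
Qed.

End CoreIdentity.

(** * The series f_n(y) *)

Section FpsFiltration.
Variables (K : nat) (F : comNzRingType).
Local Notation S := (fps K F).
Implicit Types (u v : S) (m : 'X_{1..K}) (d : nat).

Definition fcoef m u : F := fps_coef u m.

Fact fcoef_zmod m : zmod_morphism (fcoef m).
Proof. by []. Qed.
HB.instance Definition _ m := GRing.isZmodMorphism.Build S F (fcoef m) (fcoef_zmod m).

Lemma fcoefB m u v : fcoef m (u - v) = fcoef m u - fcoef m v. Proof. by []. Qed.
Lemma fcoefD m u v : fcoef m (u + v) = fcoef m u + fcoef m v. Proof. by []. Qed.

Lemma fcoefM d u v m : (mdeg m < d)%N -> fcoef m (u * v) = (fps_trunc d u * fps_trunc d v)@_m.
Proof. exact: fps_mulE. Qed.

Lemma fps_truncC d (c : F) : (0 < d)%N -> fps_trunc d (fpsC c : S) = c%:MP.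
Proof.
move=> d0; apply/mpolyP => m; rewrite mcoeffC; case: (ltnP (mdeg m) d) => [lt_m|le_m].
  by rewrite fps_truncE //=; case: eqP; rewrite ?mulr1 ?mulr0.
rewrite (_ : (m == 0%MM) = false) ?mulr0; last first.
  by apply/negbTE/eqP => m0; move: le_m; rewrite m0 mdeg0 leqNgt d0.
rewrite /fps_trunc raddf_sum big1 // => k _; rewrite /= mcoeffZ mcoeffX.
case: (bmnm k =P m) => [eq_k|_]; rewrite ?mulr0 //.
by move: le_m; rewrite -eq_k leqNgt bmdeg.
Qed.

Lemma fcoefMC u (c : F) m : fcoef m (u * fpsC c) = fcoef m u * c.
Proof.
rewrite (fcoefM _ _ (ltnSn _)) fps_truncC // mulrC mul_mpolyC mcoeffZ mulrC.
by rewrite fps_truncE.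
Qed.

Fact fpsC_zmod : zmod_morphism (@fpsC K F).
Proof. by move=> a b; apply: fpsP => m /=; rewrite mulrnBl. Qed.
HB.instance Definition _ := GRing.isZmodMorphism.Build F S (@fpsC K F) fpsC_zmod.
Fact fpsC_monoid : monoid_morphism (@fpsC K F).
Proof.
split=> // a b; apply: fpsP => m; rewrite -[RHS]/(fcoef m _) fcoefMC /fcoef /=.
by case: eqP => _; rewrite ?mulr1n // !mulr0n mul0r.
Qed.
HB.instance Definition _ := GRing.isMonoidMorphism.Build F S (@fpsC K F) fpsC_monoid.

Lemma fcoefXM (j : 'I_K) u m :
  fcoef m (fpsX j * u) = if (0 < m j)%N then fcoef (m - U_(j))%MM u else 0.
Proof.
have truncX : fps_trunc (mdeg m).+2 (fpsX j : S) = 'X_j.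
  apply/mpolyP => k; rewrite mcoeffX; case: (ltnP (mdeg k) (mdeg m).+2) => [lt_k|le_k].
    by rewrite fps_truncE //= eq_sym.
  rewrite (_ : (U_(j)%MM == k) = false); last first.
    by apply/eqP => eq_k; move: le_k; rewrite -eq_k mdeg1.
  rewrite /fps_trunc raddf_sum big1 // => i _; rewrite /= mcoeffZ mcoeffX.
  case: (bmnm i =P k) => [eq_i|_]; rewrite ?mulr0 //.
  by move: le_k; rewrite -eq_i leqNgt bmdeg.
rewrite (@fcoefM (mdeg m).+2) // truncX mulrC.
case: ifP => [mj|mj].
  have def_m : m = (U_(j) + (m - U_(j)))%MM by rewrite addmC submK // lep1mP -lt0n.
  set t := fps_trunc _ u; rewrite [X in _@_X]def_m mcoeffMX /t fps_truncE //.
  have := congr1 (@mdeg K) def_m; rewrite mdegD => ->; lia.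
rewrite mcoeffM big1 // => k /eqP def_m; rewrite mcoeffX.
case: eqP => [eq_j|]; rewrite ?mulr0 //.
by have := congr1 (fun w : 'X_{1..K} => w j) def_m; rewrite /= mnmDE -eq_j mnm1E eqxx; lia.
Qed.

Definition eqm d u v := forall m, (mdeg m < d)%N -> fcoef m u = fcoef m v.

Lemma eqm_refl d u : eqm d u u. Proof. by []. Qed.

Lemma eqm_trunc d u v : eqm d u v -> fps_trunc d u = fps_trunc d v.
Proof.
move=> eq_uv; rewrite /fps_trunc; apply: eq_bigr => m _.
by rewrite -[fps_coef u _]/(fcoef _ u) eq_uv ?bmdeg.
Qed.

Lemma eqmD d u u' v v' : eqm d u u' -> eqm d v v' -> eqm d (u + v) (u' + v').
Proof. by move=> eu ev m lt_m; rewrite !raddfD /= eu // ev. Qed.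

Lemma eqmN d u u' : eqm d u u' -> eqm d (- u) (- u').
Proof. by move=> eu m lt_m; rewrite !raddfN /= eu. Qed.

Lemma eqmM d u u' v v' : eqm d u u' -> eqm d v v' -> eqm d (u * v) (u' * v').
Proof. by move=> eu ev m lt_m; rewrite !(fcoefM _ _ lt_m) (eqm_trunc eu) (eqm_trunc ev). Qed.

Lemma eqm_sum d I r (P : pred I) (f g : I -> S) : (forall i, P i -> eqm d (f i) (g i)) ->
  eqm d (\sum_(i <- r | P i) f i) (\sum_(i <- r | P i) g i).
Proof. by move=> fg; elim/big_rec2: _ => // i u v Pi; apply: eqmD; apply: fg. Qed.

Lemma eqm_prod d I r (P : pred I) (f g : I -> S) : (forall i, P i -> eqm d (f i) (g i)) ->
  eqm d (\prod_(i <- r | P i) f i) (\prod_(i <- r | P i) g i).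
Proof. by move=> fg; elim/big_rec2: _ => // i u v Pi; apply: eqmM; apply: fg. Qed.

Lemma eqm_det d n (M M' : 'M[S]_n) : (forall i j, eqm d (M i j) (M' i j)) ->
  eqm d (\det M) (\det M').
Proof.
move=> eM; apply: eqm_sum => s _; apply: eqmM => //.
by apply: eqm_prod => i _.
Qed.

(** Order at least |n| in y makes each coefficient of a product of two-sided series a finite sum. *)
Definition tame (a : int -> S) := forall (n : int) m, (mdeg m < `|n|)%N -> fcoef m (a n) = 0.

Lemma fcoefM_low (a b : int -> S) (i j : int) m : tame a -> tame b ->
  (mdeg m < `|i| + `|j|)%N -> fcoef m (a i * b j) = 0.
Proof.
move=> ta tb lt_m; rewrite (fcoefM _ _ (ltnSn _)) mcoeffM big1 // => k /eqP def_m.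
have := congr1 (@mdeg K) def_m; rewrite mdegD => def_dm.
rewrite !fps_truncE; [|lia|lia].
case: (ltnP (mdeg k.1) `|i|) => [/ta lt_k|le_k]; first by rewrite [fps_coef (a i) _]lt_k mul0r.
rewrite [fps_coef (b j) _]tb ?mulr0 //; apply: contraTT lt_m.
by rewrite -!leqNgt => le_k2; apply: leq_trans (leq_add le_k le_k2) (eq_leq (esym def_dm)).
Qed.

Lemma fcoef_zser_mul (a b : int -> S) n m :
  fcoef m (zser_mul a b n) = zsum (fun i => fcoef m (a i * b (n - i))).
Proof. by []. Qed.

Lemma zser_mul_bounded (a b : int -> S) n m : tame a -> tame b ->
  zbounded (fun i => fcoef m (a i * b (n - i))).
Proof.
move=> ta tb; exists (mdeg m) => i lt_i; apply: fcoefM_low => //; lia.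
Qed.

Lemma tame_zser_mul (a b : int -> S) : tame a -> tame b -> tame (zser_mul a b).
Proof.
move=> ta tb n m lt_m; rewrite fcoef_zser_mul -[RHS]zsum0; apply: eq_zsum => i.
by apply: fcoefM_low => //; lia.
Qed.

Lemma tame_one : tame (@zser_one K F).
Proof. by move=> n m; rewrite /zser_one; case: eqP => [-> //|_ _]; rewrite raddf0. Qed.

Lemma tame_zgeom j : tame (@zgeom K F j).
Proof.
move=> [n|n] m; last by move=> _; exact: raddf0.
rewrite /zgeom; elim: n m => // n IH m lt_m; rewrite exprS fcoefXM.
case: ifP => // mj; apply: IH.
have : m = (U_(j) + (m - U_(j)))%MM by rewrite addmC submK // lep1mP -lt0n.
by move/(congr1 (@mdeg K)); rewrite mdegD mdeg1; lia.
Qed.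

Lemma tame_rev (a : int -> S) : tame a -> tame (fun n => a (- n)).
Proof. by move=> ta n m lt_m; apply: ta; lia. Qed.

Lemma zser_mul1 (b : int -> S) : zser_mul (@zser_one K F) b = b.
Proof.
apply/funext => n; apply: fpsP => m; rewrite -[LHS]/(fcoef m _) fcoef_zser_mul.
rewrite -[in RHS](subr0 n) -(zsum_delta 0 (fun i => fps_coef (b (n - i)) m)).
apply: eq_zsum => i; rewrite /zser_one; case: eqP => _; first by rewrite mul1r.
by rewrite mul0r raddf0.
Qed.

Lemma zser_mulC (a b : int -> S) : zser_mul a b = zser_mul b a.
Proof.
apply/funext => n; apply: fpsP => m; rewrite -[LHS]/(fcoef m _) -[RHS]/(fcoef m _).
rewrite !fcoef_zser_mul -(zsum_sub n); apply: eq_zsum => i.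
by rewrite subKr mulrC.
Qed.

Lemma zser_mul_rev (a b : int -> S) :
  zser_mul (fun n => a (- n)) (fun n => b (- n)) = fun n => zser_mul a b (- n).
Proof.
apply/funext => n; apply: fpsP => m; rewrite -[LHS]/(fcoef m _) -[RHS]/(fcoef m _).
rewrite !fcoef_zser_mul -(zsum_sub 0 (fun i => fcoef m (a i * b (- n - i)))).
by apply: eq_zsum => i; rewrite sub0r opprB opprK addrC.
Qed.

(* b = a / (1 - y_j z^e), for e = 1 or -1. *)
Definition geom_step (j : 'I_K) (e : int) (b a : int -> S) :=
  forall n, b n - fpsX j * b (n - e) = a n.

(** This stands in for associativity of two-sided products: geometric factors are removed one at a
    time. *)
Lemma geom_step_mul j e (a a' b : int -> S) : tame a -> tame b ->
  geom_step j e a a' -> geom_step j e (zser_mul a b) (zser_mul a' b).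
Proof.
move=> ta tb step n; apply: fpsP => m; rewrite -[LHS]/(fcoef m _) -[RHS]/(fcoef m _).
rewrite fcoefB fcoefXM !fcoef_zser_mul.
have eqX : (if (0 < m j)%N then zsum (fun i => fcoef (m - U_(j))%MM (a i * b (n - e - i))) else 0) =
    zsum (fun i => fcoef m ((fpsX j * a (i - e)) * b (n - i))).
  rewrite -[RHS](zsum_shift e); case: ifP => mj; last first.
    by rewrite -[LHS]zsum0; apply: eq_zsum => i; rewrite -mulrA fcoefXM mj.
  apply: eq_zsum => i; rewrite -mulrA fcoefXM mj addrK; congr (fcoef _ (_ * b _)); lia.
rewrite eqX; apply/eqP; rewrite subr_eq -zsumD.
- apply/eqP/eq_zsum => i; rewrite -fcoefD -mulrDl -step subrK //.
- have [D1 h1] := zser_mul_bounded n m ta tb.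
  exists (mdeg m + `|e| + D1)%N => i lt_i; rewrite -step mulrBl fcoefB h1 ?sub0r; last by lia.
  rewrite -mulrA fcoefXM; case: ifP => _; rewrite ?oppr0 // fcoefM_low ?oppr0 //.
  have : (mdeg (m - U_(j))%MM <= mdeg m)%N.
    by rewrite !mdegE; apply: leq_sum => k _; rewrite mnmBE leq_subr.
  lia.
- exists (mdeg m + `|e|)%N => i lt_i; rewrite -mulrA fcoefXM; case: ifP => // _.
  rewrite fcoefM_low //.
  have : (mdeg (m - U_(j))%MM <= mdeg m)%N.
    by rewrite !mdegE; apply: leq_sum => k _; rewrite mnmBE leq_subr.
  lia.
Qed.

Lemma geom_step_zgeom j : geom_step j 1 (@zgeom K F j) (@zser_one K F).
Proof. by move=> n; rewrite zgeom_inverse. Qed.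

Lemma geom_step_zgeomV j : geom_step j (-1) (@zgeomV K F j) (@zser_one K F).
Proof.
move=> n; rewrite /zgeomV opprB addrC -[_ - n]/(-1 - n) [-1 - n]addrC addrC zgeom_inverse.
by rewrite /zser_one oppr_eq0.
Qed.

Lemma tame_f_ser : tame (@f_ser K F).
Proof.
rewrite /f_ser; elim/big_rec: _ => [|j a _ ta]; first exact: tame_one.
apply: tame_zser_mul ta; apply: tame_zser_mul; first exact: tame_zgeom.
exact: tame_rev (tame_zgeom j).
Qed.

(** The exchange z -> 1/z swaps the two geometric factors of each y_j. *)
Lemma f_ser_even n : @f_ser K F (- n) = @f_ser K F n.
Proof.
have : (fun n => @f_ser K F (- n)) = @f_ser K F; last by move/(congr1 (fun a => a n)).
rewrite /f_ser; elim/big_rec: _ => [|j a _ eva].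
  by apply/funext => k; rewrite /zser_one oppr_eq0.
have gg : (fun n => zser_mul (@zgeom K F j) (@zgeomV K F j) (- n)) =
    zser_mul (@zgeom K F j) (@zgeomV K F j).
  rewrite -zser_mul_rev zser_mulC; congr (zser_mul _ _).
  by apply/funext => k; rewrite /zgeomV opprK.
by rewrite -zser_mul_rev gg eva.
Qed.

End FpsFiltration.

(** * Evaluation at z = w, and truncation of f_n *)

Section Evaluation.
Variables (K : nat) (F : fieldType).
Local Notation S := (fps K F).
Implicit Types (a b : int -> S) (w : F).

Definition zeval w a : S := Fps (fun m => zsum (fun n => fcoef m (a n) * w ^ n)).

Lemma fcoef_zeval w a m : fcoef m (zeval w a) = zsum (fun n => fcoef m (a n) * w ^ n).
Proof. by []. Qed.

Lemma tame_bounded w a m : tame a -> zbounded (fun n => fcoef m (a n) * w ^ n).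
Proof. by move=> ta; exists (mdeg m) => n lt_n; rewrite ta ?mul0r. Qed.

Lemma zeval_step w j e a b : w != 0 -> tame b -> geom_step j e b a ->
  (1 - fpsC (w ^ e) * fpsX j) * zeval w b = zeval w a.
Proof.
move=> w0 tb step; apply: fpsP => m; rewrite -[LHS]/(fcoef m _) -[RHS]/(fcoef m _).
rewrite mulrBl mul1r -mulrA [fpsC _ * _]mulrC fcoefB fcoefMC fcoefXM !fcoef_zeval.
have eqX : (if (0 < m j)%N then zsum (fun n => fcoef (m - U_(j))%MM (b n) * w ^ n) else 0) * w ^ e =
    zsum (fun n => - (- (fcoef m (fpsX j * b (n - e)) * w ^ n))).
  rewrite -[RHS](zsum_shift e); case: ifP => mj; last first.
    rewrite mul0r -[LHS]zsum0; apply: eq_zsum => n.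
    by rewrite addrK fcoefXM mj mul0r !oppr0.
  rewrite mulrC mulr_zsumr; last exact: tame_bounded.
  apply: eq_zsum => n; rewrite opprK addrK fcoefXM mj expfzDr // mulrC -mulrA.
  by [].
rewrite eqX; apply/eqP; rewrite subr_eq -zsumD.
- apply/eqP/eq_zsum => n; rewrite opprK -mulrDl -fcoefD -step subrK //.
- have [D1 h1] := tame_bounded w m tb.
  exists (mdeg m + `|e| + D1)%N => n lt_n; rewrite -step fcoefB mulrBl h1 ?sub0r; last by lia.
  rewrite fcoefXM; case: ifP => _; rewrite ?mul0r ?oppr0 // tb ?mul0r ?oppr0 //.
  have : (mdeg (m - U_(j))%MM <= mdeg m)%N.
    by rewrite !mdegE; apply: leq_sum => k _; rewrite mnmBE leq_subr.
  lia.
- exists (mdeg m + `|e|)%N => n lt_n; rewrite fcoefXM opprK; case: ifP => _; rewrite ?mul0r // tb ?mul0r //.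
  have : (mdeg (m - U_(j))%MM <= mdeg m)%N.
    by rewrite !mdegE; apply: leq_sum => k _; rewrite mnmBE leq_subr.
  lia.
Qed.

Lemma zeval_one w : zeval w (@zser_one K F) = 1.
Proof.
apply: fpsP => m; rewrite -[LHS]/(fcoef m _) fcoef_zeval.
rewrite -[RHS]mulr1 -(expr0z w) -(zsum_delta 0 (fun n => fps_coef 1 m * w ^ n)).
by apply: eq_zsum => n; rewrite /zser_one; case: eqP => // _; rewrite raddf0 mul0r.
Qed.

Definition geom_factor w (j : 'I_K) : S :=
  (1 - fpsC w * fpsX j) * (1 - fpsC w^-1 * fpsX j).

Lemma zeval_geom_factor w j a : w != 0 -> tame a ->
  geom_factor w j * zeval w (zser_mul (zser_mul (@zgeom K F j) (@zgeomV K F j)) a) = zeval w a.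
Proof.
move=> w0 ta; have tV := tame_rev (@tame_zgeom K F j); have tg := @tame_zgeom K F j.
have step1 : geom_step j 1 (zser_mul (@zgeom K F j) (@zgeomV K F j)) (@zgeomV K F j).
  by rewrite -[X in geom_step _ _ _ X](zser_mul1 (@zgeomV K F j)); apply: geom_step_mul (geom_step_zgeom F j).
have tgV : tame (zser_mul (@zgeom K F j) (@zgeomV K F j)) by apply: tame_zser_mul.
have e1 := zeval_step w0 (tame_zser_mul tgV ta) (geom_step_mul tgV ta step1).
have e2 := zeval_step w0 (tame_zser_mul tV ta) (geom_step_mul tV ta (geom_step_zgeomV F j)).
rewrite zser_mul1 exprN1 in e2; rewrite expr1z in e1.
by rewrite /geom_factor [X in X * _]mulrC -mulrA e1 e2.
Qed.

Lemma zeval_f_ser w : w != 0 -> \prod_j geom_factor w j * zeval w (@f_ser K F) = 1.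
Proof.
move=> w0; suff [] : tame (@f_ser K F) /\ \prod_j geom_factor w j * zeval w (@f_ser K F) = 1 by [].
rewrite /f_ser; elim/big_rec2: _ => [|j a P _ [ta IH]].
  by split; [exact: tame_one|rewrite mul1r zeval_one].
split.
  apply: tame_zser_mul ta; apply: tame_zser_mul; first exact: tame_zgeom.
  exact: tame_rev (@tame_zgeom K F j).
by rewrite [_ * P]mulrC -mulrA zeval_geom_factor.
Qed.

(** [zeval_f_ser] exhibits an inverse of the product, so every factor is a unit and [^-1] is a true
    inverse. *)
Lemma prod_geom_factorV w : w != 0 ->
  \prod_j (geom_factor w j)^-1 = zeval w (@f_ser K F).
Proof.
move=> /zeval_f_ser eval1; have unit_prod : \prod_j geom_factor w j \is a GRing.unit.
  by apply/unitrPr; exists (zeval w (@f_ser K F)).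
rewrite prodrV; last first.
  move=> j _; move: unit_prod; rewrite (bigD1 j) //= unitrM => /andP[] //.
by apply: (mulrI unit_prod); rewrite mulrV ?eval1.
Qed.

(** The cut gives the finite support that the determinant identity requires; as f_n has order at
    least |n| in y, nothing changes below degree d. *)
Definition f_trunc (d : nat) (n : int) : S := if (`|n| < d)%N then @f_ser K F n else 0.

Lemma f_trunc_even d n : f_trunc d (- n) = f_trunc d n.
Proof. by rewrite /f_trunc f_ser_even abszN. Qed.

Lemma f_trunc_far d (n : int) : (d <= `|n|)%N -> f_trunc d n = 0.
Proof. by rewrite /f_trunc ltnNge => ->. Qed.

Lemma f_trunc_eqm d n : eqm d (@f_ser K F n) (f_trunc d n).
Proof.
move=> m lt_m; rewrite /f_trunc; case: ltnP => // le_dn.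
by rewrite (@tame_f_ser K F n) ?raddf0 // (leq_trans lt_m).
Qed.

Lemma gen_val_eqm d w : eqm d (zeval w (@f_ser K F)) (gen_val (@fpsC K F) (f_trunc d) w).
Proof.
move=> m lt_m; rewrite fcoef_zeval /gen_val (zsum_raddf (fcoef m)); last first.
  exact: zbounded_mulf (@f_trunc_far d) _.
by apply: eq_zsum => n; rewrite -[RHS]/(fcoef m (_ * fpsC _)) fcoefMC (f_trunc_eqm n lt_m).
Qed.

End Evaluation.

(** * Sums over generalized partitions *)

Section Shifted.
Variable k : nat.
Implicit Types (rho : genpart k).

Definition shifted rho (i : 'I_k) : nat := tnth rho i + (k.-1 - i).

Fact zero_genpart_sorted : sorted geq (nseq_tuple k 0%N).
Proof. by apply/(sortedP 0%N) => i _; rewrite !nth_nseq; case: ifP; case: ifP. Qed.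
Definition zero_genpart : genpart k := GenPart zero_genpart_sorted.

(** For strictly decreasing T the tuple is weakly decreasing, so the default [zero_genpart] is not
    taken. *)
Definition part_of D (T : {ffun 'I_k -> 'I_D}) : genpart k :=
  insubd zero_genpart [tuple (T i - (k.-1 - i))%N | i < k].

(** T i exceeds the k - 1 - i distinct values that follow it; hence the natural subtraction in
    [part_of] is exact. *)
Lemma decr_ge D (T : {ffun 'I_k -> 'I_D}) (i : 'I_k) : decr T -> (k.-1 - i <= T i)%N.
Proof.
move/decrP => dT; move def_n: (k.-1 - i)%N => n; elim: n i def_n => // n IH i def_n.
have lt_i : (i.+1 < k)%N by lia.
have := dT i (Ordinal lt_i) (ltnSn i); have := IH (Ordinal lt_i); rewrite /=.
by move/(_ ltac:(lia)); apply: leq_ltn_trans.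
Qed.

Lemma shifted_part_of D (T : {ffun 'I_k -> 'I_D}) i : decr T -> shifted (part_of T) i = T i.
Proof.
move=> dT; have dT' := decrP _ dT.
rewrite /shifted /part_of val_insubd ifT ?tnth_mktuple ?subnK ?decr_ge //.
apply/(sortedP 0%N) => j; rewrite size_tuple => lt_j.
have lt_j' : (j < k)%N by apply: ltnW.
have nthE (a : 'I_k) : nth 0%N [tuple (T i - (k.-1 - i))%N | i < k] a = (T a - (k.-1 - a))%N.
  by rewrite -tnth_nth tnth_mktuple.
have := nthE (Ordinal lt_j); have := nthE (Ordinal lt_j'); rewrite /= => -> ->.
have := dT' (Ordinal lt_j') (Ordinal lt_j) (ltnSn j).
by have := decr_ge (Ordinal lt_j) dT; rewrite /geq /=; lia.
Qed.

Lemma shifted_decr rho (i j : 'I_k) : (i < j)%N -> (shifted rho j < shifted rho i)%N.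
Proof.
move=> lt_ij; have : (tnth rho j <= tnth rho i)%N.
  rewrite !(tnth_nth 0%N).
  have geq_tr : transitive geq by move=> a b c h1 h2; apply: leq_trans h2 h1.
  have := sorted_leq_nth geq_tr leqnn 0%N (valP rho); apply; rewrite ?inE ?size_tuple //.
  exact: ltnW.
rewrite /shifted; move: (ltn_ord j) lt_ij; lia.
Qed.

Lemma shifted_inj rho rho' : shifted rho =1 shifted rho' -> rho = rho'.
Proof.
move=> eq_rho; apply/val_inj/eq_from_tnth => i; apply/eqP.
by rewrite -(eqn_add2r (k.-1 - i)); apply/eqP/eq_rho.
Qed.

Variables (V : zmodType) (D : nat) (u : genpart k -> V).
Hypothesis u0 : forall rho j, (D <= shifted rho j)%N -> u rho = 0.

Definition small_parts : seq (genpart k) :=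
  map (@part_of D) (filter (@decr D k) (enum {: {ffun 'I_k -> 'I_D}})).

Lemma small_parts_out rho : rho \notin small_parts -> u rho = 0.
Proof.
move=> rho_out; apply: contraNeq rho_out => u_neq0.
have lt_D j : (shifted rho j < D)%N.
  by rewrite ltnNge; apply: contra u_neq0 => /u0 ->.
pose T : {ffun 'I_k -> 'I_D} := [ffun j => Ordinal (lt_D j)].
have dT : decr T by apply/decrP => i j lt_ij; rewrite !ffunE; apply: shifted_decr.
apply/mapP; exists T; first by rewrite mem_filter dT mem_enum.
by apply: shifted_inj => i; rewrite shifted_part_of // ffunE.
Qed.

Lemma sum_genpart :
  \sum_(rho \in [set: genpart k]%classic) u rho =
  \sum_(T : {ffun 'I_k -> 'I_D} | decr T) u (part_of T).
Proof.
rewrite (@fsum_seq _ _ small_parts); last exact: small_parts_out.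
  by rewrite big_map big_filter big_enum_cond.
rewrite map_inj_in_uniq; first exact/filter_uniq/enum_uniq.
move=> T T'.
rewrite !mem_filter => /andP[dT _] /andP[dT' _] eq_T; apply/ffunP => i; apply/ord_inj.
by rewrite -(shifted_part_of i dT) -(shifted_part_of i dT') eq_T.
Qed.

Lemma finite_genpart_support : finite_set [set rho | u rho != 0]%classic.
Proof.
apply: sub_finite_set (finite_seq small_parts) => rho /=.
by apply: contra_neqT => /small_parts_out.
Qed.

End Shifted.

(** * Both skew functions in shifted coordinates *)

Section SkewDeterminants.
Variables (K : nat) (F : fieldType).
Local Notation S := (fps K F).

(** With one-based i and j, (k - i) + (k - j) + 1 = 2k + 1 - i - j, so the shifted entries absorb
    all terms depending on the indices. *)
Lemma SOstar_fold k (rho lambda : genpart k) :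
  SOstar K F rho lambda =
  \det (\matrix_(i, j) fold_coef (@f_ser K F) (shifted lambda i) (shifted rho j)).
Proof.
rewrite /SOstar; congr (\det _); apply/matrixP => i j; rewrite !mxE /fold_coef /shifted.
by move: (ltn_ord i) (ltn_ord j) => lt_i lt_j; congr (f_ser _ - f_ser _); lia.
Qed.

(** Transposition and evenness of f. The sum over tau, which runs over the second argument, can thus
    use the same estimates as the sum over rho. *)
Lemma SOstar_sym k (rho lambda : genpart k) : SOstar K F rho lambda = SOstar K F lambda rho.
Proof.
rewrite !SOstar_fold -[LHS]det_tr; congr (\det _); apply/matrixP => i j; rewrite !mxE.
by rewrite /fold_coef -f_ser_even opprB addrC [_%:Z + _%:Z]addrC addrC.
Qed.

Lemma SOstar_eqm d k (rho lambda : genpart k) :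
  eqm d (SOstar K F rho lambda)
    (\det (\matrix_(i, j) fold_coef (@f_trunc K F d) (shifted lambda i) (shifted rho j))).
Proof.
rewrite SOstar_fold; apply: eqm_det => i j; rewrite !mxE.
by apply: eqmD; [|apply: eqmN]; apply: f_trunc_eqm.
Qed.

(** Column j of the truncated matrix is zero, its index being at distance at least d from every row
    index. *)
Lemma SOstar_vanish d D k (rho lambda : genpart k) (c : S) (j : 'I_k) m :
    (mdeg m < d)%N -> (forall i, (shifted lambda i + d <= D)%N) -> (D <= shifted rho j)%N ->
  fcoef m (c * SOstar K F rho lambda) = 0.
Proof.
move=> lt_m leD le_j; rewrite (eqmM (@eqm_refl _ _ d c) (@SOstar_eqm d _ rho lambda) lt_m).
rewrite (expand_det_col _ j) big1 ?mulr0 ?raddf0 // => i _.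
rewrite mxE /fold_coef !f_trunc_far ?subrr ?mul0r //; have := leD i; lia.
Qed.

Variables (N : nat) (x : 'I_N -> F).
Hypothesis char0 : forall n : nat, n.+1%:R != 0 :> F.
Hypothesis N_gt0 : (0 < N)%N.

Lemma so_shifted l (rho : genpart (l + N)) (mu : genpart l) :
  so x rho mu = \det (row_mx
    (\matrix_(a, i) cz (hser x) ((shifted rho a)%:Z - N%:Z - (shifted mu i)%:Z))
    (\matrix_(a, j) odd_column x (j : 'I_N) (shifted rho a)%:Z)).
Proof.
rewrite so_det ?leq_addr //.
(* [so_det] indexes its matrix by the size of the tuple, which equals l + N only propositionally. *)
have cast k k' (g : nat -> int) (h : ser F) (s : seq nat) : k = k' ->
    \det (so_mx (fun a : 'I_k => g a) h s) = \det (so_mx (fun a : 'I_k' => g a) h s).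
  by move=> ->.
rewrite (cast _ _ (fun a => (nth 0%N rho a)%:Z - a%:Z) _ _ (size_tuple rho)).
congr (\det _); apply/matrixP => a c; rewrite !mxE size_tuple.
have lt_a := ltn_ord a.
case: fintype.splitP => [i def_c|j def_c]; rewrite !mxE def_c /shifted !(tnth_nth 0%N).
  by have lt_i := ltn_ord i; congr (cz _ _); lia.
by rewrite /odd_column addKn; congr (iter _ _ _ _); lia.
Qed.

End SkewDeterminants.

(** * Both sums as determinants, and their comparison *)

Section MainIdentity.
Variables (K : nat) (F : fieldType) (l N : nat) (x : 'I_N -> F).
Local Notation S := (fps K F).
Hypothesis char0 : forall n : nat, n.+1%:R != 0 :> F.
Hypothesis N_gt0 : (0 < N)%N.
Hypothesis x_neq0 : forall m, x m != 0.
Hypothesis x_neq1 : forall m, x m != 1.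
Hypothesis x_neqV : forall m, x m - (x m)^-1 != 0.
Hypothesis xi_inj : injective (fun m => x m + (x m)^-1).
Variables (mu : genpart l) (lambda : genpart (l + N)).

Local Notation Fm := (@fpsC K F).
Local Notation h := (cz (hser x)).
Definition lhs_term (rho : genpart (l + N)) : S := fpsC (so x rho mu) * SOstar K F rho lambda.
Definition rhs_term (tau : genpart l) : S := fpsC (so x lambda tau) * SOstar K F mu tau.

Variables (d D : nat).
Hypothesis D_lambda : forall a, (shifted lambda a + d <= D)%N.
Hypothesis D_mu : forall i, (shifted mu i + d <= D)%N.
Local Notation f := (@f_trunc K F d).

Lemma fcoef_sum_lhs m : (mdeg m < d)%N -> fcoef m (fps_sum lhs_term) = fcoef m
  (\det (row_mx
    (\matrix_(a, i) \sum_(L < D) fold_coef f (shifted lambda a) L *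
        Fm (h (L%:Z - N%:Z - (shifted mu i)%:Z)))
    (\matrix_(a, j) \sum_(L < D) fold_coef f (shifted lambda a) L *
        Fm (odd_column x (j : 'I_N) L%:Z)))).
Proof.
(* One function of the column index covers both kinds of columns, so the row form of Cauchy-Binet
   applies to the whole matrix. *)
move=> lt_m; pose e (L : nat) (c : 'I_(l + N)) : F :=
  match fintype.split c with
  | inl i => h (L%:Z - N%:Z - (shifted mu i)%:Z)
  | inr j => odd_column x j L%:Z
  end.
have -> : row_mx
    (\matrix_(a, i) \sum_(L < D) fold_coef f (shifted lambda a) L *
        Fm (h (L%:Z - N%:Z - (shifted mu i)%:Z)))
    (\matrix_(a, j) \sum_(L < D) fold_coef f (shifted lambda a) L *
        Fm (odd_column x (j : 'I_N) L%:Z)) =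
    \matrix_(a, c) \sum_(L < D) fold_coef f (shifted lambda a) L * Fm (e L c).
  by apply/matrixP => a c; rewrite !mxE /e; case: fintype.splitP => j _; rewrite mxE.
rewrite -(cauchy_binet_rows (fun (L : 'I_D) c => Fm (e L c))
  (fun a (L : 'I_D) => fold_coef f (shifted lambda a) L)).
rewrite raddf_sum /= -[LHS]/(\sum_(rho \in [set: genpart (l + N)]%classic) fcoef m (lhs_term rho)).
rewrite (@sum_genpart _ _ D) => [|rho j le_j]; last exact: SOstar_vanish lt_m D_lambda le_j.
apply: eq_bigr => T dT.
rewrite /lhs_term (eqmM (@eqm_refl _ _ d _) (@SOstar_eqm _ _ d _ _ _) lt_m).
rewrite -[RHS]/(fcoef m (_ * _)); congr (fcoef m (_ * _)); last congr (\det _).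
  rewrite so_shifted // -det_map_mx; congr (\det _); apply/matrixP => a c; rewrite !mxE /e.
  by case: fintype.splitP => j _; rewrite mxE shifted_part_of.
by apply/matrixP => i j; rewrite !mxE shifted_part_of.
Qed.

Lemma fcoef_sum_rhs m : (mdeg m < d)%N -> fcoef m (fps_sum rhs_term) = fcoef m
  (\det (row_mx
    (\matrix_(a, i) \sum_(p < D) fold_coef f (shifted mu i) p *
        Fm (h ((shifted lambda a)%:Z - N%:Z - p%:Z)))
    (\matrix_(a, j) Fm (odd_column x (j : 'I_N) (shifted lambda a)%:Z)))).
Proof.
move=> lt_m; rewrite -(cauchy_binet_cols
  (fun a (p : 'I_D) => Fm (h ((shifted lambda a)%:Z - N%:Z - p%:Z)))
  (fun i (p : 'I_D) => fold_coef f (shifted mu i) p)).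
rewrite raddf_sum /= -[LHS]/(\sum_(tau \in [set: genpart l]%classic) fcoef m (rhs_term tau)).
rewrite (@sum_genpart _ _ D) => [|tau j le_j]; last first.
  by rewrite /rhs_term SOstar_sym; exact: SOstar_vanish lt_m D_mu le_j.
apply: eq_bigr => T dT.
rewrite /rhs_term SOstar_sym (eqmM (@eqm_refl _ _ d _) (@SOstar_eqm _ _ d _ _ _) lt_m).
rewrite -[RHS]/(fcoef m (_ * _)); congr (fcoef m (_ * _)); last congr (\det _).
  rewrite so_shifted // -det_map_mx; congr (\det _); apply/matrixP => a c; rewrite !mxE.
  by case: fintype.splitP => j _; rewrite !mxE ?shifted_part_of.
by apply/matrixP => i j; rewrite !mxE shifted_part_of.
Qed.

Lemma summable_lhs_at m : (mdeg m < d)%N ->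
  finite_set [set rho | fps_coef (lhs_term rho) m != 0]%classic.
Proof.
move=> lt_m; apply: (@finite_genpart_support _ _ D (fun rho => fcoef m (lhs_term rho))).
by move=> rho j le_j; exact: SOstar_vanish lt_m D_lambda le_j.
Qed.

Lemma summable_rhs_at m : (mdeg m < d)%N ->
  finite_set [set tau | fps_coef (rhs_term tau) m != 0]%classic.
Proof.
move=> lt_m; apply: (@finite_genpart_support _ _ D (fun tau => fcoef m (rhs_term tau))).
by move=> tau j le_j; rewrite /rhs_term SOstar_sym; exact: SOstar_vanish lt_m D_mu le_j.
Qed.

Lemma main_identity_at m : (mdeg m < d)%N ->
  fcoef m (fps_sum lhs_term) =
  fcoef m (\prod_(i < N) \prod_(j < K) (geom_factor (x i) j)^-1 * fps_sum rhs_term).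
Proof.
move=> lt_m; rewrite fcoef_sum_lhs //.
rewrite (core_identity N_gt0 x_neq0 x_neq1 x_neqV xi_inj Fm
  (@f_trunc_even K F d) (@f_trunc_far K F d) D_lambda D_mu).
apply: eqmM lt_m => [|m' lt_m']; last by rewrite fcoef_sum_rhs.
apply: eqm_prod => i _ m' lt_m'; rewrite prod_geom_factorV //.
by rewrite (gen_val_eqm (x i) lt_m').
Qed.

End MainIdentity.

Lemma skew_cauchy_identity (K : nat) (F : fieldType) (l N : nat) (x : 'I_N -> F)
    (mu : genpart l) (lambda : genpart (l + N)) :
    (forall n : nat, n.+1%:R != 0 :> F) -> (0 < N)%N ->
    (forall m, x m != 0) -> (forall m, x m != 1) -> (forall m, x m - (x m)^-1 != 0) ->
    injective (fun m => x m + (x m)^-1) ->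
  [/\ fps_summable (lhs_term K x mu lambda), fps_summable (rhs_term K x mu lambda) &
      fps_sum (lhs_term K x mu lambda) =
      (\prod_(i < N) \prod_(j < K) (geom_factor (x i) j)^-1) * fps_sum (rhs_term K x mu lambda)].
Proof.
move=> char0 N0 x0 x1 xV xi_inj.
have bound (m : 'X_{1..K}) : exists D, (forall a, (shifted lambda a + (mdeg m).+1 <= D)%N) /\
    (forall i, (shifted mu i + (mdeg m).+1 <= D)%N).
  (* The window depends on the monomial m: it leaves room for d = |m| + 1 beyond the shifted entries
     of both partitions. *)
  exists (\max_a shifted lambda a + \max_i shifted mu i + (mdeg m).+1)%N; split=> i; rewrite leq_add2r.
    by rewrite (leq_trans (leq_bigmax i)) // leq_addr.
  by rewrite (leq_trans (leq_bigmax i)) // leq_addl.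
split.
- by move=> m; have [D [D1 D2]] := bound m; apply: summable_lhs_at (ltnSn (mdeg m)).
- by move=> m; have [D [D1 D2]] := bound m; apply: summable_rhs_at (ltnSn (mdeg m)).
- apply: fpsP => m; have [D [D1 D2]] := bound m.
  exact: (main_identity_at char0 N0 x0 x1 xV xi_inj D1 D2 (ltnSn (mdeg m))).
Qed.

(** The difference of the two sums, multiplied by a b, factors as (a - b)(a b - 1). *)
Lemma add_inv_inj (F : fieldType) (a b : F) :
  a != 0 -> b != 0 -> a * b != 1 -> a + a^-1 = b + b^-1 -> a = b.
Proof.
move=> a0 b0 ab1 eq_ab; have : (a - b) * (a * b - 1) = 0.
  rewrite (_ : _ * _ = a * b * ((a + a^-1) - (b + b^-1))); first by rewrite eq_ab subrr mulr0.
  by field; rewrite a0 b0.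
by move/eqP; rewrite mulf_eq0 !subr_eq0 (negPf ab1) orbF => /eqP.
Qed.

(** * Indeterminates in the fraction field are in general position *)

Section FractionVariables.
Variables (R : realType) (N : nat).
Local Notation P := {mpoly (complex R)[N]}.
Local Notation F := {fraction P}.
Let x (i : 'I_N) : F := tofrac ('X_i : P).

Lemma fraction_mpoly_char0 (n : nat) : n.+1%:R != 0 :> F.
Proof.
rewrite -(rmorph_nat (@tofrac P)) tofrac_eq0 -(rmorph_nat (@mpolyC N (complex R))).
by rewrite mpolyC_eq0 Num.Theory.pnatr_eq0.
Qed.

Lemma tofrac_inj : injective (@tofrac P).
Proof.
by move=> p q /eqP; rewrite -subr_eq0 -rmorphB tofrac_eq0 subr_eq0 => /eqP.
Qed.

Lemma fraction_var_neq0 i : x i != 0.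
Proof.
rewrite /x tofrac_eq0; apply/eqP => /(congr1 (meval (fun=> 1))).
by rewrite mevalXU meval0 => /eqP; rewrite oner_eq0.
Qed.

Lemma fraction_var_neq1 i : x i != 1.
Proof.
apply/eqP; rewrite -(rmorph1 (@tofrac P)) => /tofrac_inj /(congr1 (meval (fun=> 0))).
by rewrite mevalXU meval1 => /esym/eqP; rewrite oner_eq0.
Qed.

Lemma fraction_var_mul_neq1 i j : x i * x j != 1.
Proof.
apply/eqP; rewrite -(rmorph1 (@tofrac P)) -rmorphM => /tofrac_inj /(congr1 (meval (fun=> 0))).
by rewrite mevalM !mevalXU meval1 mul0r => /esym/eqP; rewrite oner_eq0.
Qed.

Lemma fraction_var_neqV i : x i - (x i)^-1 != 0.
Proof.
rewrite subr_eq0; apply: contra (fraction_var_mul_neq1 i i) => /eqP eq_x.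
by rewrite {2}eq_x mulfV // fraction_var_neq0.
Qed.

Lemma fraction_var_sum_inj : injective (fun i => x i + (x i)^-1).
Proof.
move=> i j.
move/(add_inv_inj (fraction_var_neq0 i) (fraction_var_neq0 j) (fraction_var_mul_neq1 i j)).
(* Evaluation at the indicator of i separates the variable i from the others. *)
move/tofrac_inj/(congr1 (meval (fun k => (k == i)%:R))).
rewrite !mevalXU eqxx; by case: eqP => // _ /eqP; rewrite oner_eq0.
Qed.

End FractionVariables.

Theorem theorem3p10 (R : realType) (l N K : nat)
    (hl : (1 <= l)%N) (hN : (1 <= N)%N) (hK : (1 <= K)%N)
    (mu : genpart l) (lambda : genpart (l + N))
    (hlambda : (gp_length lambda < l + N)%N) :
  let F : fieldType := {fraction {mpoly (complex R)[N]}} in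
  let x (i : 'I_N) : F := tofrac ('X_i : {mpoly (complex R)[N]}) in
  let lhs (rho : genpart (l + N)) : fps K F :=
    fpsC (so x rho mu) * SOstar K F rho lambda in
  let rhs (tau : genpart l) : fps K F :=
    fpsC (so x lambda tau) * SOstar K F mu tau in
  [/\ fps_summable lhs, fps_summable rhs &
      fps_sum lhs =
      (\prod_(i < N) \prod_(j < K)
         ((1 - fpsC (x i) * fpsX j) * (1 - fpsC ((x i)^-1) * fpsX j))^-1)
      * fps_sum rhs].
Proof.
exact: skew_cauchy_identity (@fraction_mpoly_char0 R N) hN (@fraction_var_neq0 R N)
  (@fraction_var_neq1 R N) (@fraction_var_neqV R N) (@fraction_var_sum_inj R N).
Qed.
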